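(* The classes of radical Banach Lie algebras of the four preradicals $P_{\mathfrak{S}},P_{\mathfrak{S}^{\max}},P_{\mathfrak{J}},P_{\mathfrak{J}^{\max}}$ and of the Frattini radical $\mathcal{F}$ coincide: $$\mathbf{Rad}(\mathcal{F})=\mathbf{Rad}(P_{\mathfrak{S}})=\mathbf{Rad}(P_{\mathfrak{S}^{\max}})=\mathbf{Rad}(P_{\mathfrak{J}})=\mathbf{Rad}(P_{\mathfrak{J}^{\max}}),$$ while the classes of their semisimple algebras satisfy $$\mathbf{Sem}(P_{\mathfrak{J}^{\max}})\subsetneqq\mathbf{Sem}(P_{\mathfrak{S}^{\max}})\subsetneqq\mathbf{Sem}(P_{\mathfrak{J}})\subsetneqq\mathbf{Sem}(P_{\mathfrak{S}})\subsetneqq\mathbf{Sem}(\mathcal{F}),$$ where all the inclusions are proper.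
   Context: A Banach Lie algebra is a complex Lie algebra $\mathcal{L}$ which is a Banach space in some norm such that, for some constant $t_{\mathcal{L}}>0$, $\|[a,b]\|\leq t_{\mathcal{L}}\|a\|\|b\|$ for all $a,b\in\mathcal{L}$. For a Banach Lie algebra $\mathcal{L}$ let: $\mathfrak{S}_{\mathcal{L}}$ be the family of all proper closed Lie subalgebras of finite codimension in $\mathcal{L}$; $\mathfrak{S}^{\max}_{\mathcal{L}}$ the family of all maximal proper closed Lie subalgebras of finite codimension; $\mathfrak{J}_{\mathcal{L}}$ the family of all proper closed Lie ideals of finite codimension; $\mathfrak{J}^{\max}_{\mathcal{L}}$ the family of all maximal proper closed Lie ideals of finite codimension. For $\Gamma\in\{\mathfrak{S},\mathfrak{S}^{\max},\mathfrak{J},\mathfrak{J}^{\max}\}$ put $P_{\Gamma}(\mathcal{L})=\bigcap_{L\in\Gamma_{\mathcal{L}}}L$ if $\Gamma_{\mathcal{L}}\neq\varnothing$, and $P_{\Gamma}(\mathcal{L})=\mathcal{L}$ if $\Gamma_{\mathcal{L}}=\varnothing$; this is a closed Lie ideal of $\mathcal{L}$. For a map $R$ assigning to each Banach Lie algebra a closed Lie ideal of it, put $\mathbf{Sem}(R)=\{\mathcal{L}: R(\mathcal{L})=\{0\}\}$ and $\mathbf{Rad}(R)=\{\mathcal{L}: R(\mathcal{L})=\mathcal{L}\}$. Define $R^{0}(\mathcal{L})=\mathcal{L}$, $R^{\alpha+1}(\mathcal{L})=R(R^{\alpha}(\mathcal{L}))$, $R^{\alpha}(\mathcal{L})=\bigcap_{\alpha'<\alpha}R^{\alpha'}(\mathcal{L})$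 for limit ordinals $\alpha$; the chain stabilizes and $R^{\circ}(\mathcal{L})$ denotes its stable value. The Frattini radical is $\mathcal{F}=P_{\mathfrak{S}}^{\circ}=P_{\mathfrak{J}}^{\circ}=P_{\mathfrak{S}^{\max}}^{\circ}=P_{\mathfrak{J}^{\max}}^{\circ}$ (these four maps coincide). *)

(* Defs.v *)
From HB Require Import structures.
From mathcomp Require Import all_boot all_order all_algebra.
From mathcomp Require Import all_classical all_reals all_analysis.
From mathcomp Require Import wochoice.
From mathcomp Require Import complex.

Set Implicit Arguments.
Unset Strict Implicit.
Unset Printing Implicit Defensive.

Import Order.TTheory GRing.Theory Num.Theory.
Import numFieldNormedType.Exports.

Local Open Scope classical_set_scope.
Local Open Scope ring_scope.

(* Norms of normed spaces over [R[i]] take values in [R[i]]; [0 < t] in [R[i]]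
   forces [t] to be real. *)
HB.mixin Record isBanachLie (R : realType) L & CompleteNormedModule R[i] L := {
  lie : L -> L -> L;
  lie_linearl : forall b : L, linear (fun a : L => lie a b);
  lie_linearr : forall a : L, linear (fun b : L => lie a b);
  lie_alternating : forall a : L, lie a a = 0;
  lie_jacobi : forall a b c : L,
    lie a (lie b c) + lie b (lie c a) + lie c (lie a b) = 0;
  lie_bounded : exists2 t : R[i], 0 < t &
    forall a b : L, `|lie a b| <= t * `|a| * `|b|
}.

#[short(type="banachLieType")]
HB.structure Definition BanachLie (R : realType) :=
  {L of CompleteNormedModule R[i] L & isBanachLie R L}.

Section Subalgebras.
Context {R : realType} {L : banachLieType R}.
Implicit Types M N : set L.

Definition linear_subspace M :=
  M 0 /\ forall (k : R[i]) x y, M x -> M y -> M (k *: x + y).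

Definition lie_subalgebra M :=
  linear_subspace M /\ forall a b, M a -> M b -> M (lie a b).

Definition lie_ideal M :=
  linear_subspace M /\ forall a b, M b -> M (lie a b).

(* The quotient [L / M] is spanned by finitely many cosets. *)
Definition finite_codim M :=
  exists n (e : 'I_n -> L), forall x, exists c : 'I_n -> R[i],
    M (x - \sum_i c i *: e i).

Definition closed_subalgebra M := lie_subalgebra M /\ closed M.

Lemma lie_ideal_subalgebra M : lie_ideal M -> lie_subalgebra M.
Proof. by move=> [sM iM]; split=> // a b _; exact: iM. Qed.

Lemma closed_subalgebra_setT : closed_subalgebra [set: L].
Proof. by split; [split | exact: closedT]. Qed.

Lemma closed_subalgebra_bigcap I (D : set I) (F : I -> set L) :
  (forall i, D i -> closed_subalgebra (F i)) ->
  closed_subalgebra (\bigcap_(i in D) F i).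
Proof.
move=> FD; split; last by apply: closed_bigI => i /FD[].
split; first split.
- by move=> i /FD[[[]]].
- move=> k x y Fx Fy i Di; have [[[_ H] _] _] := FD i Di.
  by apply: H; [exact: Fx | exact: Fy].
- move=> a b Fa Fb i Di; have [[_ H] _] := FD i Di.
  by apply: H; [exact: Fa | exact: Fb].
Qed.

End Subalgebras.

Record closedSubalgebra (R : realType) (L : banachLieType R) :=
  ClosedSubalgebra {
    closedSubalgebra_set :> set L;
    closedSubalgebraP : closed_subalgebra closedSubalgebra_set }.

Lemma closedSubalgebra_inj (R : realType) (L : banachLieType R) :
  injective (@closedSubalgebra_set R L).
Proof.
move=> [M pM] [N pN] /= MN; subst N; congr ClosedSubalgebra.
exact: Prop_irrelevance.
Qed.

Definition sub_pred (R : realType) (L : banachLieType R)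
  (M : closedSubalgebra L) : {pred L} := fun x => x \in (M : set L).

(* A closed subalgebra, with the restricted norm and bracket, as a Banach Lie
   algebra in its own right. *)
Record sub_banachLie (R : realType) (L : banachLieType R)
    (M : closedSubalgebra L) := SubBanachLie {
  sub_val : L;
  sub_valP : sub_val \in sub_pred M }.

Arguments sub_val {R L M} _.

Section SubBanachLie.
Context {R : realType} {L : banachLieType R} (M : closedSubalgebra L).

Lemma sub_predP x : reflect ((M : set L) x) (x \in sub_pred M).
Proof. exact: (iffP (asboolP _)). Qed.

Fact sub_pred_submod_closed : submod_closed (sub_pred M).
Proof.
have [[[M0 ML] _] _] := closedSubalgebraP M.
by split=> [|k x y /sub_predP Mx /sub_predP My]; apply/sub_predP; auto.
Qed.

HB.instance Definition _ :=
  GRing.isSubmodClosed.Build R[i] L (sub_pred M) sub_pred_submod_closed.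

Local Notation S := (sub_banachLie M).

HB.instance Definition _ := [isSub of S for @sub_val R L M].
HB.instance Definition _ := [Choice of S by <:].
HB.instance Definition _ := [SubChoice_isSubLmodule of S by <:].

Fact sub_ler_normD (x y : S) : `|val (x + y)| <= `|val x| + `|val y|.
Proof. by rewrite raddfD ler_normD. Qed.

Fact sub_normrZ (k : R[i]) (x : S) : `|val (k *: x)| = `|k| * `|val x|.
Proof. by rewrite linearZ normrZ. Qed.

Fact sub_normr0_eq0 (x : S) : `|val x| = 0 -> x = 0.
Proof. by move=> /normr0_eq0 x0; apply: val_inj; rewrite raddf0. Qed.

HB.instance Definition _ := Lmodule_isNormed.Build R[i] S
  sub_ler_normD sub_normrZ sub_normr0_eq0.

Lemma sub_normE (x : S) : `|x| = `|val x|.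
Proof. by []. Qed.

Lemma sub_ballP (x y : S) (e : R[i]) :
  ball (val x) e (val y) <-> ball x e y.
Proof. by rewrite -!ball_normE /= sub_normE raddfB. Qed.

Fact sub_cauchy_cvg (F : set_system S) : ProperFilter F -> cauchy F -> cvg F.
Proof.
move=> FF /cauchyP Fc.
have /cauchy_cvg : cauchy (val @ F : set_system L).
  apply/cauchy_exP => e /Fc[x Fx]; exists (val x).
  apply: (@filterS _ F _ _ _ _ Fx) => y.
  by move=> /sub_ballP.
move=> /cvg_ex[l Fl].
have Ml : (M : set L) l.
  apply: (closedSubalgebraP M).2 => B /Fl FB.
  have [x Bx] := @filter_ex _ F FF _ FB.
  by exists (val x); split=> //; apply/sub_predP; exact: valP.
pose l' : S := SubBanachLie (introT (sub_predP l) Ml).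
apply/cvg_ex; exists l'; apply/cvg_ballP => e e0.
have /cvg_ballP/(_ e e0) Fle := Fl.
apply: (@filterS _ F _ (val @^-1` ball l e) (ball l' e)) Fle => y.
exact: (iffLR (sub_ballP l' y e)).
Qed.

HB.instance Definition _ := Uniform_isComplete.Build S sub_cauchy_cvg.

Fact sub_lie_subproof (x y : S) : lie (val x) (val y) \in sub_pred M.
Proof.
have [[_ Mlie] _] := closedSubalgebraP M.
by apply/sub_predP; apply: Mlie; apply/sub_predP; exact: valP.
Qed.

Definition sub_lie (x y : S) : S := SubBanachLie (sub_lie_subproof x y).

Fact sub_lie_linearl (y : S) : linear (sub_lie^~ y).
Proof.
by move=> k a b; apply: val_inj; exact: (lie_linearl (val y) k (val a) (val b)).
Qed.

Fact sub_lie_linearr (x : S) : linear (sub_lie x).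
Proof.
by move=> k a b; apply: val_inj; exact: (lie_linearr (val x) k (val a) (val b)).
Qed.

Fact sub_lie_alternating (x : S) : sub_lie x x = 0.
Proof. by apply: val_inj; exact: lie_alternating. Qed.

Fact sub_lie_jacobi (a b c : S) :
  sub_lie a (sub_lie b c) + sub_lie b (sub_lie c a) + sub_lie c (sub_lie a b)
  = 0.
Proof. by apply: val_inj; exact: lie_jacobi. Qed.

Fact sub_lie_bounded : exists2 t : R[i], 0 < t &
  forall a b : S, `|sub_lie a b| <= t * `|a| * `|b|.
Proof.
have [t t0 tP] := @lie_bounded _ L; exists t => // a b.
exact: tP.
Qed.

HB.instance Definition _ := isBanachLie.Build R S sub_lie_linearl
  sub_lie_linearr sub_lie_alternating sub_lie_jacobi sub_lie_bounded.

Lemma closed_subalgebra_sub_val (N : closedSubalgebra S) :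
  closed_subalgebra (sub_val @` N).
Proof.
have [[[N0 NL] Nlie] Ncl] := closedSubalgebraP N.
split; first split; first split.
- by exists 0 => //; exact: (raddf0 val).
- move=> k _ _ [x Nx <-] [y Ny <-]; exists (k *: x + y); first exact: NL.
  exact: (linearP val).
- by move=> _ _ [x Nx <-] [y Ny <-]; exists (lie x y) => //; exact: Nlie.
move=> l lN.
have Ml : (M : set L) l.
  apply: ((closedSubalgebraP M).2) => B /lN[_ [[x Nx <-] Bx]].
  by exists (sub_val x); split=> //; apply/sub_predP; exact: valP.
exists (SubBanachLie (introT (sub_predP l) Ml)) => //.
apply: Ncl => B /nbhs_ballP[e /= e0 eB].
have [_ [[x Nx <-] xe]] := lN _ (nbhsx_ballx l e e0).
by exists x; split=> //; apply/eB/sub_ballP.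
Qed.

End SubBanachLie.

(* Every map occurring here takes values in closed Lie ideals; iterating it only
   requires its values to be closed subalgebras. *)
Definition preradical (R : realType) :=
  forall L : banachLieType R, closedSubalgebra L.

(* Classes of Banach Lie algebras are predicates rather than terms of type
   [set (banachLieType R)], which would be universe-inconsistent. *)
Definition Sem (R : realType) (P : preradical R) (L : banachLieType R) : Prop :=
  (P L : set L) = [set 0].

Definition Rad (R : realType) (P : preradical R) (L : banachLieType R) : Prop :=
  (P L : set L) = setT.

Definition class_eq (R : realType) (A B : banachLieType R -> Prop) : Prop :=
  forall L, A L <-> B L.

Definition class_proper (R : realType) (A B : banachLieType R -> Prop) : Prop :=
  (forall L, A L -> B L) /\ exists L, B L /\ ~ A L.

Section TransfiniteIteration.
Context {R : realType} (P : preradical R) (L : banachLieType R).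

(* [P(M)] for [M] regarded as a Banach Lie algebra, seen inside [L]. *)
Definition apply_sub (M : closedSubalgebra L) : closedSubalgebra L :=
  ClosedSubalgebra (closed_subalgebra_sub_val (P (sub_banachLie M))).

(* Ordinals are the positions in well-ordered types: [f] is the initial part
   [w |-> P^w(L)] of the transfinite chain indexed by [W]. *)
Definition transfinite_chain (W : eqType) (le : rel W)
    (f : W -> closedSubalgebra L) :=
  let lt v w := le v w && (v != w) in
  forall w,
  [/\ (forall v, ~~ lt v w) -> (f w : set L) = setT,
      forall v, lt v w -> (forall u, lt u w -> le u v) ->
        f w = apply_sub (f v)
    & (exists v, lt v w) ->
      (forall v, lt v w -> exists2 u, lt v u & lt u w) ->
      (f w : set L) = \bigcap_(v in [set v | lt v w]) (f v : set L)].

(* [M] is [P^alpha(L)] for some ordinal [alpha]. *)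
Definition transfinite_power (M : closedSubalgebra L) :=
  exists (W : eqType) (le : rel W) (f : W -> closedSubalgebra L) (w : W),
    [/\ well_order le, transfinite_chain le f & f w = M].

Definition stable_value (M : closedSubalgebra L) :=
  transfinite_power M /\ apply_sub M = M.

Lemma apply_sub_subset M : apply_sub M `<=` (M : set L).
Proof. by move=> _ [x _ <-]; apply/sub_predP; exact: valP. Qed.

Lemma closedSubalgebra_eq (M N : closedSubalgebra L) :
  (M : set L) `<=` N -> (N : set L) `<=` M -> M = N.
Proof. by move=> MN NM; apply: closedSubalgebra_inj; apply/seteqP. Qed.

Definition closedSubalgebra_bigcap (D : set (closedSubalgebra L)) :
    closedSubalgebra L :=
  ClosedSubalgebra (closed_subalgebra_bigcap
    (fun (M : closedSubalgebra L) (_ : D M) => closedSubalgebraP M)).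

Section Chain.
Context (W : eqType) (le : rel W) (woW : well_order le).

Let lt v w := le v w && (v != w).

Let woWT : wo_chain le W.
Proof. by move=> A _; exact: woW. Qed.

Let le_total v w : le v w || le w v.
Proof. by apply: (wo_chainW woWT). Qed.

Let le_anti v w : le v w -> le w v -> v = w.
Proof.
by move=> vw wv; apply: (wo_chain_antisymmetric woWT) => //; apply/andP.
Qed.

Lemma well_order_wf : well_founded (fun v w => lt v w).
Proof.
move=> w; apply: contrapT => nw.
pose A := [pred v | `[< ~ Acc (fun v w => lt v w) v >]].
have [|m [[/asboolP Am mA] _]] := woW (A := A).
  by exists w; apply/asboolP.
apply: Am; constructor=> v /andP[vm nvm]; apply: contrapT => nv.
have mv : le m v by apply: mA; apply/asboolP.
by move/eqP: nvm; apply; exact: le_anti.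
Qed.

Let is_pred w v := lt v w /\ forall u, lt u w -> le u v.

Lemma well_order_not_pred_between w v : lt v w -> ~ is_pred w v ->
  exists2 u, lt v u & lt u w.
Proof.
move=> vw nP; apply: contrapT => nb; apply: nP; split=> // u uw.
apply: contrapT => /negP nuv; apply: nb; exists u => //; apply/andP; split.
  by have := le_total u v; rewrite (negPf nuv).
by apply: contra nuv => /eqP ->; have := le_total u u; rewrite orbb.
Qed.

Let chain_step w (g : forall v, lt v w -> closedSubalgebra L) :
    closedSubalgebra L :=
  if pselect (exists v, is_pred w v) is left h
  then apply_sub (g _ (projT2 (cid h)).1)
  else closedSubalgebra_bigcap [set M | exists v (vw : lt v w), M = g v vw].

Lemma transfinite_chain_exists :
  exists f : W -> closedSubalgebra L, transfinite_chain le f.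
Proof.
pose f := Fix well_order_wf (fun=> closedSubalgebra L) (@chain_step).
have fE w : f w = @chain_step w (fun v _ => f v).
  apply: (Fix_eq well_order_wf) => {}w g h gh; congr chain_step.
  by do 2![apply: functional_extensionality_dep => ?]; exact: gh.
have fcap w : ~ (exists v, is_pred w v) ->
    (f w : set L) = \bigcap_(v in [set v | lt v w]) (f v : set L).
  move=> nP; rewrite fE /chain_step; case: pselect => // _ /=.
  apply/seteqP; split=> x Hx; first by move=> v vw; apply: Hx; exists v, vw.
  by move=> _ [v [vw ->]]; exact: Hx.
exists f => w; split.
- move=> wmin; rewrite fcap; last by move=> [v [vw _]]; have /negP := wmin v.
  by apply/seteqP; split=> // x _ v vw; have /negP := wmin v.
- move=> v vw vmax; rewrite fE /chain_step.
  case: pselect => [h|]; last by case; exists v.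
  congr (apply_sub (f _)); case: (cid h) => u [uw umax] /=.
  by apply: le_anti; [exact: vmax | exact: umax].
- move=> _ wlim; apply: fcap => -[v [vw vmax]].
  have [u /andP[vu /eqP nvu] uw] := wlim v vw.
  by apply: nvu; apply: le_anti => //; exact: vmax.
Qed.

Lemma transfinite_chain_decr (f : W -> closedSubalgebra L) :
  transfinite_chain le f ->
  forall w v, lt v w -> (f w : set L) `<=` apply_sub (f v).
Proof.
move=> fc w; elim/(well_founded_ind well_order_wf): w => w IH v vw.
have [_ fS fl] := fc w.
have [[u [uw umax]]|nP] := pselect (exists u, is_pred w u).
  rewrite (fS u uw umax).
  have [->//|nvu] := eqVneq v u.
  have vu : lt v u by rewrite /lt umax.
  by apply: subset_trans _ (IH u uw v vu); exact: apply_sub_subset.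
have bw u : lt u w -> exists2 t, lt u t & lt t w.
  move=> uw; apply: (well_order_not_pred_between uw) => uP.
  by apply: nP; exists u.
have [u vu uw] := bw v vw.
apply: subset_trans (IH u uw v vu).
rewrite fl; [by move=> x; apply | by exists v | exact: bw].
Qed.

End Chain.

Lemma stable_value_exists : exists M, stable_value M.
Proof.
have [le wo] := well_ordering_principle {classic set (closedSubalgebra L)}.
have [f fc] := transfinite_chain_exists wo.
have fdecr := transfinite_chain_decr wo fc.
apply: contrapT => nM.
have fneq w : apply_sub (f w) <> f w.
  by move=> fw; apply: nM; exists (f w); split=> //; exists _, le, f, w.
have flt v w : le v w -> v != w -> f v <> f w.
  move=> vw nvw fvw; apply: (fneq v); apply: closedSubalgebra_eq.
    exact: apply_sub_subset.
  by rewrite {1}fvw; apply: fdecr; rewrite vw.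
have finj : injective f.
  move=> v w fvw; apply: contrapT => /eqP nvw.
  have : le v w || le w v.
    by apply: (@wo_chainW _ le predT) => // A _; exact: wo.
  case/orP => [vw|wv]; first exact: (flt v w).
  by apply: (flt w v) => //; rewrite eq_sym.
pose D : set (closedSubalgebra L) :=
  [set M | exists2 A : {classic set (closedSubalgebra L)},
             f A = M & ~ (A : set (closedSubalgebra L)) M].
have DE : D (f D) <-> ~ D (f D).
  split; first by move=> [A /finj ->].
  by move=> nD; exists D.
by have nD : ~ D (f D) by [move=> d; exact: (DE.1 d d)]; exact: (nD (DE.2 nD)).
Qed.

Let cap := closedSubalgebra_bigcap.

Inductive tower : closedSubalgebra L -> Prop :=
| tower_apply M : tower M -> tower (apply_sub M)
| tower_cap (D : set (closedSubalgebra L)) :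
    (forall M, D M -> tower M) -> tower (cap D).

Let transfinite_power_tower M : transfinite_power M -> tower M.
Proof.
move=> [W [le [f [w [wo fc <-]]]]].
elim/(well_founded_ind (well_order_wf wo)): w => w IH.
have [f0 fS fl] := fc w.
have [[u [uw umax]]|nP] :=
  pselect (exists u, le u w && (u != w) /\
             forall v, le v w && (v != w) -> le v u).
  by rewrite (fS u uw umax); exact/tower_apply/IH.
suff -> : f w = cap [set M | exists2 v, le v w && (v != w) & M = f v].
  by apply: tower_cap => _ [v vw ->]; exact: IH.
apply: closedSubalgebra_inj => /=.
have [ew|new] := pselect (exists v, le v w && (v != w)).
  rewrite fl//; last first.
    move=> v vw; apply: (well_order_not_pred_between wo vw) => vP.
    by apply: nP; exists v.
  apply/seteqP; split=> x Hx; last by move=> v vw; apply: Hx; exists v.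
  by move=> _ [v vw ->]; exact: Hx.
rewrite f0; last by move=> v; apply/negP => vw; apply: new; exists v.
by apply/seteqP; split=> // x _ N [v vw _]; case: new; exists v.
Qed.

Let extreme (N : closedSubalgebra L) := forall M, tower M ->
  (N : set L) `<=` M -> N <> M -> (N : set L) `<=` apply_sub M.

Let extreme_cmp N M : extreme N -> tower M ->
  (N : set L) `<=` M \/ (M : set L) `<=` apply_sub N.
Proof.
move=> eN; elim=> {M} [M tM [NM|MN]|D tD IH].
- have [->|nNM] := pselect (N = M); first by right.
  by left; exact: eN.
- by right; apply: subset_trans MN; exact: apply_sub_subset.
- have [|] := pselect (forall M, D M -> (N : set L) `<=` M).
    by move=> ND; left=> x Nx M DM; exact: (ND M DM).
  move=> /existsNP[M /not_implyP[DM nNM]].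
  have [//|MN] := IH M DM.
  by right=> x Dx; apply: MN; exact: Dx.
Qed.

Let tower_extreme N : tower N -> extreme N.
Proof.
elim=> {N} [N tN eN|D tD eD] M tM.
- move=> NM nNM; have [NM'|MN] := extreme_cmp eN tM; last first.
    by case: nNM; exact: closedSubalgebra_eq.
  have [<-//|nNM'] := pselect (N = M).
  by apply: subset_trans (eN M tM NM' nNM'); exact: apply_sub_subset.
- move=> DM nDM.
  have [|] := pselect (forall N, D N -> (M : set L) `<=` N).
    move=> MD; case: nDM; apply: closedSubalgebra_eq => // x Mx N DN.
    exact: (MD N DN).
  move=> /existsNP[N /not_implyP[DN nMN]].
  have [NM|MN] := extreme_cmp (eD N DN) tM; last first.
    by case: nMN; apply: subset_trans MN _; exact: apply_sub_subset.
  have NM' : N <> M by move=> NM'; apply: nMN; rewrite NM'.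
  move=> x Dx; apply: (eD N DN M tM NM NM'); exact: Dx.
Qed.

Lemma stable_value_unique M N : stable_value M -> stable_value N -> M = N.
Proof.
suff H A B : stable_value A -> stable_value B -> (A : set L) `<=` B.
  by move=> sM sN; apply: closedSubalgebra_eq; exact: H.
move=> [/transfinite_power_tower tA AA] [/transfinite_power_tower tB _].
elim: tB => {B} [B tB AB|D tD AD].
  have [<-|nAB] := pselect (A = B); first by rewrite AA.
  exact: (tower_extreme tA).
by move=> x Ax C DC; exact: (AD C DC).
Qed.

(* The value at which the transfinite chain stabilizes. *)
Definition iterated_value : closedSubalgebra L :=
  sval (cid stable_value_exists).

Lemma iterated_valueP : stable_value iterated_value.
Proof. exact: svalP (cid stable_value_exists). Qed.

End TransfiniteIteration.

(* [iterated P] is the map written P with a superscript circle. *)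
Definition iterated (R : realType) (P : preradical R) : preradical R :=
  iterated_value P.

Section Families.
Context {R : realType} (L : banachLieType R).
Implicit Types (M N : set L) (F : set (set L)).

Definition frakS : set (set L) :=
  [set M | [/\ lie_subalgebra M, closed M, finite_codim M & M <> setT]].

Definition frakJ : set (set L) :=
  [set M | [/\ lie_ideal M, closed M, finite_codim M & M <> setT]].

Definition maximal_members F : set (set L) :=
  [set M | F M /\ forall N, F N -> M `<=` N -> N = M].

Definition frakS_max : set (set L) := maximal_members frakS.

Definition frakJ_max : set (set L) := maximal_members frakJ.

Lemma frakS_closed M : frakS M -> closed_subalgebra M.
Proof. by case. Qed.

Lemma frakJ_closed M : frakJ M -> closed_subalgebra M.
Proof. by case=> /lie_ideal_subalgebra. Qed.

Lemma frakS_max_closed M : frakS_max M -> closed_subalgebra M.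
Proof. by case=> /frakS_closed. Qed.

Lemma frakJ_max_closed M : frakJ_max M -> closed_subalgebra M.
Proof. by case=> /frakJ_closed. Qed.

(* The intersection of the empty family is [L] itself, as required. *)
Definition family_intersection F (FP : forall M, F M -> closed_subalgebra M) :
    closedSubalgebra L :=
  ClosedSubalgebra (closed_subalgebra_bigcap FP : closed_subalgebra
    (\bigcap_(M in F) M)).

End Families.

Definition P_S (R : realType) : preradical R :=
  fun L => family_intersection (@frakS_closed R L).

Definition P_S_max (R : realType) : preradical R :=
  fun L => family_intersection (@frakS_max_closed R L).

Definition P_J (R : realType) : preradical R :=
  fun L => family_intersection (@frakJ_closed R L).

Definition P_J_max (R : realType) : preradical R :=
  fun L => family_intersection (@frakJ_max_closed R L).

(* All four maps above have the same iterate; [P_S] is the one chosen here. *)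
Definition frattini (R : realType) : preradical R := iterated (@P_S R).

(* Main.v *)
From HB Require Import structures.
Require Import Defs.
From mathcomp Require Import all_boot all_order all_algebra.
From mathcomp Require Import all_classical all_reals all_analysis.
From mathcomp Require Import complex ring zify.

Set Implicit Arguments.
Unset Strict Implicit.
Unset Printing Implicit Defensive.

Import Order.TTheory GRing.Theory Num.Theory.
Import numFieldNormedType.Exports.

Local Open Scope classical_set_scope.
Local Open Scope ring_scope.

(** The heart of the matter is that a maximal closed subalgebra [M] of finite
codimension contains a closed ideal of [L] of finite codimension.  Filter [L] by
[F_0 = L], [F_1 = M], [F_(j+1) = {x in F_j | [L, x] <= F_j}]; all [F_j] have finite
codimension and the filtration is stationary as soon as every [x] acts nilpotently
on the graded object, where the operators [ad x] commute.  If every [h] in [M] is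
nilpotent on [L / M], Engel's theorem makes [M] an ideal.  Otherwise fix [h] in [M]
with a nonzero weight on [L / M].  The norm enters here: the eigenvalues of [ad h]
on every [L / F_j] are bounded by [||ad h||], so an element of nonzero weight shifts
weights out of the spectrum and acts nilpotently, with an exponent independent of
[j].  Conjugation by the exponential of such elements shows that brackets of
opposite weights are nilpotent on the graded object as well.  Together with [M]
these span a subalgebra, which is [L] by maximality.

The same weights applied to the quotient by a maximal ideal [J], together with the
invariance of the intersection of the maximal subalgebras containing [J] under
exponentials of nilpotents, show that this intersection is [J].

The inclusions are strict because of the two-dimensional nonabelian algebra, the
three-dimensional Heisenberg algebra, the bounded sequences extended by the
backward shift, and an infinite-dimensional Heisenberg algebra. *)

(** * Brackets and subspaces of finite codimension *)

(** For each of the four families, being radical means that the family is empty, so the radical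
    classes agree once a member of one family yields a member of another; the one deep passage is
    from a maximal subalgebra to an ideal. It also gives the link [P_J] <= [P_S_max] in the chain
    [frattini] <= [P_S] <= [P_J] <= [P_S_max] <= [P_J_max]; a larger value vanishes on fewer
    algebras, whence the order of the semisimple classes. The obstacle is that the ideal inside [M]
    is not known in advance, so there is no finite-dimensional quotient algebra to which the
    classical theory applies: [L / F_j] is only a module over [M], and a bracket with an arbitrary
    element costs one level of the filtration. Everything is therefore stated for elements of [L]
    modulo a subspace, with an account of the levels lost. Exponentials are truncated so that the
    loss stays bounded, and the starting level [K] is chosen to pay for it. *)

Section LieRules.
Context {R : realType} {L : banachLieType R}.
Implicit Types a b c x y : L.

HB.instance Definition _ a :=
  GRing.isLinear.Build R[i] L L *:%R (lie a) (lie_linearr a).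

Lemma lieDr a x y : lie a (x + y) = lie a x + lie a y.
Proof. exact: raddfD. Qed.

Lemma lieZr a k x : lie a (k *: x) = k *: lie a x.
Proof. exact: linearZ. Qed.

Lemma lieBr a x y : lie a (x - y) = lie a x - lie a y.
Proof. exact: raddfB. Qed.

Lemma lieDl a x y : lie (x + y) a = lie x a + lie y a.
Proof. by have := lie_linearl a 1 x y; rewrite !scale1r. Qed.

Lemma lie0l a : lie 0 a = 0.
Proof. by apply: (addrI (lie 0 a)); rewrite -lieDl !addr0. Qed.

Lemma lieZl a k x : lie (k *: x) a = k *: lie x a.
Proof. by have := lie_linearl a k x 0; rewrite lie0l !addr0. Qed.

Lemma lieC a b : lie a b = - lie b a.
Proof.
have := lie_alternating (a + b); rewrite lieDl !lieDr !lie_alternating.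
by rewrite add0r addr0 => /eqP; rewrite addr_eq0 => /eqP.
Qed.

Lemma lieNl a b : lie (- a) b = - lie a b.
Proof. by rewrite -scaleN1r lieZl scaleN1r. Qed.

Lemma lieBl a b c : lie (a - b) c = lie a c - lie b c.
Proof. by rewrite lieDl lieNl. Qed.

Lemma lie_suml I (r : seq I) (P : pred I) (f : I -> L) a :
  lie (\sum_(i <- r | P i) f i) a = \sum_(i <- r | P i) lie (f i) a.
Proof.
by rewrite lieC raddf_sum -sumrN; apply: eq_bigr => i _; rewrite -lieC.
Qed.

Lemma lie_derivation a b c :
  lie a (lie b c) = lie (lie a b) c + lie b (lie a c).
Proof.
have /eqP := lie_jacobi a b c.
rewrite -addrA addr_eq0 => /eqP ->; rewrite opprD addrC; congr (_ + _).
  by rewrite -lieC.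
by rewrite -raddfN -lieC.
Qed.

Lemma lieA a b c :
  lie (lie a b) c = lie a (lie b c) - lie b (lie a c).
Proof. by rewrite lie_derivation addrK. Qed.

Lemma lie_bound a : exists2 C : R[i], 0 <= C & forall x, `|lie a x| <= C * `|x|.
Proof.
have [t t0 tP] := @lie_bounded R L.
by exists (t * `|a|) => [|x]; [rewrite mulr_ge0 // ltW | exact: tP].
Qed.

Lemma lie_continuous a : continuous (lie a).
Proof.
have [C C0 HC] := lie_bound a.
move=> x; apply/cvgrPdist_lt => e e0.
have D0 : 0 < C + 1 by rewrite ltr_wpDl.
near=> y; rewrite -raddfB; apply: le_lt_trans (HC _) _.
apply: (@le_lt_trans _ _ ((C + 1) * `|x - y|)).
  by rewrite ler_wpM2r // lerDl.
rewrite mulrC -ltr_pdivlMr//.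
by near: y; apply: cvgr_dist_lt => //; rewrite divr_gt0.
Unshelve. all: end_near. Qed.

End LieRules.

(** * Relative codimension and linear dependence modulo a subspace *)

Section Codimension.
Context {R : realType} {L : banachLieType R}.
Implicit Types (S T U G : set L) (x y : L).

Lemma subspace0 T : linear_subspace T -> T 0.
Proof. by case. Qed.

Lemma subspaceD T x y : linear_subspace T -> T x -> T y -> T (x + y).
Proof. by move=> [_ H] Tx Ty; have := H 1 x y Tx Ty; rewrite scale1r. Qed.

Lemma subspaceZ T k x : linear_subspace T -> T x -> T (k *: x).
Proof. by move=> [T0 H] Tx; have := H k x 0 Tx T0; rewrite addr0. Qed.

Lemma subspaceN T x : linear_subspace T -> T x -> T (- x).
Proof. by move=> sT Tx; rewrite -scaleN1r; exact: subspaceZ. Qed.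

Lemma subspaceB T x y : linear_subspace T -> T x -> T y -> T (x - y).
Proof. by move=> sT Tx Ty; apply: subspaceD => //; exact: subspaceN. Qed.

Lemma subspace_sum T I (r : seq I) (P : pred I) (f : I -> L) :
  linear_subspace T -> (forall i, P i -> T (f i)) ->
  T (\sum_(i <- r | P i) f i).
Proof.
move=> sT Tf; elim/big_rec: _ => [|i y Pi Ty]; first exact: subspace0.
exact: subspaceD (Tf i Pi) Ty.
Qed.

Lemma subspaceZV T k x : linear_subspace T -> k != 0 -> T (k *: x) -> T x.
Proof.
move=> sT k0 Tkx; rewrite -[x]scale1r -(mulVf k0) -scalerA.
exact: subspaceZ.
Qed.

Lemma subspaceDl T x y : linear_subspace T -> T x -> T (x + y) -> T y.
Proof.
by move=> sT Tx Txy; rewrite -(addKr x y) addrC; apply: subspaceB.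
Qed.

Lemma subspace_setT : linear_subspace [set: L].
Proof. by []. Qed.

Lemma subspace_preimage T (A : {linear L -> L}) :
  linear_subspace T -> linear_subspace (A @^-1` T).
Proof.
move=> sT; split=> [|k x y Tx Ty] /=; first by rewrite raddf0; case: sT.
by rewrite linearP; apply: sT.2.
Qed.

Lemma subspaceI S T :
  linear_subspace S -> linear_subspace T -> linear_subspace (S `&` T).
Proof.
move=> [S0 SL] [T0 TL]; split=> // k x y [Sx Tx] [Sy Ty].
by split; [exact: SL | exact: TL].
Qed.

Definition adjoin T x : set L := [set y | exists k, T (y - k *: x)].

Lemma adjoin_sub T x : T `<=` adjoin T x.
Proof. by move=> y Ty; exists 0; rewrite scale0r subr0. Qed.

Lemma adjoin_id T x : linear_subspace T -> adjoin T x x.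
Proof. by move=> sT; exists 1; rewrite scale1r subrr; exact: subspace0. Qed.

Lemma adjoin_subspace T x : linear_subspace T -> linear_subspace (adjoin T x).
Proof.
move=> sT; split; first by apply: adjoin_sub; exact: subspace0.
move=> k y z [a Ta] [b Tb]; exists (k * a + b).
have -> : k *: y + z - (k * a + b) *: x = k *: (y - a *: x) + (z - b *: x).
  by rewrite scalerBr scalerDl scalerA opprD addrACA.
exact: sT.2.
Qed.

Lemma adjoinP T x y : linear_subspace T -> adjoin T x y ->
  exists t k, T t /\ y = t + k *: x.
Proof. by move=> sT [k Tk]; exists (y - k *: x), k; rewrite subrK. Qed.

Lemma adjoin_min T U x : linear_subspace U -> T `<=` U -> U x ->
  adjoin T x `<=` U.
Proof.
move=> sU TU Ux y [k Tk]; rewrite -(subrK (k *: x) y).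
by apply: subspaceD => //; [exact: TU | exact: subspaceZ].
Qed.

Lemma adjoin_mono T U x : T `<=` U -> adjoin T x `<=` adjoin U x.
Proof. by move=> TU y [k Tk]; exists k; exact: TU. Qed.

Lemma adjoinC T x y : adjoin (adjoin T x) y = adjoin (adjoin T y) x.
Proof.
by apply/seteqP; split=> z [k [l H]]; exists l, k; move: H; rewrite addrAC.
Qed.

(* That is, [dim (S / (S `&` T)) <= n]. *)
Fixpoint codim_le S n T :=
  if n is n'.+1 then exists2 x, S x & codim_le S n' (adjoin T x) else S `<=` T.

Definition fin_codim S T := exists n, codim_le S n T.

Lemma codim_le_mono S n T U : T `<=` U -> codim_le S n T -> codim_le S n U.
Proof.
elim: n T U => [|n IH] T U TU /=; first by move=> /subset_trans; exact.
by move=> [x Sx Hx]; exists x => //; apply: IH Hx; exact: adjoin_mono.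
Qed.

(** Steinitz exchange. If [y] is in [adjoin T x], its coefficient at [x] is nonzero because [y] is
    not in [T], so [y] can replace [x]; otherwise the exchange takes place further on, over
    [adjoin T x]. *)
Lemma codim_le_exchange S n T y : linear_subspace T ->
  codim_le S n.+1 T -> S y -> ~ T y -> codim_le S n (adjoin T y).
Proof.
move=> sT; elim: n T sT => [|n IH] T sT [x Sx Hx] Sy nTy.
  have [k Tk] := Hx y Sy; move=> z /Hx [l Tl].
  have k0 : k != 0.
    by apply: contra_notN nTy => /eqP k0; move: Tk; rewrite k0 scale0r subr0.
  exists (l / k); have -> : z - (l / k) *: y =
      (z - l *: x) - (l / k) *: (y - k *: x).
    by rewrite scalerBr scalerA divfK// opprB addrA subrK.
  by apply: subspaceB => //; exact: subspaceZ.
have [yx|nyx] := pselect (adjoin T x y); last first.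
  exists x => //; rewrite adjoinC; apply: IH => //; exact: adjoin_subspace.
have [k Tk] := yx.
have k0 : k != 0.
  by apply: contra_notN nTy => /eqP k0; move: Tk; rewrite k0 scale0r subr0.
apply: (@codim_le_mono S n.+1 _ _ _ Hx) => z [l Tl].
exists (l / k); have -> : z - (l / k) *: y =
    (z - l *: x) - (l / k) *: (y - k *: x).
  by rewrite scalerBr scalerA divfK// opprB addrA subrK.
by apply: subspaceB => //; exact: subspaceZ.
Qed.

Lemma fin_codim_refl S : fin_codim S S.
Proof. by exists 0%N. Qed.

Lemma fin_codim_mono S T U : T `<=` U -> fin_codim S T -> fin_codim S U.
Proof. by move=> TU [n Hn]; exists n; exact: codim_le_mono Hn. Qed.

Lemma fin_codim_trans S T U : linear_subspace S -> T `<=` S ->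
  fin_codim S T -> fin_codim T U -> fin_codim S U.
Proof.
move=> sS TS [n Hn] [m]; elim: m U => [|m IH] U /=.
  by move=> TU; exists n; exact: codim_le_mono Hn.
by move=> [x Tx /IH [p Hp]]; exists p.+1, x => //; exact: TS.
Qed.

(** The given generators of [L] over [T] need not lie in [S]; exchange trades them for elements of
    [S] outside [T] until [S] is covered. *)
Lemma fin_codim_restrict S T : linear_subspace T -> linear_subspace S ->
  fin_codim [set: L] T -> fin_codim S (S `&` T).
Proof.
move=> sT sS [n]; elim: n T sT => [|n IH] T sT.
  by move=> HT; exists 0%N => x Sx; split=> //; exact: HT.
move=> HT; have [ST|] := pselect (S `<=` T); first by exists 0%N => x Sx; split=> //; exact: ST.
move=> /existsNP [x /not_implyP [Sx nTx]].
have [|m Hm] := IH _ (adjoin_subspace x sT).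
  exact: codim_le_exchange.
exists m.+1, x => //; apply: codim_le_mono Hm => y [Sy [k Tk]]; exists k.
by split=> //; apply: subspaceB => //; exact: subspaceZ.
Qed.

Lemma fin_codimI S T : linear_subspace S -> linear_subspace T ->
  fin_codim [set: L] S -> fin_codim [set: L] T -> fin_codim [set: L] (S `&` T).
Proof.
move=> sS sT cS cT; apply: fin_codim_trans cS _ => //.
exact: fin_codim_restrict.
Qed.

Lemma fin_codim_preimage T (A : {linear L -> L}) : linear_subspace T ->
  fin_codim [set: L] T -> fin_codim [set: L] (A @^-1` T).
Proof.
move=> sT [n]; elim: n T sT => [|n IH] T sT HT.
  by exists 0%N => x _; exact: HT.
have [AT|] := pselect (forall x, T (A x)); first by exists 0%N => x _; exact: AT.
move=> /existsNP [x nTx].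
have [|m Hm] := IH _ (adjoin_subspace (A x) sT).
  exact: codim_le_exchange.
exists m.+1, x => //; apply: codim_le_mono Hm => y /= [k Tk]; exists k.
by rewrite /= linearB linearZ.
Qed.

Lemma fin_codim_big S I (r : seq I) (f : I -> set L) :
  (forall i, linear_subspace (f i)) ->
  (forall i, fin_codim [set: L] (f i)) ->
  linear_subspace S -> fin_codim [set: L] S ->
  fin_codim [set: L] [set x | S x /\ forall i, List.In i r -> f i x].
Proof.
move=> sf cf; elim: r S => [|i r IH] S sS cS.
  by apply: fin_codim_mono cS => x Sx; split.
have [n Hn] := IH (S `&` f i) (subspaceI sS (sf i))
  (fin_codimI sS (sf i) cS (cf i)).
exists n; apply: codim_le_mono Hn => x [[Sx fx] H]; split=> // j /= [<-//|].
exact: H.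
Qed.

Lemma finite_codimP T : linear_subspace T ->
  finite_codim T <-> fin_codim [set: L] T.
Proof.
move=> sT; split=> [[n [e He]]|[n]].
  exists n; elim: n e T sT He => [|n IH] e T sT He.
    by move=> x _; have [c] := He x; rewrite big_ord0 subr0.
  exists (e ord_max) => //; apply: (IH (fun i => e (widen_ord (leqnSn n) i))).
    exact: adjoin_subspace.
  move=> x; have [c Hc] := He x; exists (fun i => c (widen_ord (leqnSn n) i)).
  by exists (c ord_max); move: Hc; rewrite big_ord_recr /= opprD addrA.
elim: n T sT => [|n IH] T sT.
  move=> HT; exists 0%N, (fun=> 0) => x; exists (fun=> 0).
  by rewrite big_ord0 subr0; exact: HT.
move=> [y _ /IH [|m [e He]]]; first exact: adjoin_subspace.
exists m.+1, (fun i => oapp e y (unlift ord0 i)) => x.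
have [c [k Tk]] := He x.
exists (fun i => oapp c k (unlift ord0 i)).
rewrite big_ord_recl /= unlift_none /=.
under eq_bigr do rewrite liftK /=.
by rewrite [k *: y + _]addrC opprD addrA.
Qed.

(** Finite codimension as a test principle: a linear condition that holds on [T] has to be checked
    only on a finite list. *)
Lemma fin_codim_span S T : linear_subspace T -> linear_subspace S ->
  T `<=` S -> fin_codim S T ->
  exists2 r : seq L, (forall x, List.In x r -> S x) &
  forall U, linear_subspace U -> T `<=` U ->
    (forall x, List.In x r -> U x) -> S `<=` U.
Proof.
move=> sT sS TS [n]; elim: n T sT TS => [|n IH] T sT TS /=.
  by move=> ST; exists [::] => // U _ TU _; exact: subset_trans TU.
move=> [x Sx Hx].
have [|r rS H] := IH _ (adjoin_subspace x sT) _ Hx.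
  exact: adjoin_min.
exists (x :: r) => [y [<-//|]|U sU TU Ur]; first exact: rS.
apply: H => //; last by move=> y yr; apply: Ur; right.
by apply: adjoin_min => //; apply: Ur; left.
Qed.

Fixpoint adjoin_seq T (v : nat -> L) n :=
  if n is n'.+1 then adjoin (adjoin_seq T v n') (v n') else T.

Lemma adjoin_seq_subspace T (v : nat -> L) n :
  linear_subspace T -> linear_subspace (adjoin_seq T v n).
Proof. by move=> sT; elim: n => //= n IH; exact: adjoin_subspace. Qed.

Lemma adjoin_seqP T (v : nat -> L) n x : adjoin_seq T v n x ->
  exists c : nat -> R[i], T (x - \sum_(i < n) c i *: v i).
Proof.
elim: n x => [|n IH] x /=; first by exists (fun=> 0); rewrite big_ord0 subr0.
move=> [k /IH [c Hc]]; exists (fun i => if i == n then k else c i).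
rewrite big_ord_recr /= eqxx (eq_bigr (fun i : 'I_n => c i *: v i)).
  by rewrite [_ + k *: _]addrC opprD addrA.
by move=> i _; rewrite ltn_eqF.
Qed.

(** Otherwise each [v k] would lower the codimension by one. The relation involves only earlier
    terms, so applied to iterates of one operator it is a monic polynomial. *)
Lemma dependent T (v : nat -> L) n : linear_subspace T ->
  codim_le [set: L] n T -> exists2 k, (k <= n)%N &
  exists c : nat -> R[i], T (v k - \sum_(i < k) c i *: v i).
Proof.
move=> sT Hn.
suff [k kn Hk] : exists2 k, (k <= n)%N & adjoin_seq T v k (v k).
  by exists k => //; exact: adjoin_seqP Hk.
apply: contrapT => nk.
have H k : (k <= n)%N -> codim_le [set: L] (n - k) (adjoin_seq T v k).
  elim: k => [|k IH] kn; first by rewrite subn0.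
  have Hk := IH (ltnW kn); rewrite -(subnSK kn) in Hk.
  apply: (codim_le_exchange (adjoin_seq_subspace v k sT) Hk) => // vk.
  by apply: nk; exists k => //; exact: ltnW.
have := H n (leqnn n); rewrite subnn /= => /(_ (v n) I) Hn'.
by apply: nk; exists n.
Qed.

End Codimension.

(** * Weight spaces modulo a subspace *)

Section WeightSpaces.
Context {R : realType} {L : banachLieType R} (h : L).
Implicit Types (T U G Q : set L) (x y : L) (mu nu : R[i]).

Definition ad_shift mu x := lie h x - mu *: x.

Fact ad_shift_linear mu : linear (ad_shift mu).
Proof.
move=> k x y; rewrite /ad_shift lie_linearr scalerBr scalerDr !scalerA.
by rewrite [mu * k]mulrC opprD addrACA.
Qed.

HB.instance Definition _ mu :=
  GRing.isLinear.Build R[i] L L *:%R (ad_shift mu) (ad_shift_linear mu).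

Lemma ad_shiftD mu x y : ad_shift mu (x + y) = ad_shift mu x + ad_shift mu y.
Proof. exact: raddfD. Qed.

Lemma ad_shiftZ mu k x : ad_shift mu (k *: x) = k *: ad_shift mu x.
Proof. exact: linearZ. Qed.

Lemma ad_shiftC mu nu x :
  ad_shift mu (ad_shift nu x) = ad_shift nu (ad_shift mu x).
Proof.
rewrite /ad_shift !lieBr !lieZr !scalerBr !scalerA [mu * nu]mulrC !opprB.
by rewrite addrACA [RHS]addrACA [- _ - _]addrC.
Qed.

Lemma iter_ad_shiftC p mu nu x :
  iter p (ad_shift mu) (ad_shift nu x) = ad_shift nu (iter p (ad_shift mu) x).
Proof. by elim: p => //= p ->; rewrite ad_shiftC. Qed.

Lemma ad_shiftB mu nu x : ad_shift mu x - ad_shift nu x = (nu - mu) *: x.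
Proof. by rewrite /ad_shift opprB addrC addrA subrK scalerBl. Qed.

Lemma ad_shift_lie mu nu x y :
  ad_shift (mu + nu) (lie x y) =
  lie (ad_shift mu x) y + lie x (ad_shift nu y).
Proof.
rewrite /ad_shift lie_derivation lieBl lieBr lieZl lieZr scalerDl opprD.
by rewrite addrACA.
Qed.

(** The preimage in [L] of a generalised eigenspace of [lie h] on [L / T]; no quotient is formed, as
    [T] is in general not an ideal. *)
Definition weight T mu : set L := [set x | exists p, T (iter p (ad_shift mu) x)].

Lemma weight_mono T U mu : T `<=` U -> weight T mu `<=` weight U mu.
Proof. by move=> TU x [p Tp]; exists p; exact: TU. Qed.

Lemma sub_weight T mu : T `<=` weight T mu.
Proof. by move=> x Tx; exists 0%N. Qed.

Lemma weight_unshift T mu x : weight T mu (ad_shift mu x) -> weight T mu x.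
Proof. by move=> [p Tp]; exists p.+1; rewrite iterSr. Qed.

Section Stable.
Context (T : set L) (sT : linear_subspace T) (hT : forall x, T x -> T (lie h x)).

Lemma ad_shift_stable mu x : T x -> T (ad_shift mu x).
Proof. by move=> Tx; apply: subspaceB; [|exact: hT|exact: subspaceZ]. Qed.

Lemma iter_ad_shift_stable p mu x : T x -> T (iter p (ad_shift mu) x).
Proof. by move=> Tx; elim: p => //= p; exact: ad_shift_stable. Qed.

Lemma weight_subspace mu : linear_subspace (weight T mu).
Proof.
split; first by exists 0%N; exact: subspace0.
move=> k x y [p Tp] [q Tq]; exists (p + q)%N.
have -> : iter (p + q) (ad_shift mu) (k *: x + y) =
    k *: iter (p + q) (ad_shift mu) x + iter (p + q) (ad_shift mu) y.
  by elim: (p + q)%N => //= n ->; rewrite linearP.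
apply: subspaceD => //; last by rewrite iterD; exact: iter_ad_shift_stable.
by apply: subspaceZ => //; rewrite addnC iterD; exact: iter_ad_shift_stable.
Qed.

Lemma weight_shift mu nu x : weight T mu x -> weight T mu (ad_shift nu x).
Proof.
by move=> [p Tp]; exists p; rewrite iter_ad_shiftC; exact: ad_shift_stable.
Qed.

Lemma weight_lie mu x : weight T mu x -> weight T mu (lie h x).
Proof.
by move=> /(weight_shift 0); rewrite /ad_shift scale0r subr0.
Qed.

Lemma weight_disjoint mu nu x :
  mu != nu -> weight T mu x -> weight T nu x -> T x.
Proof.
move=> mn [p Tp] [q Tq]; move: {2}(p + q)%N (leqnn (p + q)) => n.
elim: n p q x Tp Tq => [|n IH] p q x Tp Tq pq.
  by move: pq Tp; rewrite leqn0 addn_eq0 => /andP[/eqP -> _].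
case: p Tp pq => [//|p] Tp; case: q Tq => [//|q] Tq pq.
have Hmu : T (ad_shift mu x).
  apply: (IH p q.+1); [by rewrite -iterSr| |by rewrite -ltnS -addSn].
  by rewrite iter_ad_shiftC; exact: ad_shift_stable.
have Hnu : T (ad_shift nu x).
  apply: (IH p.+1 q); [|by rewrite -iterSr|by rewrite -ltnS -addnS].
  by rewrite iter_ad_shiftC; exact: ad_shift_stable.
apply: (@subspaceZV _ _ T (nu - mu)) => //; first by rewrite subr_eq0 eq_sym.
by rewrite -ad_shiftB; exact: subspaceB.
Qed.

(** On weight [nu] the operator [ad_shift mu] is [nu - mu] plus a nilpotent; the induction on the
    exponent sums the geometric series of its inverse. *)
Lemma weight_solve G mu nu x : linear_subspace G ->
  (forall x, G x -> G (lie h x)) -> mu != nu -> weight T nu x -> G x ->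
  exists u, [/\ G u, weight T nu u & (T `&` G) (ad_shift mu u - x)].
Proof.
move=> sG hG mn [p]; elim: p x => [|p IH] x Tp Gx.
  exists 0; split; [exact: subspace0|exact: (sub_weight _ (subspace0 sT))|].
  by rewrite raddf0 sub0r; split; exact: subspaceN.
have GS z : G z -> G (ad_shift nu z).
  by move=> Gz; apply: subspaceB; [|exact: hG|exact: subspaceZ].
have [||u [Gu Wu [Tu Gu']]] := IH (ad_shift nu x); first by rewrite -iterSr.
  exact: GS.
have Gxu := subspaceB sG Gx Gu.
exists ((nu - mu)^-1 *: (x - u)); split; first exact: subspaceZ.
  apply: subspaceZ (weight_subspace nu) _.
  by apply: subspaceB => //; [exact: weight_subspace|exists p.+1].
have -> : ad_shift mu ((nu - mu)^-1 *: (x - u)) - x =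
    - (nu - mu)^-1 *: (ad_shift mu u - ad_shift nu x).
  have -> : ad_shift nu x = ad_shift mu x - (nu - mu) *: x.
    by rewrite -ad_shiftB opprB addrC subrK.
  rewrite linearZ /= [ad_shift mu (x - u)]raddfB scaleNr.
  have -> : - ((nu - mu)^-1 *: (ad_shift mu u - (ad_shift mu x - (nu - mu) *: x))) =
      (nu - mu)^-1 *: (ad_shift mu x - ad_shift mu u - (nu - mu) *: x).
    by rewrite -scalerN opprB addrAC.
  by rewrite [in RHS]scalerBr scalerA mulVf ?scale1r// subr_eq0 eq_sym.
by split; exact: subspaceZ.
Qed.

Definition shift_prod (s : seq R[i]) x := foldl (fun y mu => ad_shift mu y) x s.

Lemma weight_decomposition_seq s G Q x : linear_subspace G ->
  (forall x, G x -> G (lie h x)) -> linear_subspace Q ->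
  (forall mu, weight T mu `&` G `<=` Q) ->
  G x -> T (shift_prod s x) -> Q x.
Proof.
move=> sG hG; elim: s Q x => [|mu s IH] Q x sQ WQ Gx /= Tx.
  by apply: (WQ 0); split => //; exact: sub_weight.
have GS nu z : G z -> G (ad_shift nu z).
  by move=> Gz; apply: subspaceB; [|exact: hG|exact: subspaceZ].
(* If [ad_shift mu x] is in [S] with witness [u], then [ad_shift mu (x - u)] has weight [mu], hence
   so has [x - u], and [x] is the sum of two elements of [Q]. *)
pose S := [set v | G v /\ exists u, [/\ Q u, G u &
  weight T mu (v - ad_shift mu u)]].
have sW := weight_subspace mu.
have sS : linear_subspace S.
  split.
    split; first exact: subspace0.
    exists 0; split; [exact: subspace0|exact: subspace0|].
    by rewrite raddf0 subrr; exact: subspace0.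
  move=> k v w [Gv [a [Qa Ga Ha]]] [Gw [b [Qb Gb Hb]]]; split.
    exact: sG.2.
  exists (k *: a + b); split; [exact: sQ.2|exact: sG.2|].
  rewrite linearP opprD addrACA -scalerBr; exact: sW.2.
have [|Gx' [u [Qu Gu Hu]]] := IH S (ad_shift mu x) sS _ (GS mu x Gx) Tx.
  move=> nu v [Wv Gv]; split => //.
  have [nm|mn] := eqVneq mu nu.
    exists 0; split; [exact: subspace0|exact: subspace0|].
    by rewrite raddf0 subr0 nm.
  have [u [Gu Wu [Tu _]]] := weight_solve sG hG mn Wv Gv.
  exists u; split => //; first exact: (WQ nu).
  by apply: sub_weight; rewrite -opprB; exact: subspaceN.
rewrite -(subrK u x); apply: subspaceD => //; apply: (WQ mu).
split; last exact: subspaceB.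
by apply: weight_unshift; rewrite raddfB.
Qed.

Lemma weight_not_in_seq s mu x : mu \notin s -> T (shift_prod s x) ->
  weight T mu x -> T x.
Proof.
elim: s x => [//|nu s IH] x /=; rewrite inE negb_or => /andP[mn ms] Tx Wx.
apply: (weight_disjoint mn Wx); exists 1%N => /=.
by apply: IH => //; exact: weight_shift.
Qed.

End Stable.

Definition ad_poly (p : {poly R[i]}) x := \sum_(i < size p) p`_i *: iter i (lie h) x.

Lemma ad_polyE n (p : {poly R[i]}) x : (size p <= n)%N ->
  ad_poly p x = \sum_(i < n) p`_i *: iter i (lie h) x.
Proof.
move=> pn; rewrite /ad_poly (big_ord_widen n (fun i => p`_i *: iter i (lie h) x))//.
rewrite big_mkcond; apply: eq_bigr => i _; case: ltnP => // ip.
by rewrite nth_default// scale0r.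
Qed.

Lemma ad_poly_factor mu p x :
  ad_poly (('X - mu%:P) * p) x = ad_poly p (ad_shift mu x).
Proof.
have sz : (size (('X - mu%:P) * p)%R <= (size p).+1)%N.
  apply: leq_trans (size_polyMleq _ _) _.
  by rewrite size_XsubC.
rewrite (ad_polyE _ sz) /ad_poly mulrBl.
under eq_bigr do rewrite coefB coefXM mulrC coefMC scalerBl.
rewrite sumrB big_ord_recl /= scale0r add0r big_ord_recr /=.
rewrite [p`_(size p)]nth_default// mul0r scale0r addr0 -sumrB.
apply: eq_bigr => i _.
have iterB q : iter q (lie h) (ad_shift mu x) =
    iter q.+1 (lie h) x - mu *: iter q (lie h) x.
  elim: q => [//|q IH]; rewrite iterS IH lieBr lieZr //.
by rewrite iterB scalerBr scalerA.
Qed.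

Lemma ad_poly1 x : ad_poly 1 x = x.
Proof. by rewrite (@ad_polyE 1) ?size_poly1// big_ord1 coef1 scale1r. Qed.

Lemma ad_poly_prod s x : ad_poly (\prod_(mu <- s) ('X - mu%:P)) x = shift_prod s x.
Proof.
elim: s x => [|mu s IH] x; first by rewrite big_nil ad_poly1.
by rewrite big_cons ad_poly_factor IH.
Qed.

Section FiniteCodim.
Context (T : set L) (sT : linear_subspace T) (hT : forall x, T x -> T (lie h x)).
Context (cT : fin_codim [set: L] T).

(** The first dependence among the iterates of [lie h] on [x] is a monic polynomial, which splits
    over [R[i]]; [s] lists its roots. *)
Lemma annihilating_seq x : exists s, T (shift_prod s x).
Proof.
have [n Hn] := cT.
have [k _ [c Hc]] := dependent (fun i => iter i (lie h) x) sT Hn.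
pose p : {poly R[i]} := 'X^k - \poly_(i < k) c i.
have sp : size p = k.+1.
  rewrite /p size_polyDl ?size_polyXn// size_polyN ltnS.
  exact: size_poly.
have lp : lead_coef p = 1.
  rewrite lead_coefE sp /= coefB coefXn eqxx coef_poly ltnn subr0 //.
have [s Hs] := closed_field_poly_normal p.
exists s; rewrite -ad_poly_prod; move: Hs; rewrite lp scale1r => <-.
rewrite (@ad_polyE k.+1) ?sp// big_ord_recr /=.
rewrite coefB coefXn eqxx coef_poly ltnn subr0 scale1r addrC.
under eq_bigr => i _ do
  rewrite coefB coefXn ltn_eqF// coef_poly ltn_ord sub0r scaleNr.
by rewrite sumrN.
Qed.

(** The decomposition into weight spaces as an induction principle, so that no sums of components
    have to be handled. *)
Lemma weight_decomposition G Q : linear_subspace G ->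
  (forall x, G x -> G (lie h x)) -> linear_subspace Q ->
  (forall mu, weight T mu `&` G `<=` Q) -> G `<=` Q.
Proof.
move=> sG hG sQ WQ x Gx; have [s Hs] := annihilating_seq x.
exact: (weight_decomposition_seq sT hT sG hG sQ WQ Gx Hs).
Qed.

End FiniteCodim.

(** One list for all [x] bounds the whole spectrum on [L / T]; this is what later allows a single
    exponent for all nonzero weights. *)
Lemma uniform_annihilating_seq T : linear_subspace T ->
  (forall x, T x -> T (lie h x)) -> fin_codim [set: L] T ->
  exists s, forall x, T (shift_prod s x).
Proof.
move=> sT hT [n]; elim: n T sT hT => [|n IH] T sT hT Hn.
  by exists [::] => x; exact: Hn.
have [TT|] := pselect (forall x, T x); first by exists [::] => x; exact: TT.
move=> /existsNP [x nTx].
(* The last partial product outside [T] is an eigenvector modulo [T]; adjoining it keeps the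
   subspace stable under [lie h]. *)
have [y nTy [mu Ty]] : exists2 y, ~ T y & exists mu, T (ad_shift mu y).
  have cT : fin_codim [set: L] T by exists n.+1.
  have [s] := annihilating_seq sT cT x.
  elim: s x nTx => //= mu s IHs x nTx Hx.
  have [Tx|nTx'] := pselect (T (ad_shift mu x)); first by exists x => //; exists mu.
  exact: IHs nTx' Hx.
have [||s Hs] := IH _ (adjoin_subspace y sT).
- move=> z [k Tk]; exists (k * mu).
  have -> : lie h z - (k * mu) *: y = lie h (z - k *: y) + k *: ad_shift mu y.
    by rewrite lieBr lieZr /ad_shift scalerBr scalerA addrA subrK.
  by apply: subspaceD => //; [exact: hT|exact: subspaceZ].
- exact: codim_le_exchange.
exists (rcons s mu) => z; rewrite /shift_prod foldl_rcons.
have [k Tk] := Hs z; rewrite -/(shift_prod s z).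
rewrite -(subrK (k *: y) (shift_prod s z)) ad_shiftD ad_shiftZ.
by apply: (subspaceD sT); [exact: (ad_shift_stable sT hT)|exact: subspaceZ].
Qed.

End WeightSpaces.

(** * Engel's theorem *)

Section Engel.
Context {R : realType} {L : banachLieType R} (S T : set L).
Context (sS : linear_subspace S) (sT : linear_subspace T).
Context (Slie : forall a b, S a -> S b -> S (lie a b)).
Context (ST : forall a b, S a -> T b -> T (lie a b)).
Context (cT : fin_codim [set: L] T).
Implicit Types (H : set L) (x y e : L).

Fixpoint engel_chain H i : set L :=
  if i is j.+1 then [set e | forall a, H a -> engel_chain H j (lie a e)] else T.

Definition acts_nilpotently H := exists k, forall e, engel_chain H k e.

(** The kernel of the action of [S] on [L / T]. It has finite codimension in [S], so the induction
    of Engel's theorem can start from it although [S] may be infinite-dimensional. *)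
Definition trivial_part := [set s | S s /\ forall e, T (lie s e)].

Lemma engel_chain_subspace H i : linear_subspace (engel_chain H i).
Proof.
elim: i => [//|i IH] /=; split=> [a Ha|k x y Hx Hy a Ha].
  by rewrite raddf0; exact: subspace0.
by rewrite lieDr lieZr; apply: IH.2; [exact: Hx|exact: Hy].
Qed.

Lemma engel_chain_incr H i : H `<=` S ->
  engel_chain H i `<=` engel_chain H i.+1.
Proof.
move=> HS; elim: i => [|i IH] e He a Ha; first exact: (ST (HS _ Ha) He).
by apply: IH; exact: He.
Qed.

Lemma engel_chain_le H i j : H `<=` S -> (i <= j)%N ->
  engel_chain H i `<=` engel_chain H j.
Proof.
move=> HS /subnK <-; elim: (j - i)%N => // n IH e /IH.
exact: engel_chain_incr.
Qed.

Lemma engel_chain_stable H y i e : S y ->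
  (forall a, H a -> H (lie a y)) -> engel_chain H i e -> engel_chain H i (lie y e).
Proof.
move=> Sy Hy; elim: i e => [|i IH] e He; first exact: ST.
move=> a Ha; rewrite lie_derivation.
apply: subspaceD (engel_chain_subspace H i) _ _; first exact/He/Hy.
by apply: IH; exact: He.
Qed.

(** Since [y] normalises [H] it preserves each term of the chain of [H], and there it is nilpotent
    of order [n] modulo [T]; every step of that chain becomes [n] steps for [adjoin H y]. *)
Lemma acts_nilpotently_adjoin H y n : linear_subspace H -> H `<=` S -> S y ->
  (forall a, H a -> H (lie a y)) -> (forall e, T (iter n (lie y) e)) ->
  acts_nilpotently H -> acts_nilpotently (adjoin H y).
Proof.
move=> sH HS Sy Hy ny [k Hk].
have H'S : adjoin H y `<=` S by exact: adjoin_min.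
suff sub i : engel_chain H i `<=` engel_chain (adjoin H y) (i * n).
  by exists (k * n)%N => e; exact: sub.
elim: i => [//|i IH] e He.
have step j x : engel_chain H i.+1 x -> engel_chain H i (iter j (lie y) x) ->
    engel_chain (adjoin H y) (i * n + j) x.
  elim: j x => [|j IHj] x Hx Hxj; first by rewrite addn0; exact: IH.
  rewrite addnS => a /(adjoinP sH) [b [c [Hb ->]]].
  have sc := engel_chain_subspace (adjoin H y) (i * n + j).
  rewrite lieDl lieZl; apply: (subspaceD sc).
    by apply: (engel_chain_le H'S (leq_addr j _)); apply: IH; exact: Hx.
  apply: (subspaceZ _ sc); apply: IHj; last by rewrite -iterSr.
  exact: engel_chain_stable.
rewrite mulSn addnC; apply: step => //.
exact: (engel_chain_le HS (leq0n i)) (ny e).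
Qed.

Lemma normalizing_element H : linear_subspace H -> H `<=` S ->
  trivial_part `<=` H -> acts_nilpotently H -> ~ (S `<=` H) ->
  exists y, [/\ S y, ~ H y & forall a, H a -> H (lie a y)].
Proof.
move=> sH HS S0H [k Hk] /existsNP [s /not_implyP [Ss nHs]].
(* each bracket with [H] makes an element of [S] lower the chain by one more step *)
pose B m := [set s | S s /\ forall i e, engel_chain H i e ->
  engel_chain H (i + k - m) (lie s e)].
have BS m a x : H a -> B m x -> B m.+1 (lie a x).
  move=> Ha [Sx Bx]; split; first exact: (Slie (HS _ Ha) Sx).
  move=> i e Hi; rewrite lieA.
  apply: subspaceB; first exact: engel_chain_subspace.
    rewrite subnS; have := Bx i e Hi; case: (i + k - m)%N => [|p] /= Hp.
      exact: ST (HS _ Ha) Hp.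
    exact: Hp.
  case: i Hi => [|i] Hi.
    apply: (engel_chain_le HS (leq0n _)).
    by apply: ST => //; exact: (ST (HS _ Ha) Hi).
  by rewrite addSn subSS; apply: Bx; exact: Hi.
have Bs : B 0%N s.
  split=> // i e _; rewrite subn0.
  by apply: (engel_chain_le HS (leq_addl _ _)); exact: Hk.
(* After [k + k] brackets with [H] an element of [S] sends all of [L], the [k]-th term of the chain,
   into [T]; it then lies in [trivial_part], hence in [H]. So some earlier bracket is the last one
   outside [H]. *)
have {Bs} : exists2 m, (m <= k + k)%N & B (k + k - m)%N s.
  by exists (k + k)%N; rewrite ?subnn.
move=> [m]; elim: m s Ss nHs => [|m IH] s Ss nHs mk Bs.
  rewrite subn0 in Bs; case: nHs; apply: S0H; split=> // e.
  by have := Bs.2 k e (Hk e); rewrite subnn.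
have [Hy|] := pselect (forall a, H a -> H (lie a s)); first by exists s.
move=> /existsNP [a /not_implyP [Ha nHa]].
apply: (IH (lie a s)) => //; [exact: (Slie (HS _ Ha) Ss)|exact: ltnW|].
by rewrite -subSS subSn//; exact: BS.
Qed.

Lemma nilpotent_uniform y : S y ->
  (forall e, exists p, T (iter p (lie y) e)) ->
  exists n, forall e, T (iter n (lie y) e).
Proof.
move=> Sy ny.
have Ty p e : T e -> T (iter p (lie y) e).
  by move=> Te; elim: p => //= p; exact: ST.
have [r _ Hr] := fin_codim_span sT (subspace_setT (L := L)) (@subsetT _ T) cT.
have [n Hn] : exists n, forall e, List.In e r -> T (iter n (lie y) e).
  elim: r {Hr} => [|e r [n Hn]]; first by exists 0%N.
  have [p Hp] := ny e; exists (n + p)%N => x /= [<-|/Hn Tx].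
    by rewrite iterD; exact: Ty.
  by rewrite addnC iterD; exact: Ty.
exists n => e; apply: (Hr [set e | T (iter n (lie y) e)]) => //.
  have -> : [set e | T (iter n (lie y) e)] = iter n (fun U => lie y @^-1` U) T.
    apply/seteqP; split=> x /=; elim: n x {Hn} => //= n IH x.
      by rewrite -iterS iterSr => /IH.
    by move=> /IH; rewrite -iterSr.
  by elim: n {Hn} => //= n; exact: subspace_preimage.
by move=> x Tx; exact: Ty.
Qed.

Lemma trivial_part_fin_codim : fin_codim S trivial_part.
Proof.
have [r _ Hr] := fin_codim_span sT (subspace_setT (L := L)) (@subsetT _ T) cT.
have cU := fin_codim_big r (fun e => subspace_preimage (lie e) sT)
  (fun e => fin_codim_preimage (lie e) sT cT) (subspace_setT (L := L))
  (fin_codim_refl [set: L]).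
set U := [set x | _] in cU.
have sU : linear_subspace U.
  split; first by split=> // i _ /=; rewrite raddf0; exact: subspace0.
  move=> k x y [_ Ux] [_ Uy]; split=> // e er /=.
  by rewrite lieDr lieZr; apply: sT.2; [exact: Ux|exact: Uy].
apply: fin_codim_mono (fin_codim_restrict sU sS cU) => s [Ss [_ Us]].
split=> // e; rewrite lieC; apply: subspaceN => //; rewrite lieC.
apply: subspaceN => //.
apply: (Hr [set e | T (lie s e)]) => //.
- exact: subspace_preimage.
- by move=> x Tx; exact: ST.
- by move=> x /Us Hx /=; rewrite lieC; exact: subspaceN.
Qed.

(** A subalgebra acting nilpotently grows from [trivial_part] by one normalising element at a time
    and reaches [S] after finitely many steps. If no vector were killed modulo [T], the chain of [S]
    could never leave [T]. *)
Lemma engel : (forall a, S a -> forall e, exists p, T (iter p (lie a) e)) ->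
  (exists x, ~ T x) -> exists x, ~ T x /\ forall a, S a -> T (lie a x).
Proof.
move=> Snil [x0 nTx0].
have S0sub : linear_subspace trivial_part.
  split; first by split=> [|e]; rewrite ?lie0l; exact: subspace0.
  move=> k x y [Sx Tx] [Sy Ty]; split=> [|e]; first exact: sS.2.
  by rewrite lieDl lieZl; exact: sT.2.
have S0lie a b : S a -> trivial_part b -> trivial_part (lie a b).
  move=> Sa [Sb Tb]; split=> [|e]; first exact: Slie.
  by rewrite lieA; apply: subspaceB => //; exact: ST.
suff [k Sk] : acts_nilpotently S.
  apply: contrapT => nex.
  have C1 : engel_chain S 1 `<=` T.
    by move=> x Hx; apply: contrapT => nTx; apply: nex; exists x.
  have CT i : engel_chain S i `<=` T.
    elim: i => // i IH x Hx; apply: C1 => a Sa; apply: IH; exact: Hx.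
  by apply: nTx0; exact: (CT k).
have [n Hn] := trivial_part_fin_codim.
have : exists H, [/\ linear_subspace H, forall a b, H a -> H b -> H (lie a b),
    H `<=` S, trivial_part `<=` H & acts_nilpotently H] /\ codim_le S n H.
  exists trivial_part; split=> //; split=> //.
  - by move=> a b [Sa _]; exact: S0lie.
  - by move=> s [].
  - by exists 1%N => e s [_ Ts]; exact: Ts.
elim: n {Hn} => [|n IH] [H [[sH Hlie HS S0H [k nH]] Hn]].
  exists k => e; have SH := Hn; elim: k e {nH} (nH e) => //= k IH e He a Sa.
  by apply: IH; exact: (He a (SH _ Sa)).
have [SH|nSH] := pselect (S `<=` H).
  exists k => e; elim: k e {nH} (nH e) => //= k IHk e He a Sa.
  by apply: IHk; exact: (He a (SH _ Sa)).
have [y [Sy nHy Hy]] := normalizing_element sH HS S0H (ex_intro _ k nH) nSH.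
apply: IH; exists (adjoin H y); split; last exact: codim_le_exchange.
have H'S : adjoin H y `<=` S by exact: adjoin_min.
split=> //; first exact: adjoin_subspace.
- move=> _ _ /(adjoinP sH)[a [c [Ha ->]]] /(adjoinP sH)[b [d [Hb ->]]].
  apply: adjoin_sub; rewrite lieDl !lieDr !lieZl !lieZr lie_alternating.
  rewrite !scaler0 addr0; apply: subspaceD => //.
    by apply: subspaceD => //; [exact: Hlie|apply: subspaceZ => //; exact: Hy].
  by apply: subspaceZ => //; rewrite lieC; apply: subspaceN => //; exact: Hy.
- by apply: subset_trans S0H _; exact: adjoin_sub.
have [m Hm] := nilpotent_uniform Sy (Snil y Sy).
by apply: acts_nilpotently_adjoin Hm _ => //; exists k.
Qed.

End Engel.

(** * Weights along a filtration *)

Section ComplexArchimedean.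
Context {R : realType}.
Implicit Types (a b c e q : R[i]).

Lemma complex_ge0P c : 0 <= c -> exists2 r : R, 0 <= r & c = r%:C%C.
Proof.
move=> c0; have cE : (complex.Re c)%:C%C = c by rewrite RRe_real// ger0_real.
by exists (complex.Re c) => //; rewrite -cE lecR in c0.
Qed.

Lemma complex_archimedean a b : 0 <= b -> 0 < a -> exists N, b < N%:R * a.
Proof.
move=> /complex_ge0P [r r0 ->] a0.
have [t _ aE] := complex_ge0P (ltW a0); move: a0; rewrite aE ltcR => t0.
exists (Num.bound (r / t)); rewrite -(rmorph_nat (real_complex R)) -rmorphM /= ltcR.
by rewrite -ltr_pdivrMr//; apply: archi_boundP; rewrite divr_ge0// ltW.
Qed.

Lemma complex_geometric q a e : 0 <= q -> q < 1 -> 0 <= a -> 0 < e ->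
  exists n, q ^+ n * a < e.
Proof.
move=> /complex_ge0P [r r0 ->] + /complex_ge0P [t t0 ->] e0.
have [s _ eE] := complex_ge0P (ltW e0); move: e0; rewrite eE ltcR => s0.
rewrite -[1]/(1%:C%C) ltcR => r1.
have rn : `|r| < 1 by rewrite ger0_norm.
have s1 : 0 < s / (t + 1) by rewrite divr_gt0// ltr_wpDl.
have /cvgr0Pnorm_lt/(_ _ s1) := cvg_expr rn.
move=> [n _ /(_ n (leqnn n)) /=]; rewrite ger0_norm ?exprn_ge0// => Hn.
exists n; rewrite -rmorphXn -rmorphM /= ltcR.
apply: (@le_lt_trans _ _ (r ^+ n * (t + 1))).
  by rewrite ler_wpM2l ?exprn_ge0// lerDl.
by rewrite -ltr_pdivlMr// ltr_wpDl.
Qed.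

End ComplexArchimedean.

(* Otherwise [(lie h / kappa)^n x] would be elements of [x + T] tending to [0]. *)
Lemma ad_shift_injective_mod (R : realType) (L : banachLieType R) (h : L)
    (T : set L) (C kappa : R[i]) (x : L) :
  linear_subspace T -> closed T -> (forall x, T x -> T (lie h x)) ->
  0 <= C -> (forall x, `|lie h x| <= C * `|x|) -> C < `|kappa| ->
  T (ad_shift h kappa x) -> T x.
Proof.
move=> sT clT hT C0 HC Ck Tx.
have k0 : 0 < `|kappa| by exact: le_lt_trans Ck.
have kn0 : kappa != 0 by rewrite -normr_gt0.
pose y n := kappa ^- n *: iter n (lie h) x.
have Ty n : T (x - y n).
  elim: n => [|n IH]; first by rewrite /y expr0 invr1 scale1r subrr; exact: subspace0.
  have -> : x - y n.+1 = kappa^-1 *: (lie h (x - y n) - ad_shift h kappa x).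
    have -> : lie h (x - y n) - ad_shift h kappa x = kappa *: x - lie h (y n).
      by rewrite /ad_shift lieBr opprB addrC addrA subrK.
    rewrite scalerBr scalerA mulVf// scale1r /y lieZr scalerA.
    by rewrite exprS invfM iterS.
  by apply: subspaceZ => //; apply: subspaceB => //; exact: hT.
have yn n : `|y n| <= (C / `|kappa|) ^+ n * `|x|.
  rewrite /y normrZ normfV normrX expr_div_n mulrAC [leRHS]mulrC.
  rewrite ler_wpM2l ?invr_ge0 ?exprn_ge0//.
  elim: n => [|n IH]; first by rewrite expr0 mul1r.
  rewrite iterS; apply: le_trans (HC _) _.
  by rewrite exprS -mulrA ler_wpM2l.
apply: clT => B /nbhs_ballP [e /= e0 eB].
have [||||n Hn] := @complex_geometric R (C / `|kappa|) `|x| e.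
- by rewrite divr_ge0.
- by rewrite ltr_pdivrMr// mul1r.
- by [].
- by [].
exists (x - y n); split=> //; apply: eB.
rewrite -ball_normE /= opprB addrC subrK.
exact: le_lt_trans Hn.
Qed.

Section Filtration.
Context {R : realType} {L : banachLieType R} (F : nat -> set L).
Context (Fsub : forall j, linear_subspace (F j))
  (Fdecr : forall j, F j.+1 `<=` F j)
  (Flie : forall j a x, F j.+1 x -> F j (lie a x))
  (Fcl : forall j, closed (F j)) (Fcodim : forall j, fin_codim [set: L] (F j)).

Lemma filtration_le i j : (i <= j)%N -> F j `<=` F i.
Proof.
by move=> /subnK <-; elim: (j - i)%N => // n IH x /Fdecr; exact: IH.
Qed.

Lemma filtration_lieC j a x : F j.+1 x -> F j (lie x a).
Proof. by move=> Fx; rewrite lieC; apply: subspaceN => //; exact: Flie. Qed.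

Lemma filtration_iter n j a x : F (j + n)%N x -> F j (iter n (lie a) x).
Proof.
elim: n j x => [|n IH] j x; first by rewrite addn0.
by rewrite addnS => Fx; rewrite iterSr; apply: IH; exact: Flie.
Qed.

Context (h : L) (Fh : forall j x, F j x -> F j (lie h x)).
Context (C : R[i]) (C0 : 0 <= C) (HC : forall x, `|lie h x| <= C * `|x|).

Local Notation W j := (weight h (F j)).

Lemma filtered_weight_le i j mu : (i <= j)%N -> W j mu `<=` W i mu.
Proof. by move=> ij; apply: weight_mono; exact: filtration_le. Qed.

Lemma filtered_weight_subspace j mu : linear_subspace (W j mu).
Proof. by apply: weight_subspace => //; exact: Fh. Qed.

(** Leibniz' rule for shifts reduces to the case of one factor in [F k.+1]; that is not an ideal,
    and its brackets with [L] lie only in [F k], which is the lost level. *)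
Lemma filtered_weight_lie k mu nu x y :
  W k.+1 mu x -> W k.+1 nu y -> W k (mu + nu) (lie x y).
Proof.
move=> [p Tp] [q Tq]; move: {2}(p + q)%N (leqnn (p + q)) => n.
elim: n p q x y Tp Tq => [|n IH] p q x y Tp Tq pq.
  move: pq Tp; rewrite leqn0 addn_eq0 => /andP[/eqP -> _] /= Fx.
  by apply: sub_weight; exact: filtration_lieC.
case: p Tp pq => [/filtration_lieC Fx _|p Tp]; first exact: sub_weight.
case: q Tq => [Fy _|q Tq pq].
  by apply: sub_weight; exact: Flie.
apply: weight_unshift; rewrite ad_shift_lie.
apply: subspaceD (filtered_weight_subspace k _) _ _.
  by apply: (IH p q.+1) => //; rewrite -?iterSr// -ltnS -addSn.
by apply: (IH p.+1 q) => //; rewrite -?iterSr// -ltnS -addnS.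
Qed.

Lemma large_weight j kappa : C < `|kappa| -> W j kappa `<=` F j.
Proof.
move=> Ck x [p]; elim: p x => [//|p IH] x; rewrite iterSr => /IH.
exact: ad_shift_injective_mod (Fsub j) (@Fcl j) (@Fh j) C0 HC Ck.
Qed.

Lemma weight_iter_lie n k lambda mu x y : W (k + n) lambda x -> W (k + n) mu y ->
  W k (mu + lambda *+ n) (iter n (lie x) y).
Proof.
elim: n k mu y => [|n IH] k mu y Wx Wy.
  by rewrite addn0 in Wy; rewrite mulr0n addr0.
rewrite iterSr mulrS addrA [mu + lambda]addrC; apply: IH.
  by apply: filtered_weight_le Wx; rewrite leq_add2l.
by rewrite addnS in Wx Wy; exact: filtered_weight_lie.
Qed.

(** All weights on [L / F j] lie in the disc of radius [C], of diameter [C *+ 2], so adding [N]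
    times [lambda] takes each of them out of it. The [N] brackets cost [N] levels. *)
Lemma weight_vector_nilpotent j N lambda x n w :
  C *+ 2 < N%:R * `|lambda| -> (N <= j)%N -> W j lambda x -> (N <= n)%N ->
  F (j - N) (iter n (lie x) w).
Proof.
move=> HN Nj Wx Nn; rewrite -(subnKC Nn) iterD.
move: (iter _ _ w) => {}w.
have sP : linear_subspace [set w | F (j - N) (iter N (lie x) w)].
  have iterP k u v : iter N (lie x) (k *: u + v) =
      k *: iter N (lie x) u + iter N (lie x) v.
    by elim: N {HN Nj Nn} => //= m ->; rewrite lieDr lieZr.
  split=> [|k u v Fu Fv] /=; last by rewrite iterP; exact: (Fsub _).2.
  have -> : iter N (lie x) 0 = 0.
    by elim: N {HN Nj Nn iterP} => //= m ->; rewrite raddf0.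
  exact: subspace0.
apply: (weight_decomposition (Fsub j) (@Fh j) (Fcodim j)
  (subspace_setT (L := L)) _ sP _ I) => // mu v [Wv _] /=.
have [Cmu|Cmu] := real_leP (normr_real mu) (ger0_real C0); last first.
  by apply: filtration_iter; rewrite subnK//; exact: large_weight Wv.
apply: (@large_weight _ (mu + lambda *+ N)); last first.
  by apply: weight_iter_lie; rewrite subnK.
rewrite -(ltrD2r `|mu|); apply: (@lt_le_trans _ _ `|lambda *+ N|); last first.
  by have := ler_normB (mu + lambda *+ N) mu; rewrite addrAC subrr add0r.
rewrite normrMn -mulr_natl; apply: le_lt_trans HN.
by rewrite mulr2n lerD2l.
Qed.

(** Decompose [x] at level [j]: a component of weight other than [mu] also has weight [mu] modulo
    [F i], so it vanishes there. *)
Lemma weight_lift i j mu x : (i <= j)%N -> W i mu x ->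
  exists2 y, W j mu y & F i (x - y).
Proof.
move=> ij.
apply: (weight_decomposition (Fsub j) (@Fh j) (Fcodim j)
  (filtered_weight_subspace i mu) _ _ (Q := [set x | exists2 y, W j mu y & F i (x - y)])).
- by move=> y; apply: weight_lie => //; exact: Fh.
- split.
    exists 0; first exact: (subspace0 (filtered_weight_subspace j mu)).
    by rewrite subr0; exact: subspace0.
  move=> k u v [a Wa Fa] [b Wb Fb]; exists (k *: a + b).
    exact: (filtered_weight_subspace _ _).2.
  have -> : k *: u + v - (k *: a + b) = k *: (u - a) + (v - b).
    by rewrite scalerBr opprD addrACA.
  exact: (Fsub i).2.
move=> nu v [Wv Wiv]; have [->|mn] := eqVneq mu nu.
  by exists v => //; rewrite subrr; exact: subspace0.
exists 0; first exact: (subspace0 (filtered_weight_subspace j mu)).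
rewrite subr0; apply: (weight_disjoint (Fsub i) (@Fh i) mn) => //.
exact: filtered_weight_le Wv.
Qed.

(* A bracket of weight vectors loses a level of the filtration; by [weight_lift]
   the loss can be made good up to [F 1], so for large [K] this span is a
   subalgebra. *)
Definition weight_span K : set L := [set q | forall U, linear_subspace U ->
  F 1 `<=` U -> (forall mu, mu != 0 -> W K mu `<=` U) ->
  (forall mu x y, mu != 0 -> W K mu x -> W K (- mu) y -> U (lie x y)) -> U q].

Lemma weight_span_subspace K : linear_subspace (weight_span K).
Proof.
split=> [U sU *|k x y Qx Qy U sU FU WU BU]; first exact: subspace0.
by apply: sU.2; [exact: Qx|exact: Qy].
Qed.

Lemma weight_span_filtration K : F 1 `<=` weight_span K.
Proof. by move=> x Fx U _ FU _ _; exact: FU. Qed.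

Context (K : nat) (K3 : (3 <= K)%N).
Local Notation Q := (weight_span K).

Lemma weight_span_weight j mu : (0 < j <= K)%N -> mu != 0 -> W j mu `<=` Q.
Proof.
move=> /andP[j0 jK] mu0 x /(weight_lift jK) [y Wy Fxy].
rewrite -(subrK y x); apply: (subspaceD (weight_span_subspace K)).
  by apply: weight_span_filtration; exact: filtration_le Fxy.
by move=> U sU FU WU BU; exact: (WU mu).
Qed.

Lemma weight_span_opposite j mu x y : (1 < j <= K)%N -> mu != 0 ->
  W j mu x -> W j (- mu) y -> Q (lie x y).
Proof.
move=> /andP[j1 jK] mu0 /(weight_lift jK) [x' Wx Fx] /(weight_lift jK) [y' Wy Fy].
have sQ := weight_span_subspace K.
have F2 : F j `<=` F 2 by exact: filtration_le.
rewrite -(subrK x' x) lieDl; apply: (subspaceD sQ).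
  by apply: weight_span_filtration; apply: filtration_lieC; exact: F2.
rewrite -(subrK y' y) lieDr; apply: (subspaceD sQ).
  by apply: weight_span_filtration; apply: Flie; exact: F2.
by move=> U sU FU WU BU; exact: (BU mu).
Qed.

Let K1 : (K.-1.+1 = K)%N. Proof. by case: K K3. Qed.
Let K2 : (K.-2.+1 = K.-1)%N. Proof. by case: K K3 => [//|[]]. Qed.

Let dec (P : set L) : linear_subspace P -> (forall nu, W K nu `<=` P) ->
  forall g, P g.
Proof.
move=> sP WP g.
by apply: (weight_decomposition (Fsub K) (@Fh K) (Fcodim K)
  (subspace_setT (L := L)) _ sP _ I) => // mu v [Wv _]; exact: (WP mu).
Qed.

Let subspace_liel (P : set L) z : linear_subspace P ->
  linear_subspace [set g | P (lie g z)].
Proof.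
move=> sP; split=> [|k u v Pu Pv] /=; first by rewrite lie0l; exact: subspace0.
by rewrite lieDl lieZl; exact: sP.2.
Qed.

Lemma lie_weight_span g mu x : mu != 0 -> W K mu x -> Q (lie g x).
Proof.
move=> mu0 Wx; move: g; apply: dec.
  exact: (subspace_liel x (weight_span_subspace K)).
move=> nu g Wg /=; have [nm|nm] := eqVneq (nu + mu) 0.
  have nu0 : nu != 0.
    by apply: contra_neq mu0 => n0; move: nm; rewrite n0 add0r.
  apply: (@weight_span_opposite K nu) => //; first by rewrite leqnn andbT ltnW.
  by move/eqP: nm; rewrite addrC addr_eq0 => /eqP <-.
apply: (@weight_span_weight K.-1 (nu + mu)) => //.
  by rewrite -ltnS K1 (leq_trans _ K3)//= -{2}K1.
by apply: filtered_weight_lie; rewrite K1.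
Qed.

(** For [g] of nonzero weight the triple bracket sits at level [K - 2], which [K3] keeps positive.
    For weight 0, Jacobi gives two brackets of opposite weights at level [K - 1], and these need
    level 2, since lifting errors lose one level in the bracket. *)
Lemma lie_weight_span_opposite g mu x y :
  mu != 0 -> W K mu x -> W K (- mu) y -> Q (lie g (lie x y)).
Proof.
move=> mu0 Wx Wy; move: g; apply: dec.
  exact: (subspace_liel _ (weight_span_subspace K)).
have KK : (K.-1 <= K)%N by exact: leq_pred.
have Wx' := filtered_weight_le KK Wx; have Wy' := filtered_weight_le KK Wy.
move=> nu g Wg /=; have [n0|n0] := eqVneq nu 0.
  rewrite lie_derivation; apply: (subspaceD (weight_span_subspace K)).
    apply: (@weight_span_opposite K.-1 mu) => //.
      by rewrite -ltnS K1 KK andbT.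
    by rewrite -[mu]add0r -n0; apply: filtered_weight_lie; rewrite K1.
  apply: (@weight_span_opposite K.-1 mu) => //.
    by rewrite -ltnS K1 KK andbT.
  by rewrite -[- mu]add0r -n0; apply: filtered_weight_lie; rewrite K1.
apply: (@weight_span_weight K.-2 nu) => //.
  by rewrite -ltnS K2 -ltnS K1 K3 (leq_trans (leq_pred _) KK).
rewrite -[nu]addr0 -(subrr mu); apply: filtered_weight_lie; rewrite K2.
  exact: filtered_weight_le Wg.
by apply: filtered_weight_lie; rewrite K1.
Qed.

(** Brackets of the nonzero-weight part with all of [L] stay in the span, so [F 1] alone decides
    whether the span is an ideal or only a subalgebra. *)
Lemma weight_span_ideal : (forall g x, F 1 x -> F 1 (lie g x)) ->
  forall g q, Q q -> Q (lie g q).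
Proof.
move=> F1 g q Qq; apply: (Qq [set q | Q (lie g q)]).
- exact: subspace_preimage (lie g) (weight_span_subspace K).
- by move=> x Fx; apply: weight_span_filtration; exact: F1.
- by move=> mu mu0 x Wx; exact: lie_weight_span Wx.
- by move=> mu x y mu0 Wx Wy; exact: lie_weight_span_opposite Wx Wy.
Qed.

Lemma weight_span_subalgebra : (forall g x, F 1 g -> F 1 x -> F 1 (lie g x)) ->
  forall p q, Q p -> Q q -> Q (lie p q).
Proof.
move=> F1; have sQ := weight_span_subspace K.
have QF x q : F 1 x -> Q q -> Q (lie x q).
  move=> Fx Qq; apply: (Qq [set q | Q (lie x q)]).
  - exact: subspace_preimage.
  - by move=> y Fy; apply: weight_span_filtration; exact: F1.
  - by move=> mu mu0 y Wy; exact: lie_weight_span Wy.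
  - by move=> mu y z mu0 Wy Wz; exact: lie_weight_span_opposite Wy Wz.
move=> p q Qp Qq; apply: (Qq [set q | Q (lie p q)]).
- exact: subspace_preimage.
- move=> x Fx; suff : Q (lie p x) by [].
  by rewrite lieC; apply: (subspaceN sQ); exact: QF.
- by move=> mu mu0 x Wx; exact: lie_weight_span Wx.
- by move=> mu x y mu0 Wx Wy; exact: lie_weight_span_opposite Wx Wy.
Qed.

End Filtration.

(** * Truncated exponentials *)

Lemma triangular_sum_nat (V : nmodType) (g : nat -> nat -> V) T :
  \sum_(0 <= n < T) \sum_(0 <= i < n.+1) g i (n - i)%N =
  \sum_(0 <= i < T) \sum_(0 <= j < T - i) g i j.
Proof.
elim: T => [|T IH]; first by rewrite !big_geq.
rewrite big_nat_recr//= IH [RHS]big_nat_recr//= subSnn big_nat1.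
rewrite [in LHS]big_nat_recr//= subnn addrA; congr (_ + _).
rewrite -big_split /=; apply: eq_big_nat => i /andP[_ iT].
by rewrite subSn 1?ltnW// big_nat_recr.
Qed.

Lemma pascal_sum_nat (V : nmodType) (f : nat -> V) n :
  \sum_(0 <= i < n.+2) f i *+ 'C(n.+1, i) =
  \sum_(0 <= i < n.+1) f i.+1 *+ 'C(n, i) + \sum_(0 <= i < n.+1) f i *+ 'C(n, i).
Proof.
rewrite big_nat_recl//; under eq_bigr do rewrite binS mulrnDr.
rewrite big_split /= addrA [RHS]addrC; congr (_ + _).
transitivity (\sum_(0 <= i < n.+2) f i *+ 'C(n, i)).
  by rewrite [RHS]big_nat_recl// !bin0.
by rewrite big_nat_recr//= bin_small// mulr0n addr0.
Qed.

Section TruncatedExponential.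
Context {R : realType} {L : banachLieType R}.
Implicit Types (x y a b : L).

Local Notation invf n := ((n`!%:R : R[i])^-1).

Lemma iter_lieD n x a b : iter n (lie x) (a + b) = iter n (lie x) a + iter n (lie x) b.
Proof. by elim: n => //= n ->; rewrite lieDr. Qed.

Lemma iter_lieZ n x k a : iter n (lie x) (k *: a) = k *: iter n (lie x) a.
Proof. by elim: n => //= n ->; rewrite lieZr. Qed.

Lemma iter_lie0 n x : iter n (lie x) 0 = 0.
Proof. by elim: n => //= n ->; rewrite raddf0. Qed.

Lemma iter_lie_sum n x I (r : seq I) (P : pred I) (f : I -> L) :
  iter n (lie x) (\sum_(i <- r | P i) f i) = \sum_(i <- r | P i) iter n (lie x) (f i).
Proof.
elim/big_rec2: _ => [|i u v _ <-]; first exact: iter_lie0.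
exact: iter_lieD.
Qed.

Lemma iter_lie_scale n x t a : iter n (lie (t *: x)) a = t ^+ n *: iter n (lie x) a.
Proof.
elim: n => [|n IH]; first by rewrite expr0 scale1r.
by rewrite !iterS IH lieZl lieZr scalerA exprS.
Qed.

Lemma iter_lie_leibniz n x a b : iter n (lie x) (lie a b) =
  \sum_(0 <= i < n.+1) lie (iter i (lie x) a) (iter (n - i) (lie x) b) *+ 'C(n, i).
Proof.
elim: n => [|n IH]; first by rewrite big_nat1 bin0 mulr1n.
rewrite (pascal_sum_nat (fun i => lie (iter i (lie x) a) (iter (n.+1 - i) (lie x) b))).
rewrite iterS IH raddf_sum -big_split /=; apply: eq_big_nat => i /andP[_ le_in].
by rewrite raddfMn /= lie_derivation mulrnDl subSS subSn.
Qed.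

(** The exponential of [lie x] cut off after [T] terms. It is used for [lie x] nilpotent modulo a
    subspace, where the tail does not matter and convergence is not at issue. *)
Definition texp T x a := \sum_(0 <= n < T) invf n *: iter n (lie x) a.

Lemma texpD T x a b : texp T x (a + b) = texp T x a + texp T x b.
Proof.
by rewrite -big_split; apply: eq_bigr => n _; rewrite iter_lieD scalerDr.
Qed.

Lemma texpZ T x k a : texp T x (k *: a) = k *: texp T x a.
Proof.
rewrite scaler_sumr; apply: eq_bigr => n _.
by rewrite iter_lieZ !scalerA mulrC.
Qed.

Lemma invf_bin n i : (i <= n)%N -> invf n *+ 'C(n, i) = invf i * invf (n - i).
Proof.
move=> le_in; rewrite -(bin_fact le_in) !natrM !invfM.
rewrite -[LHS]mulr_natl !mulrA.
rewrite mulfV ?mul1r// pnatr_eq0 -lt0n bin_gt0 //.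
Qed.

Section Nilpotent.
Context (G : set L) (sG : linear_subspace G) (x : L) (N : nat) (N0 : (0 < N)%N).
Context (xG : forall n a, (N <= n)%N -> G (iter n (lie x) a)).

(** The two sides differ by the terms with [i + j >= N.*2]; there [i] or [j] is at least [N], which
    is why the cut-off is [N.*2]. *)
Lemma texp_lie (H : set L) a b : linear_subspace H ->
  (forall u v, G v -> H (lie u v)) ->
  H (lie (texp N.*2 x a) (texp N.*2 x b) - texp N.*2 x (lie a b)).
Proof.
move=> sH GH; set T := N.*2.
pose g i j := (invf i * invf j) *: lie (iter i (lie x) a) (iter j (lie x) b).
have -> : texp T x (lie a b) =
    \sum_(0 <= i < T) \sum_(0 <= j < T - i) g i j.
  rewrite -triangular_sum_nat; apply: eq_big_nat => n _.
  rewrite iter_lie_leibniz scaler_sumr; apply: eq_big_nat => i /andP[_ le_in].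
  by rewrite /g -invf_bin// -scalerMnr scalerMnl.
have -> : lie (texp T x a) (texp T x b) =
    \sum_(0 <= i < T) \sum_(0 <= j < T) g i j.
  rewrite lie_suml; apply: eq_bigr => i _.
  rewrite raddf_sum; apply: eq_bigr => j _ /=.
  by rewrite lieZl lieZr scalerA.
rewrite -sumrB big_nat; apply: subspace_sum => // i /andP[_ iT].
rewrite (@big_cat_nat _ _ _ (T - i))//= ?leq_subr// addrC addrK.
rewrite big_nat; apply: subspace_sum => // j /andP[Tij jT].
apply: subspaceZ => //.
have [Ni|iN] := leqP N i.
  by rewrite lieC; apply: subspaceN => //; apply/GH/xG.
by apply/GH/xG; lia.
Qed.

(** The terms of total degree [n] with [0 < n < N.*2] cancel by the expansion of [(1 - 1) ^+ n];
    those of higher degree lie in [G]. *)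
Lemma texpK a : G (texp N.*2 (- x) (texp N.*2 x a) - a).
Proof.
set T := N.*2.
pose g i j := ((-1) ^+ i * invf i * invf j) *: iter (i + j) (lie x) a.
have -> : texp T (- x) (texp T x a) = \sum_(0 <= i < T) \sum_(0 <= j < T) g i j.
  apply: eq_bigr => i _; rewrite iter_lie_sum scaler_sumr.
  apply: eq_bigr => j _; rewrite iter_lieZ scalerA -scaleN1r iter_lie_scale.
  by rewrite -iterD scalerA /g mulrAC [invf i * _]mulrC.
have aE : \sum_(0 <= i < T) \sum_(0 <= j < T - i) g i j = a.
  rewrite -triangular_sum_nat.
  rewrite (@big_ltn _ _ _ 0); last by rewrite double_gt0.
  rewrite big_nat1 /g subnn expr0 fact0 invr1 !mul1r scale1r /= big_nat.
  rewrite big1 ?addr0// => n /andP[n0 _].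
  transitivity ((invf n * (1 - 1) ^+ n) *: iter n (lie x) a); last first.
    by rewrite subrr expr0n gtn_eqF// mulr0 scale0r.
  rewrite exprDn big_distrr scaler_suml big_mkord; apply: eq_bigr => i _.
  have le_in : (i <= n)%N by rewrite -ltnS.
  rewrite subnKC// expr1n mul1r /=; congr (_ *: _).
  by rewrite mulrnAr -mulrnAl invf_bin// [RHS]mulrC mulrA.
rewrite -[X in _ - X]aE -sumrB big_nat; apply: subspace_sum => // i /andP[_ iT].
rewrite (@big_cat_nat _ _ _ (T - i))//= ?leq_subr// addrC addrK.
rewrite big_nat; apply: subspace_sum => // j /andP[Tij jT].
by apply: subspaceZ => //; apply: xG; lia.
Qed.

End Nilpotent.

End TruncatedExponential.

(** * Finite extensions of closed subspaces *)

Section ComplexComplete.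
Context {R : realType}.
Implicit Types (z w : R[i]).

Lemma complex_Re_le z : `|complex.Re z|%:C%C <= `|z|.
Proof.
case: z => a b; rewrite normc_def lecR /= -sqrtr_sqr ler_wsqrtr//.
by rewrite lerDl sqr_ge0.
Qed.

Lemma complex_Im_le z : `|complex.Im z|%:C%C <= `|z|.
Proof.
case: z => a b; rewrite normc_def lecR /= -sqrtr_sqr ler_wsqrtr//.
by rewrite lerDr sqr_ge0.
Qed.

Lemma complex_norm_le z : `|z| <= (`|complex.Re z| + `|complex.Im z|)%:C%C.
Proof.
case: z => a b; rewrite normc_def lecR /= -[leRHS]ger0_norm ?addr_ge0//.
rewrite -sqrtr_sqr ler_wsqrtr// sqrrD !real_normK ?num_real//.
by rewrite addrAC lerDl mulrn_wge0// mulr_ge0.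
Qed.

Lemma complex_complete (F : set_system R[i]) : ProperFilter F ->
  (forall e : R[i], 0 < e -> exists w : R[i], F [set z | `|z - w| < e]) ->
  exists l : R[i], forall e : R[i], 0 < e -> F [set z | `|z - l| < e].
Proof.
move=> FF Fc.
have part (p : R[i] -> R) : (forall z w, p (z - w) = p z - p w) ->
    (forall z, `|p z|%:C%C <= `|z|) -> cvg (p @ F).
  move=> pB ple; apply/cauchy_cvgP/cauchy_exP => e e0.
  have [|w Fw] := Fc e%:C%C; first by rewrite ltcR.
  exists (p w); apply: (@filterS _ F _ _ (p @^-1` ball (p w) e) _ Fw) => z /= zw.
  rewrite -ball_normE /= distrC -pB -ltcR; exact: le_lt_trans (ple _) zw.
have /cvg_ex [a Fa] := part (@complex.Re R) (fun z w => raddfB _ z w) complex_Re_le.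
have /cvg_ex [b Fb] := part (@complex.Im R) (fun z w => raddfB _ z w) complex_Im_le.
exists (a +i* b)%C => e e0.
have [r _ eE] := complex_ge0P (ltW e0); move: e0; rewrite eE ltcR => r0.
have r20 : 0 < r / 2 by rewrite divr_gt0.
have /cvgrPdist_lt/(_ _ r20) Ha := Fa; have /cvgrPdist_lt/(_ _ r20) Hb := Fb.
near=> z; apply: le_lt_trans (complex_norm_le _) _; rewrite ltcR [r]splitr.
rewrite !raddfB /= distrC [X in _ + X]distrC.
by apply: ltrD; near: z.
Unshelve. all: end_near. Qed.

End ComplexComplete.

Section ClosedExtension.
Context {R : realType} {L : banachLieType R}.
Implicit Types (T U : set L) (x y : L).

Lemma closed_ballP T : closed T <->
  forall y, (forall e : R[i], 0 < e -> exists2 z, T z & `|y - z| < e) -> T y.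
Proof.
split=> [clT y Hy|H y Hy].
  apply: clT => B /nbhs_ballP [e /= e0 eB]; have [z Tz yz] := Hy e e0.
  by exists z; split=> //; apply: eB; rewrite -ball_normE.
apply: H => e e0; have [z [Tz]] := Hy _ (nbhsx_ballx y e e0).
by rewrite -ball_normE => yz; exists z.
Qed.

(** The distance [d] from [x] to [T] is positive, so the coefficient [k] of [z] satisfies
    [|k| * d <= |z|]; coefficients converge along with the elements. *)
Lemma adjoin_closed T x : linear_subspace T -> closed T -> closed (adjoin T x).
Proof.
move=> sT clT.
have [Tx|nTx] := pselect (T x).
  suff -> : adjoin T x = T by [].
  by apply/seteqP; split; [exact: adjoin_min|exact: adjoin_sub].
have [d d0 Hd] : exists2 d : R[i], 0 < d & forall t, T t -> d <= `|x - t|.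
  apply: contrapT => nd; apply: nTx; apply: (closed_ballP T).1 clT _ _ => e e0.
  apply: contrapT => nz; apply: nd; exists e => // t Tt.
  rewrite real_leNgt ?normr_real ?gtr0_real//; apply/negP => xt.
  by apply: nz; exists t.
have coef k z : T (z - k *: x) -> `|k| * d <= `|z|.
  move=> Tz; have [->|k0] := eqVneq k 0; first by rewrite normr0 mul0r.
  rewrite mulrC -ler_pdivlMr ?normr_gt0//.
  have := Hd (- k^-1 *: (z - k *: x)) (subspaceZ _ sT Tz).
  rewrite scalerBr scalerA mulNr mulVf// scaleN1r opprK.
  by rewrite scaleNr opprD opprK [x + _]addrC subrK normrZ normfV mulrC.
apply/closed_ballP => y Hy.
pose D := adjoin T x.
pose k z := if pselect (D z) is left h then projT1 (cid h) else 0.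
have kP z : D z -> T (z - k z *: x).
  by rewrite /k; case: pselect => // h _; case: (cid h).
(* The filter of the coefficients of the elements of [D] close to [y]; its limit is the coefficient
   of [y]. *)
pose F : set_system R[i] := [set A | exists2 e : R[i], 0 < e &
  forall z, D z -> `|y - z| < e -> A (k z)].
have FF : ProperFilter F.
  apply: Build_ProperFilter_ex => [A [e e0 He]|].
    by have [z Dz yz] := Hy e e0; exists (k z); exact: He.
  split; first by exists 1.
    move=> A B [e e0 He] [f f0 Hf].
    have ef : e <= f \/ f <= e.
      by apply/orP; apply: real_leVge; rewrite gtr0_real.
    case: ef => ef; [exists e|exists f] => // z Dz yz; split;
      [exact: He|apply: Hf => //|apply: He => //|exact: Hf]; exact: lt_le_trans ef.
  by move=> A B AB [e e0 He]; exists e => // z Dz yz; apply/AB/He.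
have [e e0|l Hl] := @complex_complete R F FF.
  have e20 : 0 < e * d / 2 by rewrite divr_gt0// mulr_gt0.
  have [w Dw yw] := Hy _ e20; exists (k w); exists (e * d / 2) => // z Dz yz /=.
  rewrite -(ltr_pM2r d0); apply: le_lt_trans (coef _ (z - w) _) _.
    rewrite scalerBl opprB.
    have -> : z - w + (k w *: x - k z *: x) = (z - k z *: x) - (w - k w *: x).
      by rewrite opprB addrACA [RHS]addrACA [- w - _]addrC.
    by apply: subspaceB => //; exact: kP.
  rewrite (_ : z - w = (y - w) - (y - z)); last by rewrite opprB [RHS]addrC addrA subrK.
  by apply: le_lt_trans (ler_normB _ _) _; rewrite [ltRHS]splitr; apply: ltrD.
exists l; apply: (closed_ballP T).1 clT _ _ => e e0.
have e20 : 0 < e / 2 / (`|x| + 1) by rewrite !divr_gt0// ltr_wpDl.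
have [f f0 Hf] := Hl _ e20.
have [g [g0 gf ge]] : exists g, [/\ 0 < g, g <= f & g <= e / 2].
  have /orP [ef|ef] : (f <= e / 2) || (e / 2 <= f).
    by apply: real_leVge; rewrite gtr0_real// divr_gt0.
  - by exists f.
  - by exists (e / 2); rewrite divr_gt0.
have [z Dz yz] := Hy g g0.
exists (z - k z *: x); first exact: kP.
have kl : `|k z - l| < e / 2 / (`|x| + 1).
  by apply: Hf => //; exact: lt_le_trans gf.
rewrite opprB (_ : y - l *: x + (k z *: x - z) = (y - z) + (k z - l) *: x); last first.
  by rewrite scalerBl addrACA [RHS]addrACA [- _ - z]addrC.
apply: le_lt_trans (ler_normD _ _) _; rewrite [ltRHS]splitr.
apply: ltr_leD; first exact: lt_le_trans ge.
rewrite normrZ; apply: (@le_trans _ _ (`|k z - l| * (`|x| + 1))).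
  by rewrite ler_wpM2l// lerDl.
by rewrite -ler_pdivlMr ?ltr_wpDl// ltW.
Qed.

(** This turns maximality among closed subalgebras or ideals into maximality among all of them. *)
Lemma closed_finite_extension T U : linear_subspace T -> linear_subspace U ->
  closed T -> fin_codim [set: L] T -> T `<=` U -> closed U.
Proof.
move=> + sU + [n]; elim: n T => [|n IH] T sT clT Hn TU.
  by suff -> : U = T by []; apply/seteqP; split=> // x _; exact: Hn.
have [UT|] := pselect (U `<=` T).
  by suff -> : U = T by []; apply/seteqP; split.
move=> /existsNP [x /not_implyP [Ux nTx]].
apply: (IH (adjoin T x)).
- exact: adjoin_subspace.
- exact: adjoin_closed.
- exact: codim_le_exchange.
- exact: adjoin_min.
Qed.

End ClosedExtension.

(** * Ideals in maximal subalgebras *)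

Section CanonicalFiltration.
Context {R : realType} {L : banachLieType R} (M : set L).
Context (sM : linear_subspace M) (Mlie : forall a b, M a -> M b -> M (lie a b)).
Context (clM : closed M) (cM : fin_codim [set: L] M).
Implicit Types (a b x y w : L) (s t r : seq L).

(** [lower j] is F_(j+1). The recursion applied to F_0 = L would only return L, so it has to start
    at [M]. *)
Fixpoint lower j : set L :=
  if j is i.+1 then [set x | lower i x /\ forall a, lower i (lie a x)] else M.

Definition canonical_filtration j : set L := if j is i.+1 then lower i else setT.

Local Notation F := canonical_filtration.

Lemma canonical_filtration_subspace j : linear_subspace (F j).
Proof.
case: j => [|j]; first exact: subspace_setT.
elim: j => [//|j IH] /=; split.
  by split=> [|a]; rewrite ?raddf0; exact: subspace0.
move=> k x y [Fx Hx] [Fy Hy]; split=> [|a]; first exact: IH.2.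
by rewrite lieDr lieZr; exact: IH.2.
Qed.

Lemma canonical_filtration_closed j : closed (F j).
Proof.
case: j => [|j]; first exact: closedT.
elim: j => [//|j IH].
have -> : F j.+2 = F j.+1 `&` \bigcap_(a in [set: L]) (lie a @^-1` F j.+1).
  by apply/seteqP; split=> x [Fx Hx]; split=> // a; [move=> _; exact: Hx|exact: (Hx a I)].
apply: closedI => //; apply: closed_bigI => a _.
by apply: closed_comp => // x _; exact: lie_continuous.
Qed.

Lemma canonical_filtration_decr j : F j.+1 `<=` F j.
Proof. by case: j => [|j] x //= []. Qed.

Lemma canonical_filtration_lie j a x : F j.+1 x -> F j (lie a x).
Proof. by case: j => [|j] //= []. Qed.

Lemma canonical_filtration_stable j a x : M a -> F j x -> F j (lie a x).
Proof.
move=> Ma; case: j => [//|j]; elim: j x => [|j IH] x; first exact: Mlie.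
move=> [Fx Hx]; split=> [|b]; first exact: IH.
rewrite lie_derivation; apply: subspaceD (canonical_filtration_subspace j.+1) _ _.
  by apply: Hx.
exact/IH/Hx.
Qed.

(** [M] preserves every term, so membership in the next one is a test on finitely many elements;
    finite codimension and stationarity both rest on this. *)
Lemma canonical_filtration_span r : (forall U : set L, linear_subspace U -> M `<=` U ->
    (forall x, List.In x r -> U x) -> [set: L] `<=` U) ->
  forall j x, F j.+1 x -> (forall e, List.In e r -> F j.+1 (lie e x)) -> F j.+2 x.
Proof.
move=> Hr j x Fx Hx; split=> // a.
apply: (Hr [set a | F j.+1 (lie a x)]) => //.
  have sF := canonical_filtration_subspace j.+1.
  split=> [|k b c Hb Hc] /=; first by rewrite lie0l; exact: (subspace0 sF).
  by rewrite lieDl lieZl; exact: sF.2.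
by move=> m Mm; exact: canonical_filtration_stable.
Qed.

Lemma canonical_filtration_codim j : fin_codim [set: L] (F j).
Proof.
case: j => [|j]; first exact: fin_codim_refl.
elim: j => [//|j IH].
have [r _ Hr] := fin_codim_span sM (subspace_setT (L := L)) (@subsetT _ M) cM.
have sF := canonical_filtration_subspace j.+1.
have := fin_codim_big r (fun e => subspace_preimage (lie e) sF)
  (fun e => fin_codim_preimage (lie e) sF IH) sF IH.
apply: fin_codim_mono => x [Fx Hx]; exact: (canonical_filtration_span Hr).
Qed.

Arguments canonical_filtration : simpl never.

Let Fsub := canonical_filtration_subspace.
Let Fle i j : (i <= j)%N -> F j `<=` F i.
Proof. exact: (filtration_le canonical_filtration_decr). Qed.

Definition word s w := foldr lie w s.

Lemma word_cat s t w : word (s ++ t) w = word s (word t w).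
Proof. by rewrite /word foldr_cat. Qed.

Lemma word_filtration s j w : F (j + size s)%N w -> F j (word s w).
Proof.
elim: s j => [|a s IH] j /=; first by rewrite addn0.
by rewrite addnS => Fw; apply: canonical_filtration_lie; exact: IH.
Qed.

Lemma wordD s v w : word s (v + w) = word s v + word s w.
Proof. by elim: s => //= a s ->; rewrite lieDr. Qed.

Lemma wordZ s k w : word s (k *: w) = k *: word s w.
Proof. by elim: s => //= a s ->; rewrite lieZr. Qed.

(** Moving [a] past [b] leaves the single bracket with [lie a b] in place of two, so the error keeps
    one more level. *)
Lemma word_rcons_swap a s j w : F (j + size s).+1 w ->
  F j.+1 (word (a :: s) w - word (rcons s a) w).
Proof.
elim: s j w => [|b s IH] j w Fw.
  by rewrite subrr; exact: (subspace0 (Fsub _)).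
rewrite /= -(subrK (lie b (lie a (word s w))) (lie a (lie b (word s w)))).
rewrite -addrA; apply: subspaceD (Fsub _) _ _.
  rewrite -lieA; apply: canonical_filtration_lie; apply: word_filtration.
  by move: Fw; rewrite /= addnS !addSn.
rewrite -lieBr; apply: canonical_filtration_lie; apply: (IH j.+1).
by move: Fw; rewrite /= addnS !addSn.
Qed.

Lemma word_perm s t j w : perm_eq s t -> F (j + size s)%N w ->
  F j.+1 (word s w - word t w).
Proof.
elim: s t j => [|a s IH] t j.
  by rewrite perm_sym => /perm_nilP -> _; rewrite subrr; exact: (subspace0 (Fsub _)).
move=> st; have /splitPr : a \in t by rewrite -(perm_mem st) mem_head.
move: st => /[swap] -[t1 t2]; rewrite perm_sym -cat1s perm_catCA cat1s perm_cons perm_sym => st Fw.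
have szt : size s = (size t1 + size t2)%N by rewrite (perm_size st) size_cat.
rewrite -(subrK (lie a (word (t1 ++ t2) w)) (word (a :: s) w)) -addrA.
apply: subspaceD (Fsub _) _ _.
  rewrite -lieBr; apply: canonical_filtration_lie; apply: IH => //.
  by move: Fw; rewrite /= addnS addSn.
rewrite -cat_rcons !word_cat.
apply: (@word_rcons_swap a t1); apply: word_filtration.
by move: Fw; rewrite /= szt addnS addSn addnA.
Qed.

(** With n = [size s]: the word is zero as a map from F_n / F_(n+1) to L / M. *)
Definition kills s := forall w, F (size s) w -> F 1 (word s w).

Lemma kills_catr s t : kills s -> kills (s ++ t).
Proof.
move=> Ks w; rewrite size_cat word_cat => Fw.
by apply: Ks; exact: word_filtration.
Qed.

Lemma kills_perm s t : perm_eq s t -> kills s -> kills t.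
Proof.
move=> st Ks w; rewrite -(perm_size st) => Fw.
rewrite -(subKr (word s w) (word t w)); apply: subspaceB (Fsub _) _ _.
  exact: Ks.
exact: word_perm.
Qed.

(* On the graded object of the filtration the [lie x] commute; [x] is good when
   it acts nilpotently there. *)
Definition good x := exists n, forall w, F n w -> F 1 (iter n (lie x) w).

Lemma word_nseq n x w : word (nseq n x) w = iter n (lie x) w.
Proof. by elim: n => //= n ->. Qed.

Lemma goodP x : good x <-> exists n, kills (nseq n x).
Proof.
by split=> -[n H]; exists n => w; move: (H w); rewrite ?size_nseq word_nseq.
Qed.

(** Pigeonhole: a long word either repeats [e] at least [n] times or has [k] letters from the rest.
    The letters that kill are moved to the front, and further letters on the right do no harm. *)
Lemma good_words r : (forall x, x \in r -> good x) ->
  exists k, forall s, {subset s <= r} -> (k <= size s)%N -> kills s.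
Proof.
elim: r => [|e r IH] Hr.
  exists 1%N => -[//|a s] /(_ a); rewrite mem_head => /(_ isT); by rewrite in_nil.
have [|k Hk] := IH; first by move=> x xr; apply: Hr; rewrite inE xr orbT.
have /goodP [n Hn] : good e by apply: Hr; rewrite mem_head.
exists (k + n)%N => s sr szs.
set s1 := seq.filter (pred1 e) s; set s2 := seq.filter (predC (pred1 e)) s.
have ss : perm_eq (s1 ++ s2) s by rewrite perm_filterC.
have s1E : s1 = nseq (size s1) e by apply/all_pred1P; exact: filter_all.
have [n1|n1] := leqP n (size s1).
  apply: kills_perm ss _; rewrite s1E -(subnKC n1) nseqD -catA.
  exact: kills_catr.
have ss' : perm_eq (s2 ++ s1) s by rewrite perm_catC.
apply: kills_perm ss' _; apply: kills_catr; apply: Hk.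
  move=> x; rewrite mem_filter /= => /andP[/negPf xe /sr]; by rewrite inE xe.
rewrite -(leq_add2r n); apply: leq_trans szs _.
by rewrite -(perm_size ss) size_cat addnC leq_add2l ltnW.
Qed.

Lemma good_subspace : linear_subspace good.
Proof.
split.
  by exists 1%N => w _ /=; rewrite lie0l; exact: (subspace0 (Fsub 1)).
move=> c x y gx gy.
have [z|k Hk] := @good_words [:: x; y].
  by rewrite !inE => /orP[/eqP ->|/eqP ->].
apply/goodP; exists k.
(* A power of the sum of two commuting nilpotents, expanded factor by factor: [s] is the part
   already expanded into letters. *)
suff H m s : {subset s <= [:: x; y]} -> (size s + m = k)%N ->
    kills (s ++ nseq m (c *: x + y)) by exact: (H k [::]).
elim: m s => [|m IH] s sub szs.
  by rewrite cats0; apply: Hk => //; rewrite -szs addn0.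
have sub' z : z \in [:: x; y] -> {subset rcons s z <= [:: x; y]}.
  by move=> zxy u; rewrite mem_rcons inE => /orP[/eqP ->|/sub].
have szs' z : (size (rcons s z) + m = k)%N by rewrite size_rcons addSnnS.
move=> w; rewrite size_cat size_nseq szs word_cat /= lieDl lieZl wordD wordZ => Fw.
have H z : z \in [:: x; y] -> F 1 (word s (lie z (word (nseq m (c *: x + y)) w))).
  move=> zxy; have := IH (rcons s z) (sub' z zxy) (szs' z) w.
  rewrite cat_rcons size_cat /= size_nseq szs word_cat; exact.
by apply: (Fsub 1).2; apply: H; rewrite !inE eqxx ?orbT.
Qed.

Lemma good_base : M `<=` good.
Proof. by move=> x Mx; exists 1%N => w /= Fw; exact: Mlie. Qed.

(** All words of length [k.+1] in a spanning list send F_(k+1) into [M]. Removing letters one by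
    one, each time through [canonical_filtration_span], climbs to F_(k+2), so the filtration stops
    at F_(k+1). *)
Lemma good_stable : (forall x, good x) ->
  exists k, forall x, F k.+1 x -> forall a, F k.+1 (lie a x).
Proof.
move=> allgood.
have [r _ Hr] := fin_codim_span sM (subspace_setT (L := L)) (@subsetT _ M) cM.
have [k Hk] := good_words (fun x (_ : x \in r) => allgood x).
exists k => x Fx; suff [] : F k.+2 x by [].
have in_mem e : List.In e r -> e \in r.
  elim: {Hr Hk} r => //= b r IH [->|/IH]; rewrite inE ?eqxx// => ->; exact: orbT.
have : forall s, {subset s <= r} -> size s = k.+1 -> F 1 (word s x).
  by move=> s sr szs; apply: (Hk s sr); rewrite szs.
elim: {Hk} k x Fx => [|k IH] x Fx Hx; apply: (canonical_filtration_span Hr) => // e er.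
  apply: (Hx [:: e]) => // z; rewrite inE => /eqP ->; exact: in_mem.
apply: IH; first exact: canonical_filtration_lie.
move=> s sr szs; have := Hx (rcons s e); rewrite size_rcons szs -cats1 word_cat.
apply=> // z; rewrite mem_cat inE => /orP[/sr//|/eqP ->]; exact: in_mem.
Qed.

Section GoodElements.
Context (h : L) (Mh : M h) (C : R[i]) (C0 : 0 <= C).
Context (HC : forall x, `|lie h x| <= C * `|x|).
Local Notation W j := (weight h (F j)).

Let Fh j x : F j x -> F j (lie h x).
Proof. exact: canonical_filtration_stable. Qed.

Context (s : seq R[i]) (Hs : forall x, F 1 (shift_prod h s x)) (N : nat)
  (HN : forall mu, mu \in s -> mu != 0 -> C *+ 2 < N%:R * `|mu|).

(** A weight outside [s] does not occur on [L / M], so its vectors lie in [M]; one in [s] acts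
    nilpotently, and [N < j] leaves the result at a positive level. *)
Lemma good_weight j mu : (N < j)%N -> mu != 0 -> W j mu `<=` good.
Proof.
move=> Nj mu0 x Wx; have [mus|mus] := boolP (mu \in s).
  exists N => w _.
  have Nj' := ltnW Nj.
  have := weight_vector_nilpotent Fsub canonical_filtration_decr
    canonical_filtration_lie canonical_filtration_closed
    canonical_filtration_codim Fh C0 HC w (HN mus mu0) Nj' Wx (leqnn N).
  by apply: Fle; rewrite subn_gt0.
apply: good_base; apply: (weight_not_in_seq (Fsub 1) (@Fh 1) mus (Hs x)).
by apply: weight_mono Wx; apply: Fle; exact: leq_ltn_trans Nj.
Qed.

Let texp_filtration T x j a : F (j + T)%N a -> F j (texp T x a).
Proof.
move=> Fa; rewrite /texp big_nat; apply: subspace_sum (Fsub j) _ => n /andP[_ nT].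
apply: subspaceZ => //.
apply: (filtration_iter (@canonical_filtration_lie)).
by apply: Fle Fa; rewrite leq_add2l ltnW.
Qed.

(* The conjugate of [y] by [exp (ad x)] is nilpotent like [y]; its expansion
   [y + [x, y] + ...] has nonzero weights, hence good terms, except for [[x, y]]. *)
Lemma good_opposite K mu x y : (3 * N < K)%N -> mu != 0 ->
  W K mu x -> W K (- mu) y -> good (lie x y).
Proof.
move=> NK mu0 Wx Wy.
have NK' : (N <= K)%N by lia.
have [mus|mus] := boolP ((mu \in s) || (- mu \in s)); last first.
  move: mus; rewrite negb_or => /andP[mus nmus]; apply: good_base.
  have K0 : (1 <= K)%N by lia.
  have W1 v z : W K v z -> W 1 v z by apply: weight_mono; exact: Fle.
  apply: Mlie; first exact: (weight_not_in_seq (Fsub 1) (@Fh 1) mus (Hs x) (W1 _ _ Wx)).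
  exact: (weight_not_in_seq (Fsub 1) (@Fh 1) nmus (Hs y) (W1 _ _ Wy)).
have {mus} HNmu : C *+ 2 < N%:R * `|mu|.
  case/orP: mus => [/HN/(_ mu0)//|/HN]; rewrite normrN; apply.
  by rewrite oppr_eq0.
have N0 : (0 < N)%N.
  rewrite lt0n; apply/eqP => N0; move: HNmu; rewrite N0 mul0r.
  by rewrite real_ltNge ?real0 ?ger0_real ?mulrn_wge0// mulrn_wge0.
have nil v z : W K v z -> `|v| = `|mu| -> forall n a, (N <= n)%N ->
    F (K - N) (iter n (lie z) a).
  move=> Wz vmu n a Nn.
  apply: (weight_vector_nilpotent Fsub canonical_filtration_decr
    canonical_filtration_lie canonical_filtration_closed
    canonical_filtration_codim Fh C0 HC a _ NK' Wz Nn).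
  by rewrite vmu.
have xG := nil _ _ Wx erefl; have yG := nil _ _ Wy (normrN mu).
have nxG n a : (N <= n)%N -> F (K - N) (iter n (lie (- x)) a).
  move=> Nn; rewrite -scaleN1r iter_lie_scale; apply: subspaceZ => //.
  exact: xG.
pose G := F (K - N); pose H := F (K - N - 1).
have GH u v : G u -> H (lie v u).
  by move=> Gu; apply: canonical_filtration_lie; rewrite -addn1 subnK//; lia.
pose phi := texp N.*2 x; pose y' := phi y.
have phi_lie a b : H (lie (phi a) (phi b) - phi (lie a b)).
  by apply: (texp_lie N0 xG) => [|u v]; [exact: Fsub|exact: GH].
have gy' : good y'.
  exists N => v _.
  have := texpK (Fsub _) N0 nxG v; rewrite opprK -/phi => Gv.
  set w := texp N.*2 (- x) v in Gv.
  (* [phi] carries [lie y] to [lie y'] up to an error, and each further bracket lets the error drop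
     by one level. *)
  have Hn n : (n <= N)%N ->
      F (K - N - n) (iter n (lie y') (phi w) - phi (iter n (lie y) w)).
    elim: n => [|n IH] nN; first by rewrite subrr; exact: (subspace0 (Fsub _)).
    rewrite !iterS -(subrK (lie y' (phi (iter n (lie y) w))) (lie y' _)) -addrA.
    apply: subspaceD (Fsub _) _ _.
      rewrite -lieBr; apply: canonical_filtration_lie.
      have -> : (K - N - n.+1).+1 = (K - N - n)%N by lia.
      by apply: IH; exact: ltnW.
    by apply: Fle (phi_lie _ _); lia.
  have vE : v = phi w - (phi w - v) by rewrite opprB addrC subrK.
  rewrite [v in iter _ _ v]vE.
  rewrite -scaleN1r iter_lieD iter_lieZ.
  apply: subspaceD (Fsub _) _ _; last first.
    apply: subspaceZ => //.
    apply: (Fle (_ : 1 <= K - N - N)%N); first by lia.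
    apply: (filtration_iter (@canonical_filtration_lie)).
    by rewrite subnK//; lia.
  rewrite -(subrK (phi (iter N (lie y) w)) (iter N (lie y') _)).
  apply: subspaceD (Fsub _) _ _.
    by apply: Fle (Hn N (leqnn N)); lia.
  (* The powers of [y] cost [N] levels and [phi] up to [N.*2] more; [3 * N < K] leaves level 1. *)
  apply: texp_filtration.
  by apply: Fle (yG N w (leqnn N)); lia.
have -> : lie x y = y' - y - \sum_(2 <= n < N.*2) (n`!%:R)^-1 *: iter n (lie x) y.
  rewrite /y' /phi /texp big_ltn ?double_gt0// big_ltn; last by lia.
  by rewrite !fact0 !invr1 !scale1r /= [y + _]addrC !addrK.
apply: subspaceB good_subspace _ _.
  apply: subspaceB good_subspace _ _ => //; apply: good_weight Wy; first by lia.
  by rewrite oppr_eq0.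
rewrite big_nat; apply: subspace_sum good_subspace _ => n /andP[n2 nN].
apply: subspaceZ good_subspace _.
have nK : (n <= K)%N by lia.
(* The term has weight (n - 1) mu, and fewer than [N.*2] levels are lost, so more than [N]
   remain. *)
apply: (@good_weight (K - n) (- mu + mu *+ n)); first by lia.
  case: n n2 {nN nK} => [//|[//|n]] _.
  by rewrite mulrS addKr -mulr_natr mulf_neq0// pnatr_eq0.
apply: (weight_iter_lie Fsub canonical_filtration_decr canonical_filtration_lie Fh);
  by rewrite subnK.
Qed.

End GoodElements.

Lemma weight_bound (C : R[i]) (s : seq R[i]) : 0 <= C ->
  exists N, forall mu, mu \in s -> mu != 0 -> C *+ 2 < N%:R * `|mu|.
Proof.
move=> C0; elim: s => [|mu s [N HN]]; first by exists 0%N.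
have [->|mu0] := eqVneq mu 0.
  by exists N => nu; rewrite inE => /orP[/eqP ->|/HN//]; rewrite eqxx.
have mu_gt0 : 0 < `|mu| by rewrite normr_gt0.
have [N' HN'] := complex_archimedean (mulrn_wge0 2 C0) mu_gt0.
have le_mul n m (nu : R[i]) : (n <= m)%N -> n%:R * `|nu| <= m%:R * `|nu|.
  by move=> nm; rewrite ler_wpM2r// ler_nat.
exists (N + N')%N => nu; rewrite inE => /orP[/eqP -> _|nus nu0].
  exact: lt_le_trans HN' (le_mul _ _ _ (leq_addl _ _)).
exact: lt_le_trans (HN nu nus nu0) (le_mul _ _ _ (leq_addr _ _)).
Qed.

End CanonicalFiltration.

Lemma maximal_subalgebra_contains_ideal (R : realType) (L : banachLieType R)
    (M : set L) : frakS_max M -> exists2 J, frakJ J & J `<=` M.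
Proof.
move=> [[[sM Mlie] clM /(finite_codimP sM) cM nM] Mmax].
have maxT U : linear_subspace U -> (forall a b, U a -> U b -> U (lie a b)) ->
    M `<=` U -> ~ (U `<=` M) -> U = setT.
  move=> sU Ulie MU nUM; apply: contrapT => nU; apply: nUM.
  have cU : fin_codim [set: L] U by exact: fin_codim_mono MU cM.
  rewrite (Mmax U)//; split=> //; last exact/finite_codimP.
  exact: closed_finite_extension MU.
have [nil|] := pselect (forall a, M a -> forall e, exists p, M (iter p (lie a) e)).
  have [|x [nMx Mx]] := engel sM sM Mlie Mlie cM nil.
    apply: contrapT => H; apply: nM; apply/seteqP; split=> // x _.
    by apply: contrapT => nMx; apply: H; exists x.
  (* The vector from Engel's theorem normalises [M], so [adjoin M x] is a subalgebra in which [M] is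
     an ideal. *)
  have UT : adjoin M x = setT.
    apply: maxT.
    - exact: adjoin_subspace.
    - move=> _ _ /(adjoinP sM)[a [c [Ma ->]]] /(adjoinP sM)[b [d [Mb ->]]].
      apply: adjoin_sub; rewrite lieDl !lieDr !lieZl !lieZr lie_alternating.
      rewrite !scaler0 addr0; apply: subspaceD => //.
        by apply: subspaceD => //; [exact: Mlie|apply: subspaceZ => //; exact: Mx].
      by apply: subspaceZ => //; rewrite lieC; apply: subspaceN => //; exact: Mx.
    - exact: adjoin_sub.
    - by move=> /(_ x (adjoin_id x sM)).
  exists M => //; split=> //; last exact/finite_codimP.
  split=> // a b Mb; have : adjoin M x a by rewrite UT.
  move=> /(adjoinP sM)[c [k [Mc ->]]]; rewrite lieDl lieZl; apply: subspaceD => //.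
    exact: Mlie.
  by apply: subspaceZ => //; rewrite lieC; apply: subspaceN => //; exact: Mx.
move=> /existsNP [h /not_implyP [Mh /existsNP [e he]]].
pose F := canonical_filtration M.
have Fsub := canonical_filtration_subspace sM.
have Fdecr := @canonical_filtration_decr _ _ M.
have Flie := @canonical_filtration_lie _ _ M.
have Fcl := canonical_filtration_closed clM.
have Fcodim := canonical_filtration_codim sM Mlie cM.
have Fh j x : F j x -> F j (lie h x) by exact: canonical_filtration_stable.
have [C C0 HC] := lie_bound h.
have [s Hs] := uniform_annihilating_seq (Fsub 1) (@Fh 1) (Fcodim 1).
have [N HN] := weight_bound s C0.
(* [good_opposite] asks for [3 * N < K], the weight span for [3 <= K]. *)
pose K := (3 * N + 3)%N.
have K3 : (3 <= K)%N by rewrite /K; lia.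
pose Q := weight_span F h K.
(* If every vector of nonzero weight were in [M], then [e] would have weight 0 modulo [M], against
   its choice. *)
have [mu [mu0 [x Wx nMx]]] : exists mu, mu != 0 /\ exists2 x, weight h (F K) mu x & ~ M x.
  apply: contrapT => nmu.
  have : weight h (F 1) 0 e.
    apply: (weight_decomposition (Fsub K) (@Fh K) (Fcodim K) (subspace_setT (L := L))
      _ (weight_subspace (Fsub 1) (@Fh 1) 0) _ I) => // mu x [Wx _].
    have [mu0|mu0] := eqVneq mu 0.
      rewrite mu0 in Wx; apply: weight_mono Wx.
      by apply: (filtration_le Fdecr); exact: leq_trans K3.
    apply: sub_weight; apply: contrapT => nMx; apply: nmu; exists mu; split=> //.
    by exists x.
  move=> [p Hp]; apply: he; exists p.
  have E n z : iter n (ad_shift h 0) z = iter n (lie h) z.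
    by elim: n => //= n ->; rewrite /ad_shift scale0r subr0.
  by move: Hp; rewrite E.
have QT : Q = setT.
  apply: maxT.
  - exact: weight_span_subspace.
  - by apply: weight_span_subalgebra => //; exact: Mlie.
  - exact: weight_span_filtration.
  - by move=> QM; apply/nMx/QM => U sU FU WU BU; exact: (WU mu).
have allgood z : good M z.
  have : Q z by rewrite QT.
  apply; first exact: good_subspace.
  - exact: good_base.
  - move=> nu nu0; apply: (good_weight sM Mlie clM cM Mh C0 HC Hs HN) => //.
    by rewrite /K; lia.
  - move=> nu u v nu0 Wu Wv.
    apply: (good_opposite sM Mlie clM cM Mh C0 HC Hs HN _ nu0 Wu Wv).
    by rewrite /K; lia.
have [k Hk] := good_stable sM Mlie cM allgood.
exists (F k.+1); last exact: (filtration_le Fdecr (isT : 1 <= k.+1)%N).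
split.
- by split; [exact: Fsub|move=> a b Fb; exact: Hk].
- exact: Fcl.
- exact/finite_codimP.
- move=> FT; apply: nM; apply/seteqP; split=> // z _.
  have : F k.+1 z by rewrite FT.
  exact: (filtration_le Fdecr (isT : 1 <= k.+1)%N).
Qed.

(** * Subalgebras above a maximal ideal *)

Section MaximalMembers.
Context {R : realType} {L : banachLieType R}.

Lemma maximal_member_above (A : set (set L)) M :
  (forall N, A N -> [/\ linear_subspace N, fin_codim [set: L] N & N <> setT]) ->
  A M -> exists2 N, maximal_members A N & M `<=` N.
Proof.
move=> HA AM; have [_ [n Hn] _] := HA M AM.
elim: n M AM Hn => [|n IH] M AM Hn.
  by have [_ _ []] := HA M AM; apply/seteqP; split.
have [mM|] := pselect (forall N, A N -> M `<=` N -> N = M); first by exists M.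
move=> /existsNP [N /not_implyP [AN /not_implyP [MN nNM]]].
have [x Nx nMx] : exists2 x, N x & ~ M x.
  apply: contrapT => H; apply: nNM; apply/seteqP; split=> // x Nx.
  by apply: contrapT => nMx; apply: H; exists x.
have [sM _ _] := HA M AM; have [sN _ _] := HA N AN.
have Hn' : codim_le [set: L] n N.
  by apply: codim_le_mono (codim_le_exchange sM Hn I nMx); exact: adjoin_min.
have [K mK NK] := IH N AN Hn'.
by exists K => //; exact: subset_trans NK.
Qed.

Lemma frakS_max_above (M : set L) : frakS M -> exists2 N, frakS_max N & M `<=` N.
Proof.
apply: maximal_member_above => N [[sN _] _ cN nN]; split=> //.
exact/finite_codimP.
Qed.

Lemma frakJ_max_above (J : set L) : frakJ J -> exists2 N, frakJ_max N & J `<=` N.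
Proof.
apply: maximal_member_above => N [[sN _] _ cN nN]; split=> //.
exact/finite_codimP.
Qed.

Lemma frakJ_frakS (J : set L) : frakJ J -> frakS J.
Proof. by move=> [iJ clJ cJ nJ]; split=> //; exact: lie_ideal_subalgebra. Qed.

(** Subtracting [2 ^+ T] times the value at [t] from the value at [2 * t] removes the top term and
    scales the others by nonzero factors. *)
Lemma polynomial_coefficients (U : set L) (v : nat -> L) T : linear_subspace U ->
  (forall t : R[i], U (\sum_(n < T) t ^+ n *: v n)) ->
  forall n, (n < T)%N -> U (v n).
Proof.
move=> sU; elim: T v => [//|T IH] v Hv.
have low n : (n < T)%N -> U (v n).
  move=> nT; apply: (@subspaceZV _ _ U (2 ^+ n - 2 ^+ T) (v n)) => //.
    by rewrite subr_eq0 -!natrX eqr_nat eqn_exp2l// ltn_eqF.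
  apply: (IH (fun n => (2 ^+ n - 2 ^+ T) *: v n)) => // t.
  have := subspaceB sU (Hv (2 * t)) (subspaceZ (2 ^+ T) sU (Hv t)).
  rewrite !big_ord_recr /= scalerDr scaler_sumr opprD addrACA.
  rewrite scalerA exprMn subrr addr0 -sumrB; congr U; apply: eq_bigr => i _.
  by rewrite !scalerA -scalerBl exprMn -mulrBl mulrC.
move=> n; rewrite ltnS leq_eqVlt => /orP[/eqP ->|/low//].
have := Hv 1; rewrite big_ord_recr /= expr1n scale1r.
apply: (subspaceDl sU); apply: subspace_sum => // i _.
by rewrite expr1n scale1r; exact: low.
Qed.

End MaximalMembers.

(** * Exponential automorphisms modulo an ideal and the maximal subalgebras above it *)

Section MaximalIdeal.
Context {R : realType} {L : banachLieType R} (J : set L).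
Context (sJ : linear_subspace J) (Jlie : forall a b, J b -> J (lie a b)).
Context (clJ : closed J) (cJ : fin_codim [set: L] J).

Section NilpotentAutomorphism.
Context (N : nat) (N0 : (0 < N)%N).

Definition nilpotent_mod z := forall n a, (N <= n)%N -> J (iter n (lie z) a).

Lemma nilpotent_modZ t z : nilpotent_mod z -> nilpotent_mod (t *: z).
Proof.
by move=> Hz n a Nn; rewrite iter_lie_scale; apply: subspaceZ => //; exact: Hz.
Qed.

Lemma nilpotent_modN z : nilpotent_mod z -> nilpotent_mod (- z).
Proof. by rewrite -scaleN1r; exact: nilpotent_modZ. Qed.

Local Notation phi z := (texp N.*2 z).

Lemma texp_ideal z a : J a -> J (phi z a).
Proof.
move=> Ja; apply: subspace_sum => // n _; apply: subspaceZ => //.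
by elim: n => //= n; exact: Jlie.
Qed.

Lemma texpKmod z (U : set L) a : linear_subspace U -> J `<=` U ->
  nilpotent_mod z -> U (phi (- z) (phi z a)) <-> U a.
Proof.
move=> sU JU Hz; have := JU _ (texpK sJ N0 Hz a).
set b := phi _ _ => Uba; split=> H.
  by rewrite -(subKr b a); apply: subspaceB.
by rewrite -(subrK a b); apply: subspaceD.
Qed.

Lemma texpNKmod z (U : set L) a : linear_subspace U -> J `<=` U ->
  nilpotent_mod z -> U (phi z (phi (- z) a)) <-> U a.
Proof.
by move=> sU JU /nilpotent_modN Hz; have := texpKmod a sU JU Hz; rewrite opprK.
Qed.

(** Modulo [J] the truncated exponential is an automorphism with inverse [phi (- z)], so it permutes
    the subalgebras above [J]. *)
Lemma frakS_texp z U : nilpotent_mod z -> frakS U -> J `<=` U ->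
  frakS (phi z @^-1` U) /\ J `<=` phi z @^-1` U.
Proof.
move=> Hz [[sU Ulie] clU cU nU] JU.
have JU' : J `<=` phi z @^-1` U by move=> a Ja; apply: JU; exact: texp_ideal.
have sU' : linear_subspace (phi z @^-1` U).
  split=> [|k a b Ua Ub] /=; first exact: (JU' _ (subspace0 sJ)).
  by rewrite texpD texpZ; exact: sU.2.
split=> //; split.
- split=> // a b Ua Ub /=.
  rewrite -(subKr (lie (phi z a) (phi z b)) (phi z (lie a b))).
  apply: subspaceB => //; first exact: Ulie.
  by apply: JU; apply: (@texp_lie _ _ J z N N0 Hz) => // u v; exact: Jlie.
- exact: closed_finite_extension JU'.
- by apply/finite_codimP => //; exact: fin_codim_mono JU' cJ.
- move=> UT; apply: nU; apply/seteqP; split=> // a _.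
  apply/(texpNKmod a sU JU Hz).
  have : (phi z @^-1` U) (phi (- z) a) by rewrite UT.
  exact.
Qed.

Lemma frakS_max_texp z U : nilpotent_mod z -> frakS_max U -> J `<=` U ->
  frakS_max (phi z @^-1` U) /\ J `<=` phi z @^-1` U.
Proof.
move=> Hz [SU mU] JU; have [SU' JU'] := frakS_texp Hz SU JU.
have [[sU _] _ _ _] := SU.
split=> //; split=> // V SV U'V.
have JV : J `<=` V by exact: subset_trans U'V.
have [[sV _] _ _ _] := SV.
have [SV' JV'] := frakS_texp (nilpotent_modN Hz) SV JV.
have VU : phi (- z) @^-1` V = U.
  by apply: mU => // u Uu; apply: U'V; apply/(texpNKmod _ sU JU Hz).
apply/seteqP; split=> // v Vv /=; rewrite -VU /=.
exact/(texpKmod _ sV JV Hz).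
Qed.

End NilpotentAutomorphism.

(** The preimage of the Frattini subalgebra of [L / J]. *)
Definition max_above := [set x | forall M, frakS_max M -> J `<=` M -> M x].

Lemma max_above_subspace : linear_subspace max_above.
Proof.
split=> [M [[[sM _] _ _ _] _] _|k x y Hx Hy M mM JM]; first exact: subspace0.
have [[[sM _] _ _ _] _] := mM.
by apply: sM.2; [exact: Hx|exact: Hy].
Qed.

Lemma sub_max_above : J `<=` max_above.
Proof. by move=> x Jx M _; exact. Qed.

(** [max_above] is invariant under the exponential of every [t *: z], and [lie z p] is the
    coefficient of [t] in the image of [p]. *)
Lemma nilpotent_normalizes N z : (0 < N)%N -> nilpotent_mod N z ->
  forall p, max_above p -> max_above (lie z p).
Proof.
move=> N0 Hz p Hp.
have N2 : (1 < N.*2)%N by lia.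
have H t : max_above (\sum_(n < N.*2) t ^+ n *: ((n`!%:R)^-1 *: iter n (lie z) p)).
  have -> : \sum_(n < N.*2) t ^+ n *: ((n`!%:R)^-1 *: iter n (lie z) p) =
      texp N.*2 (t *: z) p.
    rewrite /texp big_mkord; apply: eq_bigr => n _.
    by rewrite iter_lie_scale !scalerA mulrC.
  move=> M mM JM.
  have [mM' JM'] := frakS_max_texp N0 (nilpotent_modZ t Hz) mM JM.
  exact: (Hp _ mM' JM').
have := polynomial_coefficients (v := fun n => (n`!%:R)^-1 *: iter n (lie z) p)
  max_above_subspace H N2.
by rewrite (_ : 1`! = 1)%N// invr1 scale1r.
Qed.

(** When some [lie h] is not nilpotent modulo [J], weight vectors of nonzero weight generate [L]
    over [J] and normalise [max_above]; this is then a proper ideal above [J], hence [J]. In the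
    nilpotent case [L / J] is an abelian line and [J] is itself a maximal subalgebra. *)
Lemma max_above_maximal_ideal : J <> setT ->
  (forall I, frakJ I -> J `<=` I -> I = J) -> max_above `<=` J.
Proof.
move=> nJ Jmax.
have Jfrak : frakJ J by split=> //; exact/finite_codimP.
have maxT U : linear_subspace U -> (forall a b, U b -> U (lie a b)) ->
    J `<=` U -> ~ (U `<=` J) -> U = setT.
  move=> sU Ulie JU nUJ; apply: contrapT => nU; apply: nUJ.
  have cU : fin_codim [set: L] U by exact: fin_codim_mono JU cJ.
  rewrite (Jmax U)//; split=> //; last exact/finite_codimP.
  exact: closed_finite_extension JU.
have JT a x : J x -> setT a -> J (lie x a).
  by move=> Jx _; rewrite lieC; apply: subspaceN => //; exact: Jlie.
have [nil|] := pselect (forall a, [set: L] a -> forall e, exists p, J (iter p (lie a) e)).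
  have [|x [nJx Jx]] := engel (subspace_setT (L := L)) sJ (fun _ _ _ _ => I)
      (fun a b _ => @Jlie a b) cJ nil.
    apply: contrapT => H; apply: nJ; apply/seteqP; split=> // x _.
    by apply: contrapT => nJx; apply: H; exists x.
  have UT : adjoin J x = setT.
    apply: maxT.
    - exact: adjoin_subspace.
    - move=> a _ /(adjoinP sJ)[b [d [Jb ->]]].
      apply: adjoin_sub; rewrite lieDr lieZr; apply: subspaceD => //; first exact: Jlie.
      by apply: subspaceZ => //; exact: Jx.
    - exact: adjoin_sub.
    - by move=> /(_ x (adjoin_id x sJ)).
  have LJ a b : J (lie a b).
    have : adjoin J x b by rewrite UT.
    move=> /(adjoinP sJ)[c [k [Jc ->]]]; rewrite lieDr lieZr; apply: subspaceD => //.
      exact: Jlie.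
    by apply: subspaceZ => //; exact: Jx.
  move=> y /(_ J); apply=> //; split; first exact: frakJ_frakS.
  move=> N [[sN _] clN cN nN] JN; apply: Jmax => //; split=> //.
  by split=> // a b _; apply/JN/LJ.
move=> /existsNP [h /not_implyP [_ /existsNP [e he]]].
(* For an ideal the filtration is constant from level 1 on, so any level from 3 on, here 3 itself,
   serves for the weight span. *)
pose F j : set L := if j is _.+1 then J else setT.
have Fsub j : linear_subspace (F j) by case: j => [|j] //; exact: subspace_setT.
have Fdecr j : F j.+1 `<=` F j by case: j => [|j] x.
have Flie j a x : F j.+1 x -> F j (lie a x) by case: j => [|j] //= Jx; exact: Jlie.
have Fcl j : closed (F j) by case: j => [|j] //; exact: closedT.
have Fcodim j : fin_codim [set: L] (F j) by case: j => [|j] //; exact: fin_codim_refl.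
have Fh j x : F j x -> F j (lie h x) by case: j => [|j] //= Jx; exact: Jlie.
have [C C0 HC] := lie_bound h.
pose Q := weight_span F h 3.
have [mu [mu0 [x Wx nJx]]] : exists mu, mu != 0 /\ exists2 x, weight h J mu x & ~ J x.
  apply: contrapT => nmu.
  have : weight h J 0 e.
    apply: (weight_decomposition sJ (@Fh 1) cJ (subspace_setT (L := L))
      _ (weight_subspace sJ (@Fh 1) 0) _ I) => // mu x [Wx _].
    have [mu0|mu0] := eqVneq mu 0; first by rewrite mu0 in Wx.
    apply: sub_weight; apply: contrapT => nJx; apply: nmu; exists mu; split=> //.
    by exists x.
  move=> [p Hp]; apply: he; exists p.
  have E n z : iter n (ad_shift h 0) z = iter n (lie h) z.
    by elim: n => //= n ->; rewrite /ad_shift scale0r subr0.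
  by move: Hp; rewrite E.
have QT : Q = setT.
  apply: maxT.
  - exact: weight_span_subspace.
  - by apply: (weight_span_ideal Fsub Fdecr Flie Fcodim Fh).
  - exact: weight_span_filtration.
  - by move=> QJ; apply/nJx/QJ => U sU FU WU BU; exact: (WU mu).
have sPhi := max_above_subspace.
have Wnorm nu z : nu != 0 -> weight h J nu z ->
    forall b, max_above b -> max_above (lie z b).
  move=> nu0 Wz.
  have nu_gt0 : 0 < `|nu| by rewrite normr_gt0.
  have [N HN] := complex_archimedean (mulrn_wge0 2 C0) nu_gt0.
  have N0 : (0 < N)%N.
    rewrite lt0n; apply/eqP => N0; move: HN; rewrite N0 mul0r.
    by rewrite real_ltNge ?real0 ?ger0_real ?mulrn_wge0// mulrn_wge0.
  apply: (nilpotent_normalizes N0) => n b Nn.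
  have := weight_vector_nilpotent Fsub Fdecr Flie Fcl Fcodim Fh C0 HC b HN
    (leqnSn N) Wz Nn.
  by rewrite subSnn.
have Philie a b : max_above b -> max_above (lie a b).
  move: b; have : Q a by rewrite QT.
  move=> /(_ [set a | forall b, max_above b -> max_above (lie a b)]); apply.
  - split=> [b _|k u v Hu Hv b Hb]; first by rewrite lie0l; exact: (subspace0 sPhi).
    by rewrite lieDl lieZl; apply: sPhi.2; [exact: Hu|exact: Hv].
  - by move=> u Ju b _; apply: sub_max_above; exact: JT.
  - by move=> nu nu0 z Wz; exact: Wnorm Wz.
  - move=> nu u v nu0 Wu Wv b Hb; rewrite lieA.
    have nnu0 : - nu != 0 by rewrite oppr_eq0.
    by apply: (subspaceB sPhi); [apply: (Wnorm nu) => //; exact: (Wnorm (- nu))|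
      apply: (Wnorm (- nu)) => //; exact: (Wnorm nu)].
have [M mM JM] := frakS_max_above (frakJ_frakS Jfrak).
apply: contrapT => /maxT H.
have PhiT := H sPhi Philie sub_max_above.
have [[_ _ _ nM] _] := mM; apply: nM; apply/seteqP; split=> // x' _.
have : max_above x' by rewrite PhiT.
by apply.
Qed.

End MaximalIdeal.

(** * Comparison of the preradicals *)

Section Restriction.
Context {R : realType} {L : banachLieType R} (M : closedSubalgebra L).
Local Notation S := (sub_banachLie M).

Definition restriction (N : set L) : set S := [set s | N (sub_val s)].

Lemma restriction_subspace N : linear_subspace N -> linear_subspace (restriction N).
Proof.
move=> [N0 NL]; split; first exact: N0.
by move=> k x y Nx Ny; exact: NL.
Qed.

Lemma restriction_closed N : closed N -> closed (restriction N).
Proof.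
move=> clN; apply/closed_ballP => y Hy; apply: (closed_ballP N).1 clN _ _ => e e0.
have [z Nz yz] := Hy e e0; exists (sub_val z) => //.
Qed.

Lemma restriction_codim N : linear_subspace N -> fin_codim [set: L] N ->
  fin_codim [set: S] (restriction N).
Proof.
move=> sN cN; have sM := (closedSubalgebraP M).1.1.
have [n] := fin_codim_restrict sN sM cN.
have : (M : set L) `&` N `<=` N by move=> x [].
move: (_ `&` _) => T TN; elim: n T N {sN cN} TN => [|n IH] T N TN /=.
  by move=> MT; exists 0%N => s _; apply/TN/MT/sub_predP; exact: sub_valP.
move=> [x Mx Hx]; have [m Hm] := IH _ _ (adjoin_mono (x := x) TN) Hx.
exists m.+1, (SubBanachLie (introT (sub_predP M x) Mx)) => //.
Qed.

(** The trace of [N] on [M] is a closed subalgebra of finite codimension in [M], and [M] has no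
    proper one. *)
Lemma radical_subalgebra (N : set L) :
  (P_S S : set S) = setT -> frakS N -> (M : set L) `<=` N.
Proof.
move=> PT [[sN Nlie] clN cN nN].
have [NT|NT] := pselect (restriction N = setT).
  move=> x Mx; have : restriction N (SubBanachLie (introT (sub_predP M x) Mx)).
    by rewrite NT.
  exact.
have NS : frakS (restriction N).
  split=> //.
  - split; first exact: restriction_subspace.
    by move=> a b Na Nb; exact: Nlie.
  - exact: restriction_closed.
  - apply/finite_codimP; first exact: restriction_subspace.
    by apply: restriction_codim => //; exact/finite_codimP.
case: NT; apply/seteqP; split=> // s _.
have : (P_S S : set S) s by rewrite PT.
exact.
Qed.

End Restriction.

Section Radicals.
Context {R : realType}.
Implicit Types (L : banachLieType R).

Lemma apply_sub_fixed L (M : closedSubalgebra L) : apply_sub (@P_S R) M = M ->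
  (P_S (sub_banachLie M) : set _) = setT.
Proof.
move=> PM; apply/seteqP; split=> // s _.
have Ms : (M : set L) (sub_val s) by apply/sub_predP; exact: sub_valP.
move: Ms; rewrite -{1}PM => -[t Pt ts].
by have -> : s = t by exact: val_inj.
Qed.

Lemma family_intersection_setT L (A : set (set L))
    (AP : forall M, A M -> closed_subalgebra M) :
  (forall M, A M -> M <> setT) ->
  (family_intersection AP : set L) = setT <-> forall M, ~ A M.
Proof.
move=> AT; split=> [IT M AM|nA].
  apply: (AT M AM); apply/seteqP; split=> // x _.
  have : (family_intersection AP : set L) x by rewrite IT.
  exact.
by apply/seteqP; split=> // x _ M /nA.
Qed.

Lemma Rad_P_S L : Rad (@P_S R) L <-> forall M : set L, ~ frakS M.
Proof. by apply: family_intersection_setT => M []. Qed.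

Lemma Rad_P_S_max L : Rad (@P_S_max R) L <-> forall M : set L, ~ frakS_max M.
Proof. by apply: family_intersection_setT => M [[]]. Qed.

Lemma Rad_P_J L : Rad (@P_J R) L <-> forall M : set L, ~ frakJ M.
Proof. by apply: family_intersection_setT => M []. Qed.

Lemma Rad_P_J_max L : Rad (@P_J_max R) L <-> forall M : set L, ~ frakJ_max M.
Proof. by apply: family_intersection_setT => M [[]]. Qed.

Lemma Rad_P_S_frattini L : Rad (@frattini R) L <-> Rad (@P_S R) L.
Proof.
have [_ fixed] := iterated_valueP (@P_S R) L.
split=> [RF|RS].
  apply/Rad_P_S => M SM; have [_ _ _ nM] := SM; apply: nM.
  apply/seteqP; split=> // x _.
  apply: (radical_subalgebra (apply_sub_fixed fixed) SM).
  have : (frattini L : set L) x by rewrite RF.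
  exact.
pose T : closedSubalgebra L := ClosedSubalgebra (@closed_subalgebra_setT R L).
suff : stable_value (@P_S R) T.
  by move=> /(stable_value_unique (iterated_valueP (@P_S R) L)) E;
    rewrite /Rad /frattini /iterated E.
split.
  (* [L] is stage zero of the transfinite chain, realised over a one-point order. *)
  exists unit, (fun _ _ => true), (fun=> T), tt; split=> //.
    move=> A [[] At]; exists tt; split; first by split.
    by move=> [].
  by move=> []; split=> // [[[]]]; rewrite eqxx.
apply: closedSubalgebra_eq; first exact: apply_sub_subset.
move=> x _; exists (SubBanachLie (introT (sub_predP T x) I)) => //.
(* A proper member for the copy of [L] inside itself is carried back to one for [L], which has
   none. *)
move=> N [Nsub clN [n [e He]] nN].
pose N' := ClosedSubalgebra (conj Nsub clN : closed_subalgebra N).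
have [N'sub clN'] := closed_subalgebra_sub_val N'.
exfalso; apply: ((Rad_P_S L).1 RS (sub_val @` N)); split=> //.
  exists n, (fun i => sub_val (e i)) => y.
  have [c Hc] := He (SubBanachLie (introT (sub_predP T y) I)).
  exists c; exists (SubBanachLie (introT (sub_predP T y) I) - \sum_i c i *: e i) => //.
  rewrite [LHS](raddfB val) raddf_sum; congr (_ - _).
move=> NT; apply: nN; apply/seteqP; split=> // s _.
have : (sub_val @` N) (sub_val s) by rewrite NT.
by move=> [t Nt ts]; have -> : s = t by exact: val_inj.
Qed.

Lemma Rad_P_S_P_S_max L : Rad (@P_S R) L <-> Rad (@P_S_max R) L.
Proof.
rewrite Rad_P_S Rad_P_S_max; split=> H M; first by move=> [/H].
by move=> /frakS_max_above [N /H].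
Qed.

Lemma Rad_P_S_max_P_J L : Rad (@P_S_max R) L <-> Rad (@P_J R) L.
Proof.
rewrite Rad_P_S_max Rad_P_J; split=> H M.
  by move=> /frakJ_frakS /frakS_max_above [N /H].
by move=> /maximal_subalgebra_contains_ideal [N /H].
Qed.

Lemma Rad_P_J_P_J_max L : Rad (@P_J R) L <-> Rad (@P_J_max R) L.
Proof.
rewrite Rad_P_J Rad_P_J_max; split=> H M; first by move=> [/H].
by move=> /frakJ_max_above [N /H].
Qed.

Lemma Sem_mono (P P' : preradical R) L :
  (P' L : set L) `<=` P L -> Sem P L -> Sem P' L.
Proof.
move=> P'P P0; apply/seteqP; split; first by rewrite -P0.
by move=> _ ->; exact: (closedSubalgebraP (P' L)).1.1.1.
Qed.

Lemma P_S_max_sub_P_J_max L : (P_S_max L : set L) `<=` P_J_max L.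
Proof.
move=> x Hx J [[[sJ Jlie] clJ cJ nJ] Jmax].
apply: (max_above_maximal_ideal sJ Jlie clJ _ nJ Jmax).
  exact/finite_codimP.
by move=> M mM _; exact: Hx.
Qed.

Lemma P_J_sub_P_S_max L : (P_J L : set L) `<=` P_S_max L.
Proof.
move=> x Hx M /maximal_subalgebra_contains_ideal [J JJ JM].
by apply: JM; exact: Hx.
Qed.

Lemma P_S_sub_P_J L : (P_S L : set L) `<=` P_J L.
Proof. by move=> x Hx J /frakJ_frakS; exact: Hx. Qed.

Lemma frattini_sub_P_S L : (frattini L : set L) `<=` P_S L.
Proof.
have [_ fixed] := iterated_valueP (@P_S R) L.
move=> x Fx N SN; exact: (radical_subalgebra (apply_sub_fixed fixed) SN).
Qed.

End Radicals.

(** * Bounded functions with a Lie bracket *)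

Section BoundedFunctions.
Context {R : realType} {I : Type}.
Implicit Types (c e : R[i]).

Definition bounded_pred : {pred I -> R[i]} :=
  fun f => `[< exists c : R[i], forall i, `|f i| <= c >].

Lemma bounded_predP f : reflect (exists c : R[i], forall i, `|f i| <= c)
  (f \in bounded_pred).
Proof. exact: asboolP. Qed.

Fact bounded_pred_submod_closed : submod_closed bounded_pred.
Proof.
split=> [|k f g /bounded_predP [a Ha] /bounded_predP [b Hb]]; apply/bounded_predP.
  by exists 0 => i; rewrite normr0.
exists (`|k| * a + b) => i; apply: le_trans (ler_normD _ _) _.
by rewrite lerD// normrM ler_wpM2l.
Qed.

HB.instance Definition _ :=
  GRing.isSubmodClosed.Build R[i] (I -> R[i]) bounded_pred bounded_pred_submod_closed.

End BoundedFunctions.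

(** All four examples live on such sup-normed spaces; a finite [I] gives the finite-dimensional
    ones. *)
Record bounded_fun (R : realType) (I : Type) := BoundedFun {
  bounded_val : I -> R[i];
  bounded_valP : bounded_val \in bounded_pred }.

Section BoundedFunctionSpace.
Context {R : realType} {I : Type}.
Local Notation V := (bounded_fun R I).
Implicit Types (c e : R[i]).

HB.instance Definition _ := [isSub of V for @bounded_val R I].
HB.instance Definition _ := [Choice of V by <:].
HB.instance Definition _ := [SubChoice_isSubLmodule of V by <:].

Definition coord (i : I) (f : V) : R[i] := val f i.

Lemma coord_is_linear i : linear_for *%R (coord i).
Proof. by []. Qed.

HB.instance Definition _ i :=
  GRing.isLinear.Build R[i] V R[i] *%R (coord i) (coord_is_linear i).

Lemma coordD i f g : coord i (f + g) = coord i f + coord i g. Proof. by []. Qed.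
Lemma coordZ i k f : coord i (k *: f) = k * coord i f. Proof. by []. Qed.
Lemma coord0 i : coord i 0 = 0. Proof. by []. Qed.
Lemma coordB i f g : coord i (f - g) = coord i f - coord i g. Proof. by []. Qed.

Lemma coord_inj f g : (forall i, coord i f = coord i g) -> f = g.
Proof. by move=> fg; apply: val_inj; apply/funext. Qed.

Definition bounded_of (f : I -> R[i]) (c : R[i]) (fc : forall i, `|f i| <= c) : V :=
  BoundedFun (introT (bounded_predP f) (ex_intro _ c fc)).

(** The value 0 keeps the set inhabited when [I] is empty. *)
Definition sup_norm_set (f : V) : set R :=
  [set r | r = 0 \/ exists i, r = complex.Re `|coord i f|].

Definition sup_norm (f : V) : R[i] := (sup (sup_norm_set f))%:C%C.

Lemma complex_normE (z : R[i]) : `|z| = (complex.Re `|z|)%:C%C.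
Proof. by rewrite RRe_real// normr_real. Qed.

Lemma sup_norm_has_sup f : has_sup (sup_norm_set f).
Proof.
split; first by exists 0; left.
have /bounded_predP [c Hc] := valP f.
exists (complex.Re `|c|) => r [->|[i ->]].
  by rewrite -lecR -complex_normE; exact: normr_ge0.
rewrite -lecR -!complex_normE; apply: le_trans (Hc i) _.
by rewrite real_ler_norm// ger0_real// (le_trans _ (Hc i)).
Qed.

Lemma coord_le_norm i f : `|coord i f| <= sup_norm f.
Proof.
rewrite complex_normE lecR; apply: (sup_upper_bound (sup_norm_has_sup f)).
by right; exists i.
Qed.

Lemma sup_norm_ge0 f : 0 <= sup_norm f.
Proof. by rewrite lecR; apply: (sup_upper_bound (sup_norm_has_sup f)); left. Qed.

Lemma sup_norm_le c f : 0 <= c -> (forall i, `|coord i f| <= c) -> sup_norm f <= c.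
Proof.
move=> /complex_ge0P [r r0 ->] Hr; rewrite lecR; apply: ge_sup; first by exists 0; left.
by move=> _ [->//|[i ->]]; rewrite -lecR -complex_normE.
Qed.

Fact sup_ler_normD f g : sup_norm (f + g) <= sup_norm f + sup_norm g.
Proof.
apply: sup_norm_le => [|i]; first by rewrite addr_ge0 ?sup_norm_ge0.
by apply: le_trans (ler_normD _ _) _; rewrite lerD ?coord_le_norm.
Qed.

Fact sup_normrZ k f : sup_norm (k *: f) = `|k| * sup_norm f.
Proof.
have le k' g : sup_norm (k' *: g) <= `|k'| * sup_norm g.
  apply: sup_norm_le => [|i]; first by rewrite mulr_ge0 ?sup_norm_ge0.
  by rewrite coordZ normrM ler_wpM2l// coord_le_norm.
apply/eqP; rewrite eq_le le /=; have [->|k0] := eqVneq k 0.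
  by rewrite normr0 mul0r sup_norm_ge0.
rewrite mulrC -ler_pdivlMr ?normr_gt0// mulrC -normfV.
by have := le k^-1 (k *: f); rewrite scalerA mulVf// scale1r.
Qed.

Fact sup_normr0_eq0 f : sup_norm f = 0 -> f = 0.
Proof.
move=> f0; apply: coord_inj => i; apply/eqP; rewrite coord0 -normr_eq0 eq_le.
by rewrite normr_ge0 andbT -f0 coord_le_norm.
Qed.

HB.instance Definition _ := Lmodule_isNormed.Build R[i] V
  sup_ler_normD sup_normrZ sup_normr0_eq0.

Fact bounded_fun_cauchy_cvg (F : set_system V) : ProperFilter F -> cauchy F -> cvg F.
Proof.
move=> FF /cauchyP Fc.
have ballE (f g : V) e : ball f e g <-> `|f - g| < e by rewrite -ball_normE.
have lim i : exists l : R[i], forall e : R[i], 0 < e -> F [set f | `|coord i f - l| < e].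
  have [e e0|l Hl] := @complex_complete R (coord i @ F) _.
    have [f Ff] := Fc e e0; exists (coord i f).
    suff : F [set g | `|coord i g - coord i f| < e] by [].
    apply: filterS Ff => g /ballE fg /=.
    rewrite distrC -coordB; exact: le_lt_trans (coord_le_norm _ _) fg.
  by exists l.
pose l i := sval (cid (lim i)).
have lP i e : 0 < e -> F [set f | `|coord i f - l i| < e] := svalP (cid (lim i)) e.
have lclose f e : 0 < e -> F (ball f e) -> forall i, `|coord i f - l i| <= e + e.
  move=> e0 Ff i; have [g [/ballE fg gl]] := filter_ex (filterI Ff (lP i e e0)).
  rewrite -(subrK (coord i g) (coord i f)) -addrA; apply: le_trans (ler_normD _ _) _.
  apply: lerD; last exact: ltW.
  by rewrite -coordB; apply: le_trans (coord_le_norm _ _) _; exact: ltW.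
have [f Ff] := Fc 1 ltr01.
have lb i : `|l i| <= `|f| + (1 + 1).
  rewrite -(subKr (coord i f) (l i)); apply: le_trans (ler_normB _ _) _.
  by rewrite lerD ?coord_le_norm ?lclose.
apply/cvg_ex; exists (bounded_of lb); apply/cvg_ballP => e e0.
(* One quarter for the Cauchy ball, two for the bound in [lclose], and one to keep the inequality
   strict. *)
have e30 : 0 < e / 4 by rewrite divr_gt0.
have [g Fg] := Fc _ e30; apply: filterS (Fg) => k /ballE gk; apply/ballE.
apply: (@le_lt_trans _ _ (e / 4 + (e / 4 + e / 4))).
  apply: sup_norm_le => [|i]; first by rewrite !addr_ge0 ?ltW.
  rewrite coordB -[coord i (bounded_of lb)]/(l i).
  rewrite -(subrK (coord i g) (l i)) -addrA addrC; apply: le_trans (ler_normD _ _) _.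
  apply: lerD; last by rewrite distrC; exact: lclose.
  by rewrite -coordB; apply: le_trans (coord_le_norm _ _) _; exact: ltW.
rewrite [ltRHS](_ : e = e / 4 + (e / 4 + e / 4) + e / 4); last by field.
by rewrite ltrDl.
Qed.

HB.instance Definition _ := Uniform_isComplete.Build V bounded_fun_cauchy_cvg.

Fact delta_bound (i j : I) : `|(`[< j = i >]%:R : R[i])| <= 1.
Proof. by case: asboolP; rewrite ?normr1 ?normr0. Qed.

Definition delta i : V := bounded_of (delta_bound i).

Lemma coord_delta i j : coord j (delta i) = `[< j = i >]%:R.
Proof. by []. Qed.

Lemma coord_delta_eq i : coord i (delta i) = 1.
Proof. by rewrite coord_delta asboolT. Qed.

Lemma coord_delta_neq i j : j <> i -> coord j (delta i) = 0.
Proof. by move=> ji; rewrite coord_delta asboolF. Qed.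

End BoundedFunctionSpace.

Record lie_bracket (R : realType) (V : completeNormedModType R[i]) := LieBracket {
  bracket :> V -> V -> V;
  bracket_linearl : forall b, linear (bracket^~ b);
  bracket_linearr : forall a, linear (bracket a);
  bracket_alternating : forall a, bracket a a = 0;
  bracket_jacobi : forall a b c, bracket a (bracket b c) + bracket b (bracket c a) +
    bracket c (bracket a b) = 0;
  bracket_bounded : exists2 t : R[i], 0 < t &
    forall a b, `|bracket a b| <= t * `|a| * `|b| }.

(** The argument [br] only labels the type, so that one normed space can carry several Lie
    structures. *)
Definition with_bracket (R : realType) (V : completeNormedModType R[i])
  (br : lie_bracket V) : Type := V.

HB.instance Definition _ R V br :=
  CompleteNormedModule.copy (@with_bracket R V br) V.

HB.instance Definition _ R V br := isBanachLie.Build R (@with_bracket R V br)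
  (bracket_linearl br) (bracket_linearr br) (bracket_alternating br)
  (bracket_jacobi br) (bracket_bounded br).

Section CoordinateKernels.
Context {R : realType} {I : Type} (br : lie_bracket (bounded_fun R I)).
Local Notation L := (with_bracket br).
Implicit Types (x y : L).

Definition coord_kernel i : set L := [set x | coord i x = 0].

Lemma coord_kernel_subspace i : linear_subspace (coord_kernel i).
Proof.
split=> [|k x y]; first exact: coord0.
by rewrite /coord_kernel /= coordD coordZ => -> ->; rewrite mulr0 addr0.
Qed.

Lemma coord_kernel_closed i : closed (coord_kernel i).
Proof.
apply/closed_ballP => y Hy; apply: contrapT => /eqP y0.
have [|z z0 yz] := Hy `|coord i y|; first by rewrite normr_gt0.
have : `|coord i y| < `|coord i y|; last by rewrite ltxx.
apply: le_lt_trans yz; apply: le_trans (coord_le_norm i (y - z)).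
by rewrite coordB (z0 : coord i z = 0) subr0.
Qed.

Lemma coord_kernel_codim i : codim_le [set: L] 1 (coord_kernel i).
Proof.
exists (delta i : L) => // x _; exists (coord i x).
by rewrite /coord_kernel /= coordB coordZ coord_delta_eq mulr1 subrr.
Qed.

Lemma coord_kernel_proper i : coord_kernel i <> setT.
Proof.
move=> KT; have : coord_kernel i (delta i : L) by rewrite KT.
by rewrite /coord_kernel /= coord_delta_eq => /eqP; rewrite oner_eq0.
Qed.

Lemma coord_kernel_frakS i :
  (forall x y, coord i x = 0 -> coord i y = 0 -> coord i (lie x y) = 0) ->
  frakS (coord_kernel i).
Proof.
move=> Ki; split; [|exact: coord_kernel_closed| |exact: coord_kernel_proper].
  by split=> //; exact: coord_kernel_subspace.
apply/finite_codimP; first exact: coord_kernel_subspace.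
by exists 1%N; exact: coord_kernel_codim.
Qed.

Lemma coord_kernel_maximal i N : linear_subspace N -> N <> setT ->
  coord_kernel i `<=` N -> N = coord_kernel i.
Proof.
move=> sN nN KN; apply/seteqP; split=> // x Nx; apply: contrapT => nKx.
apply: nN; apply/seteqP; split=> // y _.
have H := codim_le_exchange (coord_kernel_subspace i) (coord_kernel_codim i)
  (Logic.I : setT x) nKx.
exact: (adjoin_min sN KN Nx (H y Logic.I)).
Qed.

Lemma coord_kernel_frakS_max i :
  (forall x y, coord i x = 0 -> coord i y = 0 -> coord i (lie x y) = 0) ->
  frakS_max (coord_kernel i).
Proof.
move=> Ki; split; first exact: coord_kernel_frakS.
by move=> N [[sN _] _ _ nN]; exact: coord_kernel_maximal.
Qed.

End CoordinateKernels.

Lemma set1_0_subspace (R : realType) (L : banachLieType R) :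
  linear_subspace [set 0 : L].
Proof. by split=> // k x y -> ->; rewrite scaler0 addr0. Qed.

Lemma set1_0_closed (R : realType) (L : banachLieType R) : closed [set 0 : L].
Proof.
apply/closed_ballP => y Hy; apply: contrapT => /eqP y0.
have [|z -> yz] := Hy `|y|; first by rewrite normr_gt0.
by move: yz; rewrite subr0 ltxx.
Qed.

Lemma bounded_fun_fin_codim (R : realType) (I : finType)
    (br : lie_bracket (bounded_fun R I)) :
  finite_codim [set 0 : with_bracket br].
Proof.
exists #|I|, (fun k => delta (enum_val k)) => x.
exists (fun k => coord (enum_val k) x).
apply: (@coord_inj R I) => i.
rewrite coordB coord0 [coord i (\sum_ _ _)]raddf_sum (bigD1 (enum_rank i))//= big1.
  by rewrite addr0 coordZ enum_rankK coord_delta_eq mulr1 subrr.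
move=> k ki; rewrite coordZ coord_delta_neq ?mulr0// => ik.
by move/eqP: ki; apply; rewrite ik enum_valK.
Qed.

Lemma addr_idem (V : zmodType) (x : V) : x = x + x -> x = 0.
Proof. by move=> /(congr1 (fun y => y - x)); rewrite subrr addrK. Qed.

(** * Semidirect products by a line and Heisenberg algebras *)

Section LinearBrackets.
Context {R : realType} (V : completeNormedModType R[i]).

(* The semidirect product of the abelian algebra [ker alpha] by a line acting
   through [T]. *)
Section Semidirect.
Context (alpha : V -> R[i]) (T : V -> V).
Context (alphaP : linear_for *%R alpha) (TP : linear T) (aT : forall x, alpha (T x) = 0).
Context (alpha_le : forall x, `|alpha x| <= `|x|) (T_le : forall x, `|T x| <= `|x|).

Definition semidirect x y := alpha x *: T y - alpha y *: T x.

Fact semidirect_linearr a : linear (semidirect a).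
Proof.
move=> k x y; rewrite /semidirect TP alphaP !scalerDr !scalerDl !scalerN !scalerA.
by rewrite [alpha a * k]mulrC opprD addrACA.
Qed.

Fact semidirectC x y : semidirect x y = - semidirect y x.
Proof. by rewrite /semidirect opprB. Qed.

Fact semidirect_linearl b : linear (semidirect^~ b).
Proof.
move=> k x y; rewrite semidirectC semidirect_linearr opprD -scalerN.
by rewrite -!semidirectC.
Qed.

Fact semidirect_alternating a : semidirect a a = 0.
Proof. exact: subrr. Qed.

Fact semidirect_jacobi a b c : semidirect a (semidirect b c) +
  semidirect b (semidirect c a) + semidirect c (semidirect a b) = 0.
Proof.
have TZ k x : T (k *: x) = k *: T x.
  have T0 : T 0 = 0.
    by apply: addr_idem; rewrite -{1}[0]addr0 -{1}[0](scale1r 0) TP scale1r.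
  by have := TP k x 0; rewrite T0 !addr0.
have TB x y : T (x - y) = T x - T y.
  by rewrite addrC -scaleN1r TP scaleN1r addrC.
have aB k x l y : alpha (k *: T x - l *: T y) = 0.
  rewrite -scaleN1r addrC alphaP.
  have aZ m z : alpha (m *: T z) = 0.
    have a0 : alpha 0 = 0.
      by apply: addr_idem; rewrite -{1}[0]addr0 -{1}[0](scale1r 0) alphaP mul1r.
    by have := alphaP m (T z) 0; rewrite addr0 a0 aT mulr0 addr0.
  by rewrite !aZ mulr0 addr0.
rewrite /semidirect !aB !scale0r !subr0 !TB !TZ !scalerBr !scalerA.
rewrite [alpha b * alpha a]mulrC [alpha c * alpha a]mulrC [alpha c * alpha b]mulrC.
set X := (_ *: T (T c)); set Y := (_ *: T (T b)); set Z := (_ *: T (T a)).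
by rewrite addrAC [X - Y + _]addrA subrK addrA subrK subrr.
Qed.

Fact semidirect_bounded : exists2 t : R[i], 0 < t &
  forall a b, `|semidirect a b| <= t * `|a| * `|b|.
Proof.
exists 2 => // a b; apply: le_trans (ler_normB _ _) _.
rewrite !normrZ -mulrA mulr_natl mulr2n; apply: lerD; first by rewrite ler_pM.
by rewrite mulrC ler_pM.
Qed.

Definition semidirect_bracket := LieBracket semidirect_linearl semidirect_linearr
  semidirect_alternating semidirect_jacobi semidirect_bounded.

End Semidirect.

Section Heisenberg.
Context (omega : V -> V -> R[i]) (z : V).
Context (omegal : forall b, linear_for *%R (omega^~ b))
  (omegar : forall a, linear_for *%R (omega a)).
Context (omega_alt : forall a, omega a a = 0) (omega_z : forall a, omega a z = 0).
Context (omega_bounded : exists2 t : R[i], 0 < t &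
  forall a b, `|omega a b| <= t * `|a| * `|b|).

(** Every bracket is a multiple of [z], which lies in the radical of [omega]; all triple brackets
    vanish, and with them the Jacobi sum. *)
Definition heisenberg x y := omega x y *: z.

Fact heisenberg_linearl b : linear (heisenberg^~ b).
Proof. by move=> k x y; rewrite /heisenberg omegal scalerDl scalerA. Qed.

Fact heisenberg_linearr a : linear (heisenberg a).
Proof. by move=> k x y; rewrite /heisenberg omegar scalerDl scalerA. Qed.

Fact heisenberg_alternating a : heisenberg a a = 0.
Proof. by rewrite /heisenberg omega_alt scale0r. Qed.

Fact omega_centerr a k : omega a (k *: z) = 0.
Proof.
have := omegar a k z 0; rewrite omega_z mulr0 add0r addr0 => ->.
by apply: addr_idem; rewrite -{1}[0]addr0 -{1}[0](scale1r 0) omegar mul1r.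
Qed.

Fact heisenberg_jacobi a b c : heisenberg a (heisenberg b c) +
  heisenberg b (heisenberg c a) + heisenberg c (heisenberg a b) = 0.
Proof. by rewrite /heisenberg !omega_centerr !scale0r !addr0. Qed.

Fact heisenberg_bounded : exists2 t : R[i], 0 < t &
  forall a b, `|heisenberg a b| <= t * `|a| * `|b|.
Proof.
have [t t0 Ht] := omega_bounded.
exists (t * (`|z| + 1)) => [|a b]; first by rewrite mulr_gt0// ltr_wpDl.
rewrite normrZ [t * _ * _]mulrAC [t * _ * _ * _]mulrAC; apply: ler_pM => //.
by rewrite lerDl.
Qed.

Definition heisenberg_bracket := LieBracket heisenberg_linearl heisenberg_linearr
  heisenberg_alternating heisenberg_jacobi heisenberg_bounded.

End Heisenberg.

End LinearBrackets.

(** * Examples *)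

Section GeometricLimit.
Context {R : realType}.
Implicit Types (s : nat -> R[i]) (l D : R[i]).

Lemma complex_le_eps (a b : R[i]) : a \is Num.real -> b \is Num.real ->
  (forall e : R[i], 0 < e -> a <= b + e) -> a <= b.
Proof.
move=> ra rb H; rewrite real_leNgt//; apply/negP => ba.
have e0 : 0 < (a - b) / 2 by rewrite divr_gt0// subr_gt0.
have := H _ e0; rewrite real_leNgt//; last by rewrite realD// gtr0_real.
move=> /negP; apply.
rewrite -ltrBrDl [ltRHS](_ : a - b = (a - b) / 2 + (a - b) / 2); last by field.
by rewrite ltrDl.
Qed.

Definition geometric_limit s l :=
  exists D, forall n, `|s n - l| <= D * 2 ^- n.

Lemma geometric_limit_exists s D : 0 <= D ->
  (forall k, `|s k.+1 - s k| <= D * 2 ^- k) ->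
  exists l, forall n, `|s n - l| <= D *+ 2 * 2 ^- n.
Proof.
move=> D0 Hs.
have tail n m : `|s (m + n)%N - s n| <= D *+ 2 * (2 ^- n - 2 ^- (m + n)).
  elim: m => [|m IH]; first by rewrite !subrr normr0 mulr0.
  rewrite -(subrK (s (m + n)%N) (s (m.+1 + n)%N)) -addrA.
  apply: le_trans (ler_normD _ _) _; apply: le_trans (lerD (Hs _) IH) _.
  rewrite addSn exprS invfM; set q := 2 ^- (m + n); set p := 2 ^- n.
  by rewrite [leRHS](_ : _ = D * q + D *+ 2 * (p - q))// mulr2n; field.
have tail' n m : (n <= m)%N -> `|s m - s n| <= D *+ 2 * 2 ^- n.
  move=> /subnK <-; apply: le_trans (tail n _) _.
  by rewrite ler_wpM2l ?mulrn_wge0// gerDl oppr_le0 invr_ge0 exprn_ge0.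
pose F : set_system R[i] := [set A | exists N, forall n, (N <= n)%N -> A (s n)].
have FF : ProperFilter F.
  apply: Build_ProperFilter_ex => [A [N HN]|]; first by exists (s N); exact: HN.
  split; first by exists 0%N.
    move=> A B [N HN] [N' HN']; exists (N + N')%N => n Nn.
    split; [apply: HN|apply: HN']; apply: leq_trans Nn; [exact: leq_addr|exact: leq_addl].
  by move=> A B AB [N HN]; exists N => n /HN/AB.
have [e e0|l Hl] := @complex_complete R F FF.
  have [||||N HN] := @complex_geometric R 2^-1 (D *+ 2) e.
  - by rewrite invr_ge0.
  - by rewrite invf_lt1 ?ltr1n.
  - exact: mulrn_wge0.
  - by [].
  exists (s N), N => n Nn /=; apply: le_lt_trans (tail' _ _ Nn) _.
  by rewrite mulrC -exprVn.
exists l => n; apply: complex_le_eps; rewrite ?normr_real//.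
  by rewrite ger0_real// mulr_ge0 ?mulrn_wge0 ?invr_ge0 ?exprn_ge0.
move=> e e0; have [N HN] := Hl e e0.
rewrite -(subrK (s (N + n)%N) (s n)) -addrA; apply: le_trans (ler_normD _ _) _.
apply: lerD; first by rewrite distrC tail' ?leq_addl.
by apply/ltW/HN; exact: leq_addr.
Qed.

Lemma geometric_limit_unique s l l' :
  geometric_limit s l -> geometric_limit s l' -> l = l'.
Proof.
move=> [D HD] [D' HD']; apply/eqP; rewrite -subr_eq0; apply/eqP.
apply: contrapT => /eqP ll; have ll0 : 0 < `|l - l'| by rewrite normr_gt0.
have D0 : 0 <= D by have := HD 0%N; rewrite expr0 invr1 mulr1; exact: le_trans.
have D0' : 0 <= D' by have := HD' 0%N; rewrite expr0 invr1 mulr1; exact: le_trans.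
have [||||n Hn] := @complex_geometric R 2^-1 (D + D') `|l - l'|.
- by rewrite invr_ge0.
- by rewrite invf_lt1 ?ltr1n.
- exact: addr_ge0.
- by [].
have : `|l - l'| < `|l - l'|; last by rewrite ltxx.
apply: le_lt_trans Hn; rewrite -(subrK (s n) l) -addrA.
apply: le_trans (ler_normD _ _) _; rewrite distrC exprVn mulrC mulrDl.
exact: lerD (HD n) (HD' n).
Qed.

Lemma geometric_limitP s s' k l l' : geometric_limit s l -> geometric_limit s' l' ->
  geometric_limit (fun n => k * s n + s' n) (k * l + l').
Proof.
move=> [D HD] [D' HD']; exists (`|k| * D + D') => n.
rewrite opprD addrACA -mulrBr; apply: le_trans (ler_normD _ _) _.
by rewrite mulrDl lerD// normrM -mulrA ler_wpM2l.
Qed.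

End GeometricLimit.

Section SymplecticForm.
Context {R : realType}.
Local Notation V := (bounded_fun R (option (bool * nat))).
Implicit Types (x y : V).

(** [Some (true, k)] and [Some (false, k)] index conjugate coordinates; [None] is reserved for the
    centre. *)
Definition symplectic_term x y k : R[i] :=
  coord (Some (true, k)) x * coord (Some (false, k)) y -
  coord (Some (false, k)) x * coord (Some (true, k)) y.

(** On bounded sequences the unweighted series need not converge; the weights [2 ^- k] make the form
    bounded and keep its rank infinite. *)
Definition symplectic_sum x y n := \sum_(k < n) 2 ^- k * symplectic_term x y k.

Lemma symplectic_limit x y : exists l, forall n,
  `|symplectic_sum x y n - l| <= (`|x| * `|y|) *+ 2 *+ 2 * 2 ^- n.
Proof.
apply: geometric_limit_exists => [|k]; first by rewrite mulrn_wge0// mulr_ge0.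
rewrite /symplectic_sum big_ord_recr /= addrAC subrr add0r normrM mulrC normfV normrX normr_nat.
rewrite ler_wpM2r ?invr_ge0 ?exprn_ge0// mulr2n.
apply: le_trans (ler_normB _ _) _; rewrite !normrM.
by apply: lerD; apply: ler_pM => //; exact: coord_le_norm.
Qed.

Definition symplectic x y := sval (cid (symplectic_limit x y)).

Lemma symplecticP x y : geometric_limit (symplectic_sum x y) (symplectic x y).
Proof. by exists ((`|x| * `|y|) *+ 2 *+ 2); exact: svalP (cid (symplectic_limit x y)). Qed.

Lemma symplectic_linearl b : linear_for *%R (symplectic^~ b).
Proof.
move=> k x y; apply: geometric_limit_unique (symplecticP _ _) _.
have := geometric_limitP k (symplecticP x b) (symplecticP y b).
congr geometric_limit; apply/funext => n.
rewrite mulr_sumr -big_split; apply: eq_bigr => i _ /=.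
by rewrite /symplectic_term !coordD !coordZ; ring.
Qed.

Lemma symplectic_linearr a : linear_for *%R (symplectic a).
Proof.
move=> k x y; apply: geometric_limit_unique (symplecticP _ _) _.
have := geometric_limitP k (symplecticP a x) (symplecticP a y).
congr geometric_limit; apply/funext => n.
rewrite mulr_sumr -big_split; apply: eq_bigr => i _ /=.
by rewrite /symplectic_term !coordD !coordZ; ring.
Qed.

Lemma symplectic_alternating a : symplectic a a = 0.
Proof.
apply: geometric_limit_unique (symplecticP _ _) _; exists 0 => n.
rewrite mul0r subr0 /symplectic_sum big1 ?normr0// => i _.
by rewrite /symplectic_term [coord (Some (true, _)) a * _]mulrC subrr mulr0.
Qed.

Lemma symplectic_center a : symplectic a (delta None) = 0.
Proof.
apply: geometric_limit_unique (symplecticP _ _) _; exists 0 => n.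
rewrite mul0r subr0 /symplectic_sum big1 ?normr0// => i _.
by rewrite /symplectic_term !coord_delta_neq// !mulr0 subrr mulr0.
Qed.

Lemma symplectic_bounded : exists2 t : R[i], 0 < t &
  forall a b, `|symplectic a b| <= t * `|a| * `|b|.
Proof.
exists 4 => // a b; have := svalP (cid (symplectic_limit a b)) 0%N.
rewrite /symplectic_sum big_ord0 sub0r normrN expr0 invr1 mulr1 => /le_trans; apply.
by rewrite -mulrnA -mulrA mulr_natl.
Qed.

Lemma symplectic_delta a k :
  symplectic a (delta (Some (false, k))) = 2 ^- k * coord (Some (true, k)) a.
Proof.
apply: geometric_limit_unique (symplecticP _ _) _.
(* The partial sums are exact once [k < n]; before that they are 0, with error [2 ^- k] times [|c|],
   at most [2 ^- n] times [|c|]. *)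
set c := coord _ a; exists `|c| => n.
have termE j : symplectic_term a (delta (Some (false, k))) j =
    if j == k then c else 0.
  rewrite /symplectic_term [coord (Some (true, j)) (delta _)]coord_delta_neq//.
  rewrite mulr0 subr0; case: eqVneq => [->|/eqP jk].
    by rewrite coord_delta_eq mulr1.
  by rewrite coord_delta_neq ?mulr0// => -[].
have [kn|nk] := ltnP k n.
  rewrite /symplectic_sum (bigD1 (Ordinal kn))//= termE eqxx big1 ?addr0.
    by rewrite subrr normr0 mulr_ge0// invr_ge0 exprn_ge0.
  move=> i ik; rewrite termE (negPf (_ : nat_of_ord i != k)) ?mulr0//.
rewrite /symplectic_sum big1; last first.
  by move=> i _; rewrite termE ltn_eqF ?mulr0// (leq_trans _ nk).
rewrite sub0r normrN normrM mulrC ler_wpM2l// normfV normrX normr_nat.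
by rewrite lef_pV2 ?posrE ?exprn_gt0// ler_weXn2l// ler1n.
Qed.

End SymplecticForm.

Section Examples.
Context (R : realType).

Section AffineAlgebra.
Local Notation V := (bounded_fun R bool).

Definition affine_op (x : V) : V := coord false x *: delta false.

Fact affine_op_linear : linear affine_op.
Proof. by move=> k x y; rewrite /affine_op coordD coordZ scalerDl scalerA. Qed.

Fact coord_linear_for I (i : I) : linear_for *%R (coord i : bounded_fun R I -> R[i]).
Proof. by []. Qed.

Fact affine_op_ker x : coord true (affine_op x) = 0.
Proof. by rewrite coordZ coord_delta_neq// mulr0. Qed.

Lemma norm_delta_le I (i : I) : `|delta i : bounded_fun R I| <= 1.
Proof. by apply: sup_norm_le => // j; exact: delta_bound. Qed.

Fact affine_op_le x : `|affine_op x| <= `|x|.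
Proof.
rewrite normrZ -[leRHS]mulr1; apply: ler_pM => //; first exact: coord_le_norm.
exact: norm_delta_le.
Qed.

Definition affine_algebra := with_bracket (semidirect_bracket
  (coord_linear_for true) affine_op_linear affine_op_ker
  (@coord_le_norm R bool true) affine_op_le).

Lemma affine_lie (x y : affine_algebra) :
  lie x y = coord true x *: affine_op y - coord true y *: affine_op x.
Proof. by []. Qed.

Lemma coord_true_lie (x y : affine_algebra) : coord true (lie x y) = 0.
Proof. by rewrite affine_lie coordB !coordZ coord_delta_neq// !mulr0 subrr. Qed.

Lemma affine_P_S_max : Sem (@P_S_max R) affine_algebra.
Proof.
apply/seteqP; split=> [x Hx|_ ->]; last exact: (closedSubalgebraP (P_S_max _)).1.1.1.
apply: (@coord_inj R bool) => b; rewrite coord0; apply: (Hx (coord_kernel b)).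
apply: coord_kernel_frakS_max => u v; case: b {Hx}; first by rewrite coord_true_lie.
by rewrite affine_lie /affine_op coordB !coordZ => -> ->; rewrite !mul0r !mulr0 subrr.
Qed.

(** An element with nonzero [true] coordinate brackets [delta false] to a nonzero multiple of it. So
    an ideal without [delta false] lies in [coord_kernel true], a proper ideal that does contain it,
    and is not maximal. *)
Lemma affine_P_J_max : ~ Sem (@P_J_max R) affine_algebra.
Proof.
move=> H; suff : (P_J_max affine_algebra : set affine_algebra) (delta false : affine_algebra).
  rewrite H => /(congr1 (coord false)); rewrite coord_delta_eq coord0 => /eqP.
  by rewrite oner_eq0.
move=> J [[[sJ Jlie] clJ cJ nJ] Jmax]; apply: contrapT => nJd.
have JK : J `<=` coord_kernel true.
  move=> u Ju; apply: contrapT => /eqP ut; apply: nJd.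
  have := Jlie (delta false) u Ju; rewrite affine_lie coord_delta_neq// scale0r sub0r.
  move=> /(subspaceN sJ); rewrite opprK /affine_op coord_delta_eq scale1r.
  by move/(subspaceZV sJ ut).
apply: nJd; rewrite -(Jmax (coord_kernel true)) //.
  by rewrite /coord_kernel /= coord_delta_neq.
have [_ cl fc pr] : frakS (coord_kernel true : set affine_algebra).
  by apply: coord_kernel_frakS => x y _ _; exact: coord_true_lie.
split=> //; split; first exact: coord_kernel_subspace.
by move=> a b _; exact: coord_true_lie.
Qed.

End AffineAlgebra.

Section Heisenberg3.
Local Notation V := (bounded_fun R (option bool)).

Definition heis3_form (x y : V) : R[i] :=
  coord (Some true) x * coord (Some false) y -
  coord (Some false) x * coord (Some true) y.

Fact heis3_linearl b : linear_for *%R (heis3_form^~ b).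
Proof. by move=> k x y; rewrite /heis3_form !coordD !coordZ /=; ring. Qed.

Fact heis3_linearr a : linear_for *%R (heis3_form a).
Proof. by move=> k x y; rewrite /heis3_form !coordD !coordZ /=; ring. Qed.

Fact heis3_alt a : heis3_form a a = 0.
Proof. by rewrite /heis3_form mulrC subrr. Qed.

Fact heis3_center a : heis3_form a (delta None) = 0.
Proof. by rewrite /heis3_form !coord_delta_neq// !mulr0 subrr. Qed.

Fact heis3_bounded : exists2 t : R[i], 0 < t &
  forall a b, `|heis3_form a b| <= t * `|a| * `|b|.
Proof.
exists 2 => // a b; apply: le_trans (ler_normB _ _) _.
rewrite -mulrA mulr_natl mulr2n !normrM.
by apply: lerD; apply: ler_pM => //; exact: coord_le_norm.
Qed.

Definition heisenberg3 := with_bracket (heisenberg_bracket heis3_linearl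
  heis3_linearr heis3_alt heis3_center heis3_bounded).

Lemma heis3_lie (x y : heisenberg3) : lie x y = heis3_form x y *: delta None.
Proof. by []. Qed.

Let z : heisenberg3 := delta None.

Let z_neq0 : z <> 0.
Proof.
move=> /(congr1 (coord None)); rewrite coord_delta_eq coord0 => /eqP.
by rewrite oner_eq0.
Qed.

Lemma heis3_P_J : Sem (@P_J R) heisenberg3.
Proof.
apply/seteqP; split=> [x Hx|_ ->]; last exact: (closedSubalgebraP (P_J _)).1.1.1.
apply: Hx; split.
- by split=> [|a b ->]; [exact: set1_0_subspace|rewrite /= raddf0].
- exact: set1_0_closed.
- exact: bounded_fun_fin_codim.
- by move=> T0; apply: z_neq0; suff : [set 0] z by []; rewrite T0.
Qed.

(** If a maximal [M] missed the central [z], then [M] and [z] would span the algebra, every bracket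
    would come from elements of [M], and [z], itself a bracket, would be in [M]. *)
Lemma heis3_P_S_max : ~ Sem (@P_S_max R) heisenberg3.
Proof.
move=> H; suff : (P_S_max heisenberg3 : set heisenberg3) z by rewrite H; exact: z_neq0.
move=> M [[[sM Mlie] clM cM nM] Mmax]; apply: contrapT => nMz.
have zc a : lie a z = 0 by rewrite heis3_lie heis3_center scale0r.
have UT : adjoin M z = setT.
  apply: contrapT => nU; apply: nMz; rewrite -(Mmax (adjoin M z)).
  - exact: adjoin_id.
  - split=> //; last 2 first.
    + exact: adjoin_closed.
    + apply/finite_codimP; first exact: adjoin_subspace.
      by apply: fin_codim_mono (adjoin_sub z) _; exact/finite_codimP.
    split; first exact: adjoin_subspace.
    move=> _ _ /(adjoinP sM)[a [k [Ma ->]]] /(adjoinP sM)[b [l [Mb ->]]].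
    apply: adjoin_sub; rewrite lieDr lieZr zc scaler0 addr0 lieC lieDr lieZr zc.
    by rewrite scaler0 addr0 -lieC; exact: Mlie.
  - exact: adjoin_sub.
have decomp x : exists2 m, M m & forall y, lie y x = lie y m.
  have : adjoin M z x by rewrite UT.
  move=> /(adjoinP sM)[m [k [Mm ->]]]; exists m => // y.
  by rewrite lieDr lieZr zc scaler0 addr0.
have [m Mm mE] := decomp (delta (Some true)).
have [n Mn nE] := decomp (delta (Some false)).
apply: nMz; have -> : z = lie m n; last exact: Mlie.
rewrite -nE lieC -mE -lieC heis3_lie /heis3_form !coord_delta_eq.
by rewrite !coord_delta_neq// mul0r subr0 mulr1 scale1r.
Qed.

End Heisenberg3.
End Examples.

Section ShiftAlgebra.
Context (R : realType).
Local Notation V := (bounded_fun R nat).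

Fact shift_bound (x : V) n : `|if n is m.+1 then coord m.+2 x else 0| <= `|x|.
Proof. by case: n => [|n]; rewrite ?normr0//; exact: coord_le_norm. Qed.

(** Coordinate 0 is the functional of the semidirect product; the shift acts on the coordinates from
    1 on and kills [delta 1]. *)
Definition shift_op (x : V) : V := bounded_of (shift_bound x).

Lemma coord_shift_op n x : coord n.+1 (shift_op x) = coord n.+2 x. Proof. by []. Qed.

Fact coord0_shift_op x : coord 0%N (shift_op x) = 0. Proof. by []. Qed.

Fact shift_op_linear : linear shift_op.
Proof.
move=> k x y; apply: coord_inj => -[|n]; first by rewrite coordD coordZ mulr0 addr0.
by rewrite coordD coordZ !coord_shift_op coordD coordZ.
Qed.

Fact shift_op_le x : `|shift_op x| <= `|x|.
Proof. by apply: sup_norm_le => // n; exact: shift_bound. Qed.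

Definition shift_algebra := with_bracket (semidirect_bracket
  (@coord_linear_for R nat 0%N) shift_op_linear coord0_shift_op
  (@coord_le_norm R nat 0%N) shift_op_le).

Lemma shift_lie (x y : shift_algebra) :
  lie x y = coord 0%N x *: shift_op y - coord 0%N y *: shift_op x.
Proof. by []. Qed.

Let K i : set shift_algebra := coord_kernel i.

(** The hyperplane [K 0] is abelian, so each of its subspaces is a subalgebra, in particular its
    traces on the [K n]. *)
Lemma shift_P_S : Sem (@P_S R) shift_algebra.
Proof.
apply/seteqP; split=> [x Hx|_ ->]; last exact: (closedSubalgebraP (P_S _)).1.1.1.
apply: (@coord_inj R nat) => n; rewrite coord0.
have K0 i : linear_subspace (K i) by exact: coord_kernel_subspace.
have cK i : fin_codim [set: shift_algebra] (K i).
  by exists 1%N; exact: coord_kernel_codim.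
suff [] : (K 0%N `&` K n) x by [].
apply: Hx; split.
- split; first exact: subspaceI.
  move=> a b [a0 _] [b0 _]; rewrite shift_lie a0 b0 !scale0r subrr.
  exact: (subspace0 (subspaceI (K0 _) (K0 _))).
- by apply: closedI; exact: coord_kernel_closed.
- apply/finite_codimP; first exact: subspaceI.
  exact: fin_codimI.
- move=> KT; have HT y : (K 0%N `&` K n) y by rewrite KT.
  have nK : K 0%N <> setT by exact: coord_kernel_proper.
  by apply: nK; apply/seteqP; split=> // y _; case: (HT y).
Qed.

Lemma shift_delta n : lie (delta 0%N : shift_algebra) (delta n.+2) = delta n.+1.
Proof.
rewrite shift_lie coord_delta_eq coord_delta_neq// scale1r scale0r subr0.
apply: (@coord_inj R nat) => -[|m]; first by rewrite coord_delta_neq.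
rewrite coord_shift_op !coord_delta; congr (_ : bool)%:R.
by apply/asbool_equiv_eq; split=> -[->].
Qed.

Lemma shift_delta1 : lie (delta 0%N : shift_algebra) (delta 1%N) = 0.
Proof.
rewrite shift_lie coord_delta_eq coord_delta_neq// scale1r scale0r subr0.
by apply: (@coord_inj R nat) => -[|m] //; rewrite coord_shift_op coord_delta_neq.
Qed.

(* Modulo an ideal of finite codimension some [d k] depends on the [d i], [i < k];
   the [k]-th power of the shift kills the latter and maps [d k] to [d 0]. *)
Lemma shift_P_J : ~ Sem (@P_J R) shift_algebra.
Proof.
pose d n : shift_algebra := delta n.+1.
move=> H; suff : (P_J shift_algebra : set shift_algebra) (d 0%N).
  rewrite H => /(congr1 (coord 1%N)); rewrite coord_delta_eq coord0 => /eqP.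
  by rewrite oner_eq0.
move=> J [[sJ Jlie] clJ /(finite_codimP sJ) [n Hn] nJ].
pose A := iter _ (lie (delta 0%N : shift_algebra)).
have iterD0 m i : A (m + i)%N (d i) = if m is 0 then d 0%N else 0.
  elim: i m => [|i IH] m.
    rewrite addn0; elim: m => [//|m IH]; rewrite /A iterSr shift_delta1.
    exact: iter_lie0.
  by rewrite addnS /A iterSr shift_delta; exact: IH.
have [k _ [c Hc]] := dependent d sJ Hn.
have JA m x : J x -> J (A m x) by move=> Jx; elim: m => //= m; exact: Jlie.
have := JA k _ Hc; rewrite /A -scaleN1r iter_lieD iter_lieZ iter_lie_sum.
have -> : iter k (lie (delta 0%N : shift_algebra)) (d k) = d 0%N := iterD0 0%N k.
rewrite big1 ?scaler0 ?addr0// => i _; rewrite iter_lieZ.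
suff -> : iter k (lie (delta 0%N : shift_algebra)) (d i) = 0 by rewrite scaler0.
have := iterD0 (k - i)%N i; rewrite subnK; last exact: ltnW.
by rewrite /A => ->; rewrite -(subnSK (ltn_ord i)).
Qed.

End ShiftAlgebra.

Section InfiniteHeisenberg.
Context (R : realType).

Definition infinite_heisenberg := with_bracket (heisenberg_bracket
  (@symplectic_linearl R) (@symplectic_linearr R) (@symplectic_alternating R)
  (@symplectic_center R) (@symplectic_bounded R)).
Local Notation H := infinite_heisenberg.

Let z : H := delta None.

Lemma infinite_heisenberg_lie (x y : H) : lie x y = symplectic x y *: z.
Proof. by []. Qed.

Let z_neq0 : z <> 0.
Proof.
move=> /(congr1 (coord None)); rewrite coord_delta_eq coord0 => /eqP.
by rewrite oner_eq0.
Qed.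

(* A subalgebra of finite codimension not containing [z] would be isotropic,
   although the form has infinite rank. *)
Lemma infinite_heisenberg_P_S : ~ Sem (@P_S R) H.
Proof.
move=> H0; suff : (P_S H : set H) z by rewrite H0; exact: z_neq0.
move=> M [[sM Mlie] clM /(finite_codimP sM) cM nM]; apply: contrapT => nMz.
have iso a b : M a -> M b -> symplectic a b = 0.
  move=> Ma Mb; apply: contrapT => /eqP ab0; apply: nMz.
  by apply: (subspaceZV sM ab0); rewrite -infinite_heisenberg_lie; exact: Mlie.
have [r _ Hr] := fin_codim_span sM (subspace_setT (L := H)) (@subsetT _ M) cM.
pose K (e : H) : set H := [set x | symplectic x e = 0].
have sK e : linear_subspace (K e).
  split=> [|k x y]; rewrite /K /=; last first.
    by rewrite (symplectic_linearl e) => -> ->; rewrite mulr0 addr0.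
  by apply: addr_idem; rewrite -{1}[0]addr0 -{1}[0](scale1r 0) (symplectic_linearl e) mul1r.
have cK e : fin_codim [set: H] (K e).
  have [KT|] := pselect (forall x, K e x); first by exists 0%N => x _; exact: KT.
  move=> /existsNP [x /eqP xe]; exists 1%N, x => // y _.
  exists (symplectic y e / symplectic x e).
  rewrite /K /= addrC -scaleNr (symplectic_linearl e) mulNr divfK// addrC subrr //.
have sub := subspace_setT (L := H).
(* The elements of [M] orthogonal to the list [r] still have finite codimension, and since [M] is
   isotropic they are orthogonal to all of [L]. *)
have [n Hn] := fin_codim_big r sK cK sM cM.
pose v k : H := delta (Some (true, k)).
have sN : linear_subspace [set x | M x /\ forall e, List.In e r -> K e x].
  split=> [|k x y [Mx Kx] [My Ky]].
    by split=> [|e _]; [exact: subspace0|exact: (subspace0 (sK e))].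
  by split=> [|e er]; [exact: sM.2|apply: (sK e).2; [exact: Kx|exact: Ky]].
have [k _ [c]] := dependent v sN Hn.
set p := v k - _ => -[Mp Kp].
have pL : forall y : H, symplectic p y = 0.
  move=> y; apply: (Hr [set y | symplectic p y = 0]) => //.
  - split=> [|l a b] /=; last first.
      by rewrite (symplectic_linearr p) => -> ->; rewrite mulr0 addr0.
    by apply: addr_idem; rewrite -{1}[0]addr0 -{1}[0](scale1r 0) (symplectic_linearr p) mul1r.
  - by move=> m Mm; exact: iso.
(* [k] is the last index in [p], with coefficient 1, so the form takes the nonzero value [2 ^- k]
   here. *)
have := pL (delta (Some (false, k))).
rewrite symplectic_delta coordB coord_delta_eq [coord _ (\sum_ _ _)]raddf_sum big1.
  by rewrite subr0 mulr1 => /eqP; rewrite invr_eq0 expf_eq0 pnatr_eq0 andbF.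
move=> i _; rewrite [LHS]coordZ coord_delta_neq ?mulr0// => -[ki].
by have := ltn_ord i; rewrite -ki ltnn.
Qed.

(** The coordinate hyperplanes through [z] contain all brackets, so they are subalgebras and confine
    the Frattini radical to the line of [z]. Were it nonzero, [0] would be a proper subalgebra of
    finite codimension in it. *)
Lemma infinite_heisenberg_frattini : Sem (@frattini R) H.
Proof.
have [_ fixed] := iterated_valueP (@P_S R) H.
have PS := apply_sub_fixed fixed; rewrite -/(frattini H) in PS.
set M := frattini H in PS *.
have M0 : (M : set H) 0 := (closedSubalgebraP M).1.1.1.
have MK j : (M : set H) `<=` (coord_kernel (Some j) : set H).
  apply: (radical_subalgebra PS); apply: coord_kernel_frakS => a b _ _.
  by rewrite infinite_heisenberg_lie coordZ coord_delta_neq// mulr0.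
have coordM j x : (M : set H) x -> coord (Some j) x = 0 by exact: MK.
have Mz x : (M : set H) x -> x = coord None x *: z.
  move=> Mx; apply: (@coord_inj R) => -[j|]; rewrite coordZ.
    by rewrite coordM// coord_delta_neq// mulr0.
  by rewrite coord_delta_eq mulr1.
apply/seteqP; split=> [x Mx|_ ->//]; apply: contrapT => /eqP x0.
pose S := sub_banachLie M.
pose s : S := SubBanachLie (introT (sub_predP M x) Mx).
have s0 : s <> 0 by move=> /(congr1 val); exact/eqP.
have xN0 : coord None x != 0.
  by apply: contra_neq x0 => c0; rewrite (Mz x Mx) c0 scale0r.
have F0 : frakS [set 0 : S].
  split.
  - split; first exact: set1_0_subspace.
    by move=> a b -> _ /=; rewrite lie0l.
  - exact: set1_0_closed.
  - apply/finite_codimP; first exact: set1_0_subspace.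
    exists 1%N, s => // t _; exists (coord None (sub_val t) / coord None x).
    apply: val_inj; have Mt : (M : set H) (sub_val t).
      by apply/sub_predP; exact: sub_valP.
    transitivity (sub_val t - (coord None (sub_val t) / coord None x) *: x : H).
      by [].
    have xE := Mz _ Mx; rewrite [X in _ - _ *: X]xE scalerA divfK//.
    by rewrite -(Mz _ Mt) subrr.
  - by move=> T0; apply: s0; suff : [set 0] s by []; rewrite T0.
apply: s0; have : (P_S S : set S) s by rewrite PS.
by move=> /(_ _ F0).
Qed.

End InfiniteHeisenberg.

Theorem mainTheorem2 (R : realType) :
  [/\ class_eq (Rad (@frattini R)) (Rad (@P_S R)),
      class_eq (Rad (@P_S R)) (Rad (@P_S_max R)),
      class_eq (Rad (@P_S_max R)) (Rad (@P_J R))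
    & class_eq (Rad (@P_J R)) (Rad (@P_J_max R))]
  /\
  [/\ class_proper (Sem (@P_J_max R)) (Sem (@P_S_max R)),
      class_proper (Sem (@P_S_max R)) (Sem (@P_J R)),
      class_proper (Sem (@P_J R)) (Sem (@P_S R))
    & class_proper (Sem (@P_S R)) (Sem (@frattini R))].
Proof.
split; split.
- exact: Rad_P_S_frattini.
- exact: Rad_P_S_P_S_max.
- exact: Rad_P_S_max_P_J.
- exact: Rad_P_J_P_J_max.
- split=> [L|]; first by apply: Sem_mono; exact: P_S_max_sub_P_J_max.
  exists (affine_algebra R); split; [exact: affine_P_S_max|exact: affine_P_J_max].
- split=> [L|]; first by apply: Sem_mono; exact: P_J_sub_P_S_max.
  exists (heisenberg3 R); split; [exact: heis3_P_J|exact: heis3_P_S_max].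
- split=> [L|]; first by apply: Sem_mono; exact: P_S_sub_P_J.
  exists (shift_algebra R); split; [exact: shift_P_S|exact: shift_P_J].
- split=> [L|]; first by apply: Sem_mono; exact: frattini_sub_P_S.
  exists (infinite_heisenberg R); split.
    exact: infinite_heisenberg_frattini.
  exact: infinite_heisenberg_P_S.
Qed.
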